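(* For each $n$ let $d=d_n\ge 2$ be an integer and let $C=C^{(n)}$ be the copula of the i.i.d. $d_n$-dimensional vectors $\boldsymbol X_1,\dots,\boldsymbol X_n$ (the $n$-th row of a triangular array, all rows defined on a common probability space). Suppose that every $C^{(n)}$ satisfies the second-order regularity condition for bivariate margins (stated in the context) with a constant $K$ that does not depend on $n$ and $C^{(n)}$, and that $\log d_n=o(n^{1/3})$. Let $\gamma\in\{\rho,\tau,\beta\}$. Then \[ \max_{I\in\mathcal I_2(d)}\big|\sqrt n\{\hat\gamma_{n,I}-\gamma_I\}-S_{n,I}^{\gamma}\big| = O_{\mathrm{a.s.}}\big(n^{-1/4}(\log(nd))^{3/4}\big)=o_{\mathrm{a.s.}}(1). \]
   Context: Setting. For each $n$, $\boldsymbol X_1,\dots,\boldsymbol X_n$ are i.i.d. in $\mathbb R^{d}$, $d=d_n$ (upper index $(n)$ suppressed), with continuous marginal cdfs $F_1,\dots,F_d$ and copula $C=C^{(n)}$. $U_{ij}=F_j(X_{ij})$, $\boldsymbol U_i=(U_{i1},\dots,U_{id})$; $R_{ij}$ is the (max-)rank of $X_{ij}$ among $X_{1j},\dots,X_{nj}$; $\hat U_{ij}=R_{ij}/n$. $\mathcal I_2(d)=\{I\subset\{1,\dots,d\}:|I|=2\}$. For $I=\{\ell,m\}$ with $\ell<m$, $C_I$ is the bivariate $I$-margin of $C$ (copula of $(U_{1\ell},U_{1m})$), $\hat C_{n,I}(u,v)=\frac1n\sum_{i=1}^n\mathbf 1(\hat U_{i\ell}\le u,\hat U_{im}\le v)$,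 and $\Pi_2(u,v)=uv$. Second-order regularity condition for bivariate margins (with constant $K$): let $W_2=\{\boldsymbol u\in[0,1]^d:|\{j:u_j<1\}|\le2\}$ and $V_j=\{\boldsymbol u\in[0,1]^d:u_j\in(0,1)\}$. For each $j$ the first-order partial derivative $\dot C_j$ exists and is continuous on $V_j\cap W_2$; for each $i,j$ the second-order partial derivative $\ddot C_{ij}$ exists and is continuous on $V_i\cap V_j\cap W_2$; and for all $i,j\in\{1,\dots,d\}$, $|\ddot C_{ij}(\boldsymbol u)|\le K\min\big(\frac1{u_j(1-u_j)},\frac1{u_i(1-u_i)}\big)$ for all $\boldsymbol u\in V_i\cap V_j\cap W_2$. Association measures (Spearman's rho, Kendall's tau, Blomqvist's beta), for $I=\{\ell,m\}$: \[\rho_I=12\int C_I\,d\Pi_2-3,\quad \tau_I=4\int C_I\,dC_I-1,\quad \beta_I=4C_I(\tfrac12,\tfrac12)-1,\] with sample versions \[\hat\rho_{n,I}=1-\frac{6\sum_{i=1}^n(R_{i\ell}-R_{im})^2}{n(n-1)(n+1)},\quad \hat\tau_{n,I}=\frac{2}{n(n-1)}\sum_{1\le i<j\le n}\mathrm{sgn}(X_{i\ell}-X_{j\ell})\,\mathrm{sgn}(X_{im}-X_{jm}),\quad \hat\beta_{n,I}=4\hat C_{n,I}(\tfrac12,\tfrac12)-1.\] ($\gamma_I$ and $\hat\gamma_{n,I}$ denote the quantities for the chosen $\gamma\in\{\rho,\tau,\beta\}$.) Linearizing functions, for $\boldsymbol u\in[0,1]^d$ and $I=\{\ell,m\}$: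 \[g_I^\rho(\boldsymbol u)=12(1-u_\ell)(1-u_m)-36\int\Pi_2\,dC_I+12\int_0^1\{C_I(u_\ell,z)+C_I(z,u_m)\}\,dz,\] \[g_I^\tau(\boldsymbol u)=8C_I(u_\ell,u_m)-4u_\ell-4u_m+2-2\tau_I,\] \[g_I^\beta(\boldsymbol u)=4\Big[\mathbf 1(u_\ell\le\tfrac12,u_m\le\tfrac12)-C_I(\tfrac12,\tfrac12)-\dot C_{I,\ell}(\tfrac12,\tfrac12)\{\mathbf 1(u_\ell\le\tfrac12)-\tfrac12\}-\dot C_{I,m}(\tfrac12,\tfrac12)\{\mathbf 1(u_m\le\tfrac12)-\tfrac12\}\Big],\] where $\dot C_{I,\ell},\dot C_{I,m}$ are the partial derivatives of $C_I$ with respect to the coordinates $u_\ell$ and $u_m$. Finally $S_{n,I}^\gamma=\frac1{\sqrt n}\sum_{i=1}^n g_I^\gamma(\boldsymbol U_i)$. $X_n=O_{\mathrm{a.s.}}(a_n)$ means $\limsup_n|X_n|/a_n<\infty$ almost surely; $o_{\mathrm{a.s.}}(1)$ means almost sure convergence to $0$. *)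

(* Defs.v *)
From HB Require Import structures.
From mathcomp Require Import all_boot all_order all_algebra.
From mathcomp Require Import all_classical all_reals all_analysis.
From mathcomp Require Import measurable_realfun.

Set Implicit Arguments.
Unset Strict Implicit.
Unset Printing Implicit Defensive.

Import Order.TTheory GRing.Theory Num.Theory.
Import numFieldNormedType.Exports.

Local Open Scope classical_set_scope.
Local Open Scope ring_scope.

Section Independence.
Context {d0 d1} {T : measurableType d0} {E : measurableType d1} {R : realType}.
Variable P : probability T R.

Definition mutually_independent (n : nat) (X : 'I_n -> {RV P >-> E}) : Prop :=
  forall (J : {set 'I_n}) (A : 'I_n -> set E),
    (forall i, measurable (A i)) ->
    P (\bigcap_(i in [set` J]) (X i @^-1` A i)) =
    (\prod_(i in J) P (X i @^-1` A i))%E.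

(* The laws are only compared on measurable sets: a measure is a function on
   all subsets of [E], with irrelevant values on the nonmeasurable ones. *)
Definition iid_sample (law : probability E R) (n : nat)
    (X : 'I_n -> {RV P >-> E}) : Prop :=
  mutually_independent X /\
  (forall i (A : set E), measurable A -> distribution P (X i) A = law A).

End Independence.

(* Points of R^d at which measurability matters are tuples (Borel product
   sigma-algebra); points of [0,1]^d at which the copula is evaluated and
   differentiated are row vectors (normed module structure). *)

Section Copula.
Context {R : realType} {d : nat}.
Variable law : probability (d.-tuple R) R.

Definition tuple_coord (j : 'I_d) (x : d.-tuple R) : R := tnth x j.

Fact measurable_tuple_coord j : measurable_fun setT (tuple_coord j).
Proof. exact: measurable_tnth. Qed.

HB.instance Definition _ j :=
  isMeasurableFun.Build _ _ _ _ (tuple_coord j) (measurable_tuple_coord j).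

Definition marginal_cdf (j : 'I_d) (x : R) : R :=
  fine (cdf (tuple_coord j : {RV law >-> R}) x).

(* x |-> (F_1(x_1), ..., F_d(x_d)) *)
Definition pit (x : d.-tuple R) : d.-tuple R :=
  [tuple marginal_cdf j (tnth x j) | j < d].

Fact measurable_pit : measurable_fun setT pit.
Proof.
apply/measurable_fun_tnthP => j.
have -> : (tnth (T:=R))^~ j \o pit = marginal_cdf j \o tuple_coord j.
  by apply/funext => x /=; rewrite tnth_mktuple.
apply: measurableT_comp; last exact: measurable_tuple_coord.
apply: nondecreasing_measurable => // r s rs.
by rewrite fine_le ?fin_num_measure// cdf_nondecreasing.
Qed.

HB.instance Definition _ := isMeasurableFun.Build _ _ _ _ pit measurable_pit.

Definition copula_law : set (d.-tuple R) -> \bar R :=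
  distribution law (pit : {RV law >-> d.-tuple R}).

HB.instance Definition _ := Probability.on copula_law.

(* For continuous marginals (the only case used), the copula is the joint cdf
   of (F_1(X_1), ..., F_d(X_d)).  It is a total function, but only its values
   on [0,1]^d are relevant. *)
Definition copula (u : 'rV[R]_d) : R :=
  fine (copula_law [set v : d.-tuple R | forall j, tnth v j <= u 0 j]).

Definition bimargin (l m : 'I_d) (s t : R) : R :=
  copula (\row_j (if j == l then s else if j == m then t else 1)).

Definition tuple_coordpair (l m : 'I_d) (v : d.-tuple R) : R * R :=
  (tnth v l, tnth v m).

Fact measurable_tuple_coordpair l m :
  measurable_fun setT (tuple_coordpair l m).
Proof. by apply: measurable_fun_pair; exact: measurable_tnth. Qed.

HB.instance Definition _ l m :=
  isMeasurableFun.Build _ _ _ _ (tuple_coordpair l m)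
    (measurable_tuple_coordpair l m).

(* the measure dC_I on the plane *)
Definition bimargin_law (l m : 'I_d) : set (R * R) -> \bar R :=
  distribution copula_law
    (tuple_coordpair l m : {RV copula_law >-> (R * R)%type}).

HB.instance Definition _ l m := Probability.on (bimargin_law l m).

End Copula.

Section Regularity.
Context {R : realType} {d : nat}.

Definition partial (j : 'I_d) (f : 'rV[R]_d -> R) (u : 'rV[R]_d) : R :=
  'D_(delta_mx 0 j) f u.

Definition partially_derivable (j : 'I_d) (f : 'rV[R]_d -> R)
  (u : 'rV[R]_d) : Prop := derivable f u (delta_mx 0 j).

Definition Wset2 : set 'rV[R]_d :=
  [set u : 'rV[R]_d | (forall j, 0 <= u 0 j <= 1) /\
           (#|[pred j : 'I_d | (u 0 j < 1)%R]| <= 2)%N].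

Definition Vset (j : 'I_d) : set 'rV[R]_d :=
  [set u : 'rV[R]_d | (forall k, 0 <= u 0 k <= 1) /\ 0 < u 0 j < 1].

(* Moving the coordinate j slightly from a point of [Vset j `&` Wset2] stays in
   that set, so the (two-sided) derivatives below depend only on values of [C]
   on [0,1]^d, and the second-order ones only on values of [partial j C] at
   points where it exists. *)
Definition second_order_regular (K : R) (C : 'rV[R]_d -> R) : Prop :=
  [/\ forall j,
        (forall u, (Vset j `&` Wset2) u -> partially_derivable j C u) /\
        {within Vset j `&` Wset2, continuous (partial j C)},
      forall i j,
        (forall u, (Vset i `&` Vset j `&` Wset2) u ->
          partially_derivable i (partial j C) u) /\
        {within Vset i `&` Vset j `&` Wset2,
          continuous (partial i (partial j C))} &
      forall i j u, (Vset i `&` Vset j `&` Wset2) u ->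
        `|partial i (partial j C) u| <=
        K * Num.min (u 0 j * (1 - u 0 j))^-1 (u 0 i * (1 - u 0 i))^-1].

End Regularity.

Inductive measure_kind := Spearman | Kendall | Blomqvist.

Section Association.
Context {R : realType} {d : nat}.
Variable law : probability (d.-tuple R) R.
Variables l m : 'I_d.

Local Notation C := (bimargin law l m).
Local Notation dC := (bimargin_law law l m).
Local Notation dPi := (@lebesgue_measure R \x @lebesgue_measure R)%E.
Local Notation I01 := (`[0, 1]%classic : set R).
Local Notation half := (2^-1 : R).

Definition spearman : R := 12 * (\int[dPi]_(z in I01 `*` I01) C z.1 z.2) - 3.

Definition kendall : R := 4 * (\int[dC]_(z in I01 `*` I01) C z.1 z.2) - 1.

Definition blomqvist : R := 4 * C half half - 1.

Definition assoc (g : measure_kind) : R :=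
  match g with
  | Spearman => spearman
  | Kendall => kendall
  | Blomqvist => blomqvist
  end.

Definition lin_spearman (u : d.-tuple R) : R :=
  12 * (1 - tnth u l) * (1 - tnth u m)
  - 36 * (\int[dC]_(z in I01 `*` I01) (z.1 * z.2))
  + 12 * (\int[@lebesgue_measure R]_(z in I01)
            (C (tnth u l) z + C z (tnth u m))).

Definition lin_kendall (u : d.-tuple R) : R :=
  8 * C (tnth u l) (tnth u m) - 4 * tnth u l - 4 * tnth u m + 2 - 2 * kendall.

Definition lin_blomqvist (u : d.-tuple R) : R :=
  4 * (((tnth u l <= half) && (tnth u m <= half))%:R - C half half
       - derive1 (fun s => C s half) half * ((tnth u l <= half)%R%:R - half)
       - derive1 (fun t => C half t) half * ((tnth u m <= half)%R%:R - half)).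

Definition lin (g : measure_kind) : d.-tuple R -> R :=
  match g with
  | Spearman => lin_spearman
  | Kendall => lin_kendall
  | Blomqvist => lin_blomqvist
  end.

End Association.

Section Sample.
Context {R : realType} {d n : nat}.
Variable x : 'I_n -> d.-tuple R.

(* maximal rank of x_ij among x_1j, ..., x_nj *)
Definition rank (i : 'I_n) (j : 'I_d) : nat :=
  #|[pred k : 'I_n | (tnth (x k) j <= tnth (x i) j)%R]|.

Definition pseudo_obs (i : 'I_n) (j : 'I_d) : R := (rank i j)%:R / n%:R.

Definition empirical_copula (l m : 'I_d) (s t : R) : R :=
  n%:R^-1 * \sum_(i < n) ((pseudo_obs i l <= s) && (pseudo_obs i m <= t))%:R.

Definition spearman_hat (l m : 'I_d) : R :=
  1 - 6 * (\sum_(i < n) ((rank i l)%:R - (rank i m)%:R) ^+ 2)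
      / (n%:R * (n%:R - 1) * (n%:R + 1)).

Definition kendall_hat (l m : 'I_d) : R :=
  2 / (n%:R * (n%:R - 1)) *
  \sum_(i < n) \sum_(j < n | (i < j)%N)
    Num.sg (tnth (x i) l - tnth (x j) l) * Num.sg (tnth (x i) m - tnth (x j) m).

Definition blomqvist_hat (l m : 'I_d) : R :=
  4 * empirical_copula l m 2^-1 2^-1 - 1.

Definition assoc_hat (g : measure_kind) : 'I_d -> 'I_d -> R :=
  match g with
  | Spearman => spearman_hat
  | Kendall => kendall_hat
  | Blomqvist => blomqvist_hat
  end.

Variable law : probability (d.-tuple R) R.

Definition lin_sum (g : measure_kind) (l m : 'I_d) : R :=
  (Num.sqrt n%:R)^-1 * \sum_(i < n) lin law l m g (pit law (x i)).

(* A two-element set I of coordinates is encoded as a pair (l, m) with l < m;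
   the default value 0 of the maximum is harmless, the terms being >= 0. *)
Definition max_lin_error (g : measure_kind) : R :=
  \big[Num.max/0]_(I : 'I_d * 'I_d | (I.1 < I.2)%N)
    `|Num.sqrt n%:R * (assoc_hat g I.1 I.2 - assoc law I.1 I.2 g)
      - lin_sum g I.1 I.2|.

End Sample.

Section AlmostSure.
Context {d0} {T : measurableType d0} {R : realType}.
Variable P : probability T R.

Definition bigO_as (Z : nat -> T -> R) (a : nat -> R) : Prop :=
  {ae P, forall w, (limn_esup (fun n => (`|Z n w| / a n)%:E) < +oo)%E}.

Definition littleo1_as (Z : nat -> T -> R) : Prop :=
  {ae P, forall w, Z n w @[n --> \oo] --> (0 : R)}.

End AlmostSure.

(* Main.v *)
(* Discretise [0, 1] into N = 2n cells.  Up to O(1/n), each sample measure, each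
   population measure and each linearizing sum is an expression in the
   frequencies [ph] and the probabilities [p] of the cells of the unit square.
   Let t^4 = ln (n d) / n and D = [ph] - [p].  By Bernstein's inequality, a union
   bound over the O(d^2 n^4) index rectangles and the Borel-Cantelli lemma,
   almost surely, for all large n,
     |D(A)| <= 13 (t^2 sqrt (p(A)) + t^4)  for all rectangles A of cells;
   everything else is deterministic.  A line of cells then has frequency O(t^4),
   so that ties are harmless.  The linearization errors of Kendall's tau and
   Spearman's rho are bilinear forms in D, with kernels 1(a' <= a) 1(b' <= b)
   and 1(a' <= a) 1(c < b); that of Blomqvist's beta is an oscillation of D
   over strips of width O(t^2) and a Taylor remainder of the copula, the only
   place where its smoothness is used.  All of them are O(t^3), and
   sqrt n t^3 = n^(-1/4) (ln (n d))^(3/4). *)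
Require Import Defs.
From HB Require Import structures.
From mathcomp Require Import all_boot all_order all_algebra.
From mathcomp Require Import all_classical all_reals all_analysis.
From mathcomp Require Import measurable_realfun.
From mathcomp Require Import ring lra zify.

Set Implicit Arguments.
Unset Strict Implicit.
Unset Printing Implicit Defensive.

Import Order.TTheory GRing.Theory Num.Theory.
Import numFieldNormedType.Exports.

Local Open Scope classical_set_scope.
Local Open Scope ring_scope.

(** * Bilinear forms in the deviations of cell frequencies *)

(** The obvious bound on a bilinear form in D, total variation times the supremum over rectangles,
    is only O(t^2), one factor t short. The gain comes from the factor sqrt (p(A)): over J disjoint
    blocks the deviations t^2 sqrt(p) add up, by Cauchy-Schwarz, to at most t^2 sqrt(J), and a strip
    of mass O(t^2) has deviation O(t^3) only. Both facts need the bound for all rectangles at once;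
    the grid makes these a finite family, of size polynomial in n and d. The mesh 1/(2n) is fine
    enough because 1/n <= t^4 for large n, so that discretization errors are absorbed in t^3. The
    number 13 is the k for which the exponent (k - 1)/2 of the deviation bound is 6: (n d)^-6 beats
    the d^2 n^4 rectangles and leaves the summable n^-2. The assumption on log d makes t and sqrt n
    t^3 tend to 0: the latter is (ln (n d) / n^(1/3))^(3/4). *)

Lemma sum_sqrt_le {R : realType} (J : finType) (S : pred J) (x : J -> R) :
  (forall j, 0 <= x j) ->
  \sum_(j | S j) Num.sqrt (x j)
  <= Num.sqrt (#|S|%:R * \sum_(j | S j) x j).
Proof.
move=> x0.
have s0 : 0 <= \sum_(j | S j) Num.sqrt (x j) by rewrite sumr_ge0.
rewrite -[leLHS]ger0_norm// -sqrtr_sqr ler_wsqrtr// expr2.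
rewrite big_distrlr/=.
have -> : #|S|%:R * \sum_(j | S j) x j =
    \sum_(i | S i) \sum_(j | S j) (x i + x j) / 2.
  transitivity (\sum_(i | S i) (#|S|%:R * x i + \sum_(j | S j) x j) / 2).
    rewrite -mulr_suml big_split/= -mulr_sumr sumr_const -mulr_natl.
    by field.
  by apply: eq_bigr => i _; rewrite -mulr_suml big_split/= sumr_const mulr_natl.
rewrite ler_sum// => i Si; rewrite ler_sum// => j Sj.
(* AM-GM on each term of the squared sum: sqrt(x_i) sqrt(x_j) <= (x_i + x_j) / 2. *)
rewrite -{2}(sqr_sqrtr (x0 i)) -{2}(sqr_sqrtr (x0 j)).
have := sqr_ge0 (Num.sqrt (x i) - Num.sqrt (x j)); nra.
Qed.

(** Inside one parent, Cauchy-Schwarz bounds the sum of the sqrt([q j]) by [r] sqrt([q0 i]). As the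
    bound on [y] already carries sqrt([q0 i]), the leading products become [q0 i], which sum to at
    most 1: the leading term t^4 r pays for the children of one parent but not for the number of
    parents. Only the terms that contain an additive t^4 pay [r0]. *)
Lemma block_bilinear_le {R : realType} (J J0 : finType) (par : J -> J0)
    (q x y : J -> R) (q0 : J0 -> R) (k t r r0 : R) :
  0 <= k -> 0 <= r -> 0 <= r0 ->
  (forall j, 0 <= q j) -> (forall i, 0 <= q0 i) ->
  (forall i, \sum_(j | par j == i) q j <= q0 i) -> \sum_i q0 i <= 1 ->
  (forall i, #|[pred j | par j == i]|%:R <= r ^+ 2) ->
  #|J0|%:R <= r0 ^+ 2 ->
  (forall j, `|x j| <= k * (t ^+ 2 * Num.sqrt (q j) + t ^+ 4)) ->
  (forall j, `|y j| <= k * (t ^+ 2 * Num.sqrt (q0 (par j)) + t ^+ 4)) ->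
  `|\sum_j x j * y j| <=
    k ^+ 2 * (t ^+ 4 * r + t ^+ 6 * (r ^+ 2 + r) * r0
              + t ^+ 8 * r ^+ 2 * r0 ^+ 2).
Proof.
move=> k0 r_ge0 r00 q_ge0 q0_ge0 qq0 q01 cr cr0 hx hy.
set s := fun i => Num.sqrt (q0 i).
have t2 : 0 <= t ^+ 2 by rewrite sqr_ge0.
have t4 : 0 <= t ^+ 4 by rewrite -[4%N]/(2 * 2)%N exprM sqr_ge0.
apply: (@le_trans _ _ (\sum_i \sum_(j | par j == i)
    k ^+ 2 * ((t ^+ 2 * s i + t ^+ 4) * (t ^+ 2 * Num.sqrt (q j) + t ^+ 4)))).
  rewrite (le_trans (ler_norm_sum _ _ _))// (partition_big par predT)//=.
  apply: ler_sum => i _; apply: ler_sum => j /eqP ji.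
  rewrite normrM (le_trans (ler_pM _ _ (hx j) (hy j)))// ji -/(s i).
  rewrite le_eqVlt; apply/orP; left; apply/eqP; ring.
under eq_bigr do rewrite -mulr_sumr -mulr_sumr.
rewrite -mulr_sumr ler_wpM2l ?sqr_ge0//.
have s_ge0 i : 0 <= s i by exact: sqrtr_ge0.
have in1 i : \sum_(j | par j == i) (t ^+ 2 * Num.sqrt (q j) + t ^+ 4) <=
    t ^+ 2 * (r * s i) + t ^+ 4 * r ^+ 2.
  rewrite big_split/= -mulr_sumr sumr_const lerD//.
    rewrite ler_wpM2l// (le_trans (sum_sqrt_le _ q_ge0))//.
    have -> : r * s i = Num.sqrt (r ^+ 2 * q0 i).
      by rewrite sqrtrM ?sqr_ge0// sqrtr_sqr ger0_norm.
    rewrite ler_wsqrtr// ler_pM// ?sumr_ge0//.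
    by move: (cr i).
  rewrite -mulr_natr ler_wpM2l//.
  exact: cr.
apply: (@le_trans _ _ (\sum_i (t ^+ 2 * s i + t ^+ 4) *
    (t ^+ 2 * (r * s i) + t ^+ 4 * r ^+ 2))).
  by apply: ler_sum => i _; rewrite ler_wpM2l// addr_ge0// mulr_ge0.
have ss : \sum_i s i <= r0.
  rewrite (le_trans (sum_sqrt_le _ q0_ge0))//.
  rewrite -[leRHS](ger0_norm r00) -sqrtr_sqr ler_wsqrtr//.
  rewrite -[leRHS]mulr1 ler_pM// ?sumr_ge0//.
have -> : \sum_i (t ^+ 2 * s i + t ^+ 4) *
    (t ^+ 2 * (r * s i) + t ^+ 4 * r ^+ 2) =
  t ^+ 4 * r * \sum_i q0 i + t ^+ 6 * (r ^+ 2 + r) * \sum_i s i +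
  t ^+ 8 * r ^+ 2 * #|J0|%:R.
  rewrite -sum1_card natr_sum !mulr_sumr -!big_split/=.
  apply: eq_bigr => i _; rewrite -(sqr_sqrtr (q0_ge0 i)) -/(s i); ring.
have t6 : 0 <= t ^+ 6 by rewrite -[6%N]/(2 * 3)%N exprM exprn_ge0.
have t8 : 0 <= t ^+ 8 by rewrite -[8%N]/(2 * 4)%N exprM exprn_ge0.
rewrite !lerD//.
- by rewrite -[leRHS]mulr1 ler_wpM2l// mulr_ge0.
- by rewrite ler_wpM2l// mulr_ge0// addr_ge0// sqr_ge0.
- by rewrite ler_wpM2l// mulr_ge0// sqr_ge0.
Qed.

Section GridWeights.
Context {R : realType} {N : nat}.
Local Notation I := 'I_N.+1.
Implicit Types (w p ph : I * I -> R) (A B : pred I).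

(** The bounds are natural numbers, not indices, so that empty ranges and the whole grid are
    included. *)
Definition index_interval A : Prop :=
  exists i j : nat, A =1 (fun a => (i <= a < j)%N).

Definition rect_sum w A B : R := \sum_(z | A z.1 && B z.2) w z.

(** With t^4 = ln (n d) / n, the two terms are the Gaussian deviation sqrt(p ln (n d) / n) and the
    Poisson deviation ln (n d) / n of Bernstein's inequality. *)
Definition rect_close (k t : R) p ph : Prop :=
  forall A B, index_interval A -> index_interval B ->
  `|rect_sum ph A B - rect_sum p A B|
  <= k * (t ^+ 2 * Num.sqrt (rect_sum p A B) + t ^+ 4).

Definition weights w : Prop := (forall z, 0 <= w z) /\ \sum_z w z = 1.

Lemma eq_rect_sum w A A' B B' : A =1 A' -> B =1 B' ->
  rect_sum w A B = rect_sum w A' B'.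
Proof. by move=> AA BB; apply: eq_bigl => z; rewrite AA BB. Qed.

Lemma rect_sumB w w' A B :
  rect_sum (fun z => w z - w' z) A B = rect_sum w A B - rect_sum w' A B.
Proof. exact: sumrB. Qed.

Lemma rect_sum_ge0 w A B : (forall z, 0 <= w z) -> 0 <= rect_sum w A B.
Proof. by move=> w0; rewrite sumr_ge0. Qed.

Lemma rect_sum_mono w A A' B B' : (forall z, 0 <= w z) ->
  {subset A <= A'} -> {subset B <= B'} -> rect_sum w A B <= rect_sum w A' B'.
Proof.
move=> w0 AA BB; rewrite /rect_sum big_mkcond [leRHS]big_mkcond/=.
apply: ler_sum => z _; case: ifPn => [/andP[/AA + /BB]|].
  by rewrite !unfold_in => -> ->.
by case: ifP.
Qed.

Lemma rect_sum_le1 w A B : weights w -> rect_sum w A B <= 1.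
Proof.
move=> [w0 <-]; rewrite -[leRHS]/(rect_sum w xpredT xpredT).
exact: rect_sum_mono.
Qed.

Lemma index_interval_all : index_interval xpredT.
Proof. by exists 0%N, N.+1 => a /=; rewrite ltn_ord. Qed.

Lemma index_interval_le (a : I) : index_interval (fun b => (b <= a)%N).
Proof. by exists 0%N, a.+1. Qed.

Lemma index_interval_gt (c : nat) : index_interval (fun b : I => (c < b)%N).
Proof. by exists c.+1, N.+1 => b /=; rewrite ltn_ord andbT. Qed.

Lemma index_interval1 (a : I) : index_interval (pred1 a).
Proof.
exists a, a.+1 => b /=; rewrite ltnS -eqn_leq.
by apply/eqP/eqP => [->//|/val_inj].
Qed.

(* One scale of a partition of the grid: [f] maps a cell to its block, [g] a
   block to its parent, and [K j] is the part of the parent of the block [j]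
   that precedes [j]. *)
Definition scale (r : R) (J J0 : finType) (f : I -> J) (g : J -> J0)
    (K : J -> pred I) : Prop :=
  [/\ forall j, index_interval (fun a => f a == j),
      forall j, index_interval (K j),
      forall j a, K j a -> g (f a) = g j,
      forall i, #|[pred j | g j == i]|%:R <= r &
      #|J0|%:R <= r].

(** The inner sum depends on [z] only through its pair of blocks, so the form is a sum, over pairs
    of blocks, of D(block) times D(part of the parent preceding the block). That part lies in the
    parent rectangle, whose probability serves as [q0]. Pairs square the counts: at most [r ^+ 2]
    children for each parent and [r ^+ 2] parents. *)
Lemma scale_bilinear (k t r : R) p ph (J J0 J' J0' : finType)
    (f : I -> J) (g : J -> J0) K (f' : I -> J') (g' : J' -> J0') K' :
  let D z := ph z - p z in
  0 <= k -> 0 <= r -> weights p -> rect_close k t p ph ->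
  scale r f g K -> scale r f' g' K' ->
  `|\sum_z D z * rect_sum D (K (f z.1)) (K' (f' z.2))|
  <= k ^+ 2 * (t ^+ 4 * r + t ^+ 6 * (r ^+ 2 + r) * r
              + t ^+ 8 * r ^+ 2 * r ^+ 2).
Proof.
move=> D k0 r0 [p0 p1] cl [fI KI Kg fb fc] [fI' KI' Kg' fb' fc'].
rewrite (partition_big (fun z => (f z.1, f' z.2)) predT)//=.
rewrite (eq_bigr (fun j => rect_sum D (fun a => f a == j.1) (fun b => f' b ==
  j.2)
    * rect_sum D (K j.1) (K' j.2))); last first.
  move=> [j j'] _; rewrite /rect_sum mulr_suml; apply: eq_big => // z.
  by move=> /eqP[-> ->].
pose q0 (i : J0 * J0') := rect_sum p (fun a => g (f a) == i.1) (fun b => g' (f'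
  b) == i.2).
apply: (@block_bilinear_le _ _ _ (fun j => (g j.1, g' j.2))
  (fun j => rect_sum p (fun a => f a == j.1) (fun b => f' b == j.2))
  _ _ q0) => //.
- by move=> j; exact: rect_sum_ge0.
- by move=> i; exact: rect_sum_ge0.
- move=> i; rewrite le_eqVlt; apply/orP; left; apply/eqP.
  rewrite /q0 /rect_sum [RHS](partition_big (fun z => (f z.1, f' z.2))
    (fun j => (g j.1, g' j.2) == i))/=; last first.
    by move=> [z z'] /=; case: i => i i' /=; rewrite xpair_eqE.
  apply: eq_bigr => -[j j'] /eqP <-; apply: eq_bigl => -[z z'] /=.
  rewrite xpair_eqE; apply/idP/idP => [/andP[/eqP -> /eqP ->]|/andP[]//].
  by rewrite !eqxx.
- by rewrite -p1 [leRHS](partition_big (fun z => (g (f z.1), g' (f' z.2)))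
    predT).
- move=> -[i i'].
  rewrite (@eq_card _ _ [predX [pred j | g j == i] & [pred j | g' j == i']]);
    last first.
    by move=> [j j']; rewrite !inE xpair_eqE.
  rewrite cardX natrM expr2 ler_pM//; [exact: fb|exact: fb'].
- by rewrite card_prod natrM expr2 ler_pM.
- by move=> j; rewrite rect_sumB; apply: cl.
- move=> [j j'] /=; rewrite rect_sumB (le_trans (cl _ _ (KI _) (KI' _)))//.
  rewrite ler_wpM2l// lerD2r ler_wpM2l ?sqr_ge0// ler_wsqrtr//.
  apply: rect_sum_mono => // z; rewrite !unfold_in /=.
    by move=> /Kg ->.
  by move=> /Kg' ->.
Qed.

Lemma weights_diff_le p ph (u : I * I -> R) (e : R) :
  weights p -> weights ph -> (forall z, `|u z| <= e) ->
  `|\sum_z (ph z - p z) * u z| <= 2 * e.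
Proof.
move=> [p0 p1] [ph0 ph1] ue; apply: le_trans (ler_norm_sum _ _ _) _.
apply: (@le_trans _ _ (\sum_z (ph z * e + p z * e))).
  apply: ler_sum => z _; rewrite normrM -mulrDl ler_pM//.
  rewrite ler_norml; have := p0 z; have := ph0 z; lra.
rewrite big_split/= -!mulr_suml p1 ph1; lra.
Qed.

End GridWeights.

(** * Two nested partitions of the grid into blocks of w and of w M cells *)

Section TwoScales.
Context {R : realType} {N : nat}.
Local Notation I := 'I_N.+1.
Variables (w M : nat).
Hypotheses (w_gt0 : (0 < w)%N) (M_gt0 : (0 < M)%N).

Definition fine_block (a : I) : 'I_(N %/ w).+1 := inord (a %/ w).
Definition fine_parent (j : 'I_(N %/ w).+1) : 'I_(N %/ (w * M)).+1 :=
  inord (j %/ M).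
Definition coarse_block (a : I) : 'I_(N %/ (w * M)).+1 := inord (a %/ (w * M)).

Lemma fine_blockE a : fine_block a = (a %/ w)%N :> nat.
Proof. by rewrite inordK// ltnS leq_div2r// -ltnS. Qed.

Lemma fine_parentE j : fine_parent j = (j %/ M)%N :> nat.
Proof. by rewrite inordK// ltnS divnMA leq_div2r// -ltnS. Qed.

Lemma coarse_blockE a : coarse_block a = (a %/ w %/ M)%N :> nat.
Proof. by rewrite inordK -?divnMA// ltnS leq_div2r// -ltnS. Qed.

Lemma divn_eq_itv (v a j : nat) : (0 < v)%N ->
  (a %/ v == j)%N = (j * v <= a < j.+1 * v)%N.
Proof. by move=> v0; rewrite eqn_leq -ltnS ltn_divLR// leq_divRL// andbC. Qed.

Lemma fine_block_interval j : index_interval (fun a => fine_block a == j).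
Proof.
exists (j * w)%N, (j.+1 * w)%N => a.
by rewrite -val_eqE/= fine_blockE divn_eq_itv.
Qed.

Lemma before_fine_interval (j : nat) :
  index_interval (fun a : I => (a %/ w < j)%N).
Proof. by exists 0%N, (j * w)%N => a; rewrite ltn_divLR. Qed.

Lemma same_fine_le_interval (b : I) :
  index_interval (fun a : I => (a %/ w == b %/ w)%N && (a <= b)%N).
Proof.
exists (b %/ w * w)%N, b.+1 => a; rewrite divn_eq_itv//.
have : (b < (b %/ w).+1 * w)%N by rewrite ltn_ceil.
rewrite ltnS => bw; apply/idP/idP => [/andP[/andP[-> _] ->]//|/andP[-> ab]].
by rewrite ab (leq_ltn_trans ab bw).
Qed.

Lemma fine_scale (r : R) :
  M%:R <= r -> (N %/ (w * M)).+1%:R <= r ->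
  scale r fine_block fine_parent
    (fun j a => (a %/ w %/ M == j %/ M)%N && (a %/ w < j)%N).
Proof.
move=> Mr Cr; split.
- exact: fine_block_interval.
- move=> j; exists (j %/ M * M * w)%N, (j * w)%N => a.
  rewrite ltn_divLR// -[(_ %/ M)%N]divnMA divn_eq_itv ?muln_gt0 ?w_gt0//.
  rewrite [(w * M)%N]mulnC !mulnA.
  have jw : (j * w <= (j %/ M).+1 * M * w)%N.
    by rewrite leq_pmul2r// ltnW// ltn_ceil.
  apply/idP/idP => [/andP[/andP[-> _] ->]//|/andP[-> aj]].
  by rewrite aj (leq_trans aj jw).
- move=> j a /andP[/eqP e _]; apply: val_inj.
  by rewrite /= !fine_parentE fine_blockE.
- move=> i; apply: le_trans Mr; rewrite ler_nat.
  rewrite -[leqRHS]card_ord.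
  (* Within one parent a fine block is determined by its remainder modulo [M]. *)
  pose h (j : 'I_(N %/ w).+1) : 'I_M := Ordinal (ltn_pmod j M_gt0).
  rewrite -(@card_in_image _ _ h); first exact: max_card.
  move=> j1 j2 /eqP e1 /eqP e2 /(congr1 val)/= e.
  have {}e1 : fine_parent j1 = i :> nat by rewrite e1.
  have {}e2 : fine_parent j2 = i :> nat by rewrite e2.
  apply: val_inj => /=; rewrite (divn_eq j1 M) (divn_eq j2 M) e.
  by rewrite fine_parentE in e1; rewrite fine_parentE in e2; rewrite e1 e2.
- by rewrite card_ord.
Qed.

(** The whole grid is the only parent, so that preceding inside the parent means preceding. *)
Lemma coarse_scale (r : R) :
  (N %/ (w * M)).+1%:R <= r ->
  scale r coarse_block (fun=> tt) (fun j a => (a %/ w %/ M < j)%N).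
Proof.
move=> Cr; split => //.
- move=> j; exists (j * (w * M))%N, (j.+1 * (w * M))%N => a.
  by rewrite -val_eqE/= coarse_blockE -divnMA divn_eq_itv ?muln_gt0 ?w_gt0.
- move=> j; exists 0%N, (j * (w * M))%N => a.
  by rewrite -divnMA ltn_divLR ?muln_gt0 ?w_gt0.
- move=> i; apply: le_trans Cr.
  by rewrite ler_nat -[leqRHS]card_ord max_card.
- by apply: le_trans Cr; rewrite card_unit ler1n.
Qed.

End TwoScales.

Section RectSplit.
Context {R : realType} {N : nat}.
Local Notation I := 'I_N.+1.
Implicit Types (w : I * I -> R) (A B : pred I).

Lemma rect_sumE w A B :
  rect_sum w A B = \sum_z w z * ((A z.1)%:R * (B z.2)%:R).
Proof.
rewrite /rect_sum big_mkcond; apply: eq_bigr => z _.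
by case: (A _); case: (B _); rewrite /= ?(mulr1, mulr0, mul0r).
Qed.

(** Reading booleans as naturals, the one hypothesis says both that [A1] and [A2] cover [A] and that
    they are disjoint. *)
Lemma rect_sum_splitl w A A1 A2 B :
  (forall a, A a = A1 a + A2 a :> nat)%N ->
  rect_sum w A B = rect_sum w A1 B + rect_sum w A2 B.
Proof.
move=> e; rewrite !rect_sumE -big_split; apply: eq_bigr => z _ /=.
by rewrite e natrD; ring.
Qed.

Lemma rect_sum_splitr w A B B1 B2 :
  (forall b, B b = B1 b + B2 b :> nat)%N ->
  rect_sum w A B = rect_sum w A B1 + rect_sum w A B2.
Proof.
move=> e; rewrite !rect_sumE -big_split; apply: eq_bigr => z _ /=.
by rewrite e natrD; ring.
Qed.

(* The cell of index [a > 0] stands for the interval ](a - 1) / N, a / N],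
   and the cell of index 0 for the null set {0}. *)
Definition cell_mass (a : I) : R := (0 < a)%N%:R / N%:R.

Definition uniform_margins w : Prop :=
  (forall a, \sum_b w (a, b) = cell_mass a) /\
  (forall b, \sum_a w (a, b) = cell_mass b).

Lemma rect_sum_marginl w A : uniform_margins w ->
  rect_sum w A xpredT = \sum_(a | A a) cell_mass a.
Proof.
move=> [wl _]; rewrite -(eq_bigr _ (fun a _ => wl a)) /rect_sum.
rewrite pair_big/=; apply: eq_big => [[a b]|[a b] _] //=.
Qed.

Lemma rect_sum_marginr w B : uniform_margins w ->
  rect_sum w xpredT B = \sum_(b | B b) cell_mass b.
Proof.
move=> [_ wr]; rewrite -(eq_bigr _ (fun b _ => wr b)) /rect_sum.
rewrite exchange_big pair_big/=; apply: eq_big => [[a b]|[a b] _] //=.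
Qed.

Lemma sum_cell_mass_le A : \sum_(a | A a) cell_mass a <= #|A|%:R / N%:R.
Proof.
rewrite -mulr_suml ler_wpM2r ?invr_ge0// -sum1_card natr_sum ler_sum// => a _.
by rewrite ler_nat leq_b1.
Qed.

End RectSplit.

(** Take [w] just above N t^2 and [M] just above 1/t: fine blocks then have width about t^2 and
    coarse ones about t, with O(1/t) fine blocks in a coarse one and O(1/t) coarse blocks. Since N
    t^2 and 1/t are at least 1, rounding up costs at most a factor 2. *)
Lemma two_scales_exist {R : realType} (N : nat) (t : R) :
  0 < t <= 1 -> 1 <= N%:R * t ^+ 4 ->
  exists w M : nat, [/\ (0 < w)%N /\ (0 < M)%N, w%:R / N%:R <= 2 * t ^+ 2,
    M%:R <= 2 / t, (N %/ (w * M)).+1%:R <= 2 / t &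
    (N %/ w).+1%:R <= (2 / t) ^+ 2].
Proof.
move=> /andP[t0 t1] Nt.
have N0 : 0 < N%:R :> R.
  by rewrite -(pmulr_lgt0 _ (exprn_gt0 4 t0)) (lt_le_trans ltr01).
have Nt2 : 1 <= N%:R * t ^+ 2.
  by apply: (le_trans Nt); rewrite ler_pM2l// ler_wiXn2l// ltW.
have ti : 1 <= t^-1 by rewrite invf_ge1.
have w1 := truncnS_gt (N%:R * t ^+ 2).
have w2 : (Num.truncn (N%:R * t ^+ 2))%:R <= N%:R * t ^+ 2.
  by rewrite truncn_le// mulr_ge0 ?sqr_ge0// ltW.
have M1 := truncnS_gt t^-1.
have M2 : (Num.truncn t^-1)%:R <= t^-1 by rewrite truncn_le// invr_ge0 ltW.
set w := (Num.truncn (N%:R * t ^+ 2)).+1.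
set M := (Num.truncn t^-1).+1.
rewrite -/w in w1; rewrite -/M in M1.
have wS : w%:R <= 2 * (N%:R * t ^+ 2) by rewrite -[X in X <= _]natr1; lra.
have MS : M%:R <= 2 * t^-1 by rewrite -[X in X <= _]natr1; lra.
have divS v (x : R) : (0 < v)%N -> 1 <= x -> N%:R <= v%:R * x ->
    (N %/ v).+1%:R <= 2 * x.
  move=> v0 x1 Nvx; rewrite -[X in X <= _]natr1.
  suff : (N %/ v)%:R <= x by lra.
  have v0R : 0 < v%:R :> R by rewrite ltr0n.
  rewrite -(ler_pM2l v0R); apply: le_trans Nvx.
  by rewrite -natrM ler_nat mulnC leq_divM.
have w0R : 0 < w%:R :> R by rewrite ltr0n.
exists w, M; split => //.
- by rewrite ler_pdivrMr// (le_trans wS)// [N%:R * _]mulrC mulrA.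
- apply: divS => //; rewrite natrM.
  apply: (@le_trans _ _ (N%:R * t ^+ 2 * t^-1 * t^-1)).
    by rewrite le_eqVlt; apply/orP; left; apply/eqP; field; rewrite gt_eqF.
  rewrite ler_wpM2r ?invr_ge0 ?(ltW t0)//.
  by rewrite ler_pM ?mulr_ge0 ?invr_ge0 ?sqr_ge0 ?ltW.
- rewrite exprMn exprVn; apply: (@le_trans _ _ (2 * (t ^+ 2)^-1)); last first.
    by rewrite ler_wpM2r ?invr_ge0 ?sqr_ge0// -natrX ler_nat.
  apply: divS => //; first by rewrite invf_ge1 ?exprn_gt0// expr_le1// ltW.
  by rewrite ler_pdivlMr ?exprn_gt0// ltW.
Qed.

(** * Remainders of order t^3 *)

Section BilinearRemainders.
Context {R : realType} {N : nat}.
Local Notation I := 'I_N.+1.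
Variables (k t : R) (p ph : I * I -> R).
Hypotheses (k_ge0 : 0 <= k) (t01 : 0 < t <= 1) (Nt : 1 <= N%:R * t ^+ 4).
Hypotheses (p_weights : weights p) (ph_weights : weights ph).
Hypotheses (p_margins : uniform_margins p) (close : rect_close k t p ph).
Local Notation D := (fun z => ph z - p z).

Let t0 : 0 < t. Proof. by case/andP: t01. Qed.
Let t1 : t <= 1. Proof. by case/andP: t01. Qed.

Lemma rect_diff_le A B (q : R) : index_interval A -> index_interval B ->
  rect_sum p A B <= q ^+ 2 -> 0 <= q ->
  `|rect_sum D A B| <= k * (t ^+ 2 * q + t ^+ 4).
Proof.
move=> AI BI pq q0; rewrite rect_sumB (le_trans (close AI BI))//.
rewrite ler_wpM2l// lerD2r ler_wpM2l ?sqr_ge0//.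
by rewrite -(ger0_norm q0) -sqrtr_sqr ler_wsqrtr.
Qed.

Lemma rect_diff_le_global A B : index_interval A -> index_interval B ->
  `|rect_sum D A B| <= 2 * k * t ^+ 2.
Proof.
move=> AI BI; apply: (le_trans (rect_diff_le (q := 1) AI BI _ _)) => //.
  by rewrite expr1n rect_sum_le1.
have : t ^+ 4 <= t ^+ 2 by rewrite ler_wiXn2l// ltW.
move=> ?; have -> : 2 * k * t ^+ 2 = k * (2 * t ^+ 2) by ring.
by rewrite mulr1 ler_wpM2l//; lra.
Qed.

(** Uniform margins give the strip a mass of at most 4 t^2, and the square root 2 t of that mass is
    the extra factor over the global bound. *)
Lemma rect_diff_le_strip A B (m : nat) :
  index_interval A -> index_interval B -> m%:R / N%:R <= 4 * t ^+ 2 ->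
  (#|A| <= m)%N \/ (#|B| <= m)%N ->
  `|rect_sum D A B| <= 3 * k * t ^+ 3.
Proof.
move=> AI BI mt Am.
apply: (le_trans (rect_diff_le (q := 2 * t) AI BI _ _)).
- rewrite exprMn -natrX; apply: le_trans mt.
  have [p0 _] := p_weights.
  case: Am => Cm.
    apply: (@le_trans _ _ (rect_sum p A xpredT)); first exact: rect_sum_mono.
    rewrite rect_sum_marginl// (le_trans (sum_cell_mass_le _))//.
    by rewrite ler_wpM2r ?invr_ge0// ler_nat.
  apply: (@le_trans _ _ (rect_sum p xpredT B)); first exact: rect_sum_mono.
  rewrite rect_sum_marginr// (le_trans (sum_cell_mass_le _))//.
  by rewrite ler_wpM2r ?invr_ge0// ler_nat.
- by rewrite mulr_ge0// ltW.
have : t ^+ 4 <= t ^+ 3 by rewrite ler_wiXn2l// ltW.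
move=> ?; have -> : 3 * k * t ^+ 3 = k * (3 * t ^+ 3) by ring.
rewrite ler_wpM2l//.
have -> : t ^+ 2 * (2 * t) = 2 * t ^+ 3 by ring.
lra.
Qed.

Lemma card_same_fine (w : nat) (b : I) : (0 < w)%N ->
  (#|[pred a : I | (a %/ w == b %/ w)%N && (a <= b)%N]| <= w)%N.
Proof.
move=> w0; rewrite -[leqRHS]card_ord.
pose h (a : I) : 'I_w := Ordinal (ltn_pmod a w0).
rewrite -(@card_in_image _ _ h); first exact: max_card.
move=> a c /andP[/eqP ea _] /andP[/eqP ec _] /(congr1 val)/= e.
by apply: val_inj; rewrite /= (divn_eq a w) (divn_eq c w) e ea ec.
Qed.

(** At r = 2/t the three terms of [scale_bilinear] are 2 t^3, 8 t^3 + 4 t^4 and 16 t^4. *)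
Lemma scale_bilinear_cube (J J0 J' J0' : finType)
    (f : I -> J) (g : J -> J0) K (f' : I -> J') (g' : J' -> J0') K' :
  scale (2 / t) f g K -> scale (2 / t) f' g' K' ->
  `|\sum_z D z * rect_sum D (K (f z.1)) (K' (f' z.2))| <= 30 * k ^+ 2 * t ^+ 3.
Proof.
move=> fK fK'; have r0 : 0 <= 2 / t by rewrite divr_ge0// ltW.
apply: (le_trans (scale_bilinear k_ge0 r0 p_weights close fK fK')).
have -> : 30 * k ^+ 2 * t ^+ 3 = k ^+ 2 * (30 * t ^+ 3) by ring.
rewrite ler_wpM2l ?sqr_ge0//.
have -> : t ^+ 4 * (2 / t) + t ^+ 6 * ((2 / t) ^+ 2 + 2 / t) * (2 / t) +
   t ^+ 8 * (2 / t) ^+ 2 * (2 / t) ^+ 2 =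
   2 * t ^+ 3 + 8 * t ^+ 3 + 20 * t ^+ 4 by field; rewrite gt_eqF.
have : t ^+ 4 <= t ^+ 3 by rewrite ler_wiXn2l// ltW.
by lra.
Qed.

(* One scale of blocks only gives the order t^(8/3).  Here two cells are
   compared through blocks of width t, then of width t^2.  If they separate at
   one of these scales, the form is a sum over blocks j of D(j) D(part of the parent of
   j preceding j), bounded by Cauchy-Schwarz inside each parent; cells in the
   same block of width t^2 contribute an oscillation of D over a strip. *)
Lemma concordance_remainder :
  `|\sum_z D z * rect_sum D (fun a => (a <= z.1)%N) (fun b => (b <= z.2)%N)|
  <= (120 * k ^+ 2 + 12 * k) * t ^+ 3.
Proof.
have [w [M [[w0 M0] wN Mt Ct _]]] := two_scales_exist t01 Nt.
have wN4 : w%:R / N%:R <= 4 * t ^+ 2.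
  by apply: (le_trans wN); have := sqr_ge0 t; lra.
pose S (b : I) : pred I := fun a => (a %/ w == b %/ w)%N && (a <= b)%N.
pose U (b : I) : pred I := fun a => (a %/ w < b %/ w)%N.
pose C (b : I) : pred I := fun a => (a %/ w %/ M < b %/ w %/ M)%N.
pose F (b : I) : pred I :=
  fun a => (a %/ w %/ M == b %/ w %/ M)%N && (a %/ w < b %/ w)%N.
have leUS (b a : I) : ((a <= b)%N = U b a + S b a :> nat)%N.
  rewrite /U /S; case: (leqP a b) => ab; last first.
    by rewrite andbF /= addn0 ltnNge leq_div2r// ltnW.
  by rewrite andbT; have := leq_div2r w ab; case: ltngtP.
have UCF (b a : I) : (U b a = C b a + F b a :> nat)%N.
  rewrite /U /C /F; case: (ltnP (a %/ w) (b %/ w)) => ab; last first.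
    by rewrite andbF /= addn0 ltnNge leq_div2r.
  by rewrite andbT; have := leq_div2r M (ltnW ab); case: ltngtP.
(* Same fine block in the first coordinate; else same fine block in the second; else both
   coordinates separate, each at the coarse or at the fine scale. The two strips give 6 k t^3 each
   and the four separated forms 30 k^2 t^3 each. *)
rewrite (eq_bigr (fun z =>
    D z * rect_sum D (S z.1) (fun b => (b <= z.2)%N) +
    D z * rect_sum D (U z.1) (S z.2) +
    (D z * rect_sum D (C z.1) (C z.2) + D z * rect_sum D (C z.1) (F z.2) +
     D z * rect_sum D (F z.1) (C z.2) + D z * rect_sum D (F z.1) (F z.2))));
    last first.
  move=> z _; rewrite (rect_sum_splitl _ _ (leUS z.1)).
  rewrite (rect_sum_splitr _ (U z.1) (leUS z.2)).
  rewrite (rect_sum_splitl _ (U z.2) (UCF z.1)) !(rect_sum_splitr _ _ (UCF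
    z.2)).
  by ring.
rewrite !big_split/=.
have b1 : `|\sum_z D z * rect_sum D (S z.1) (fun b => (b <= z.2)%N)| <=
    2 * (3 * k * t ^+ 3).
  apply: weights_diff_le => // z; apply: (@rect_diff_le_strip _ _ w) => //.
  - exact: same_fine_le_interval.
  - exact: index_interval_le.
  - by left; exact: card_same_fine.
have b2 : `|\sum_z D z * rect_sum D (U z.1) (S z.2)| <= 2 * (3 * k * t ^+ 3).
  apply: weights_diff_le => // z; apply: (@rect_diff_le_strip _ _ w) => //.
  - exact: before_fine_interval.
  - exact: same_fine_le_interval.
  - by right; exact: card_same_fine.
have sC := @coarse_scale R N w M w0 M0 _ Ct.
have sF := @fine_scale R N w M w0 M0 _ Mt Ct.
have toC (a b : I) : C b a = (a %/ w %/ M < coarse_block w M b)%N.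
  by rewrite coarse_blockE.
have toF (a b : I) : F b a =
    (a %/ w %/ M == fine_block w b %/ M)%N && (a %/ w < fine_block w b)%N.
  by rewrite fine_blockE.
have b3 : `|\sum_z D z * rect_sum D (C z.1) (C z.2)| <= 30 * k ^+ 2 * t ^+ 3.
  apply: le_trans (scale_bilinear_cube sC sC); rewrite le_eqVlt; apply/orP;
    left.
  apply/eqP; congr (`| _ |); apply: eq_bigr => z _; congr (_ * _).
  by apply: eq_rect_sum => a; exact: toC.
have b4 : `|\sum_z D z * rect_sum D (C z.1) (F z.2)| <= 30 * k ^+ 2 * t ^+ 3.
  apply: le_trans (scale_bilinear_cube sC sF); rewrite le_eqVlt; apply/orP;
    left.
  apply/eqP; congr (`| _ |); apply: eq_bigr => z _; congr (_ * _).
  by apply: eq_rect_sum => a; [exact: toC|exact: toF].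
have b5 : `|\sum_z D z * rect_sum D (F z.1) (C z.2)| <= 30 * k ^+ 2 * t ^+ 3.
  apply: le_trans (scale_bilinear_cube sF sC); rewrite le_eqVlt; apply/orP;
    left.
  apply/eqP; congr (`| _ |); apply: eq_bigr => z _; congr (_ * _).
  by apply: eq_rect_sum => a; [exact: toF|exact: toC].
have b6 : `|\sum_z D z * rect_sum D (F z.1) (F z.2)| <= 30 * k ^+ 2 * t ^+ 3.
  apply: le_trans (scale_bilinear_cube sF sF); rewrite le_eqVlt; apply/orP;
    left.
  apply/eqP; congr (`| _ |); apply: eq_bigr => z _; congr (_ * _).
  by apply: eq_rect_sum => a; exact: toF.
move: b1 b2 b3 b4 b5 b6; rewrite !ler_norml.
set s1 := \sum_z _; set s2 := \sum_z _; set s3 := \sum_z _.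
set s4 := \sum_z _; set s5 := \sum_z _; set s6 := \sum_z _.
lra.
Qed.

(** The inner deviation depends on the first coordinate alone, so one scale suffices: the O(t^-2)
    columns of width t^2 are the children of a single parent, and the leading term t^4 r with r =
    2/t is already O(t^3). Cells in the same column leave a strip term. *)
Lemma margin_remainder (c : nat) :
  `|\sum_z D z * (rect_sum D (fun a => (a <= z.1)%N) xpredT * (c < z.2)%N%:R)|
  <= (12 * k ^+ 2 + 6 * k) * t ^+ 3.
Proof.
have [w [M [[w0 M0] wN Mt _ Ft]]] := two_scales_exist t01 Nt.
have wN4 : w%:R / N%:R <= 4 * t ^+ 2.
  by apply: (le_trans wN); have := sqr_ge0 t; lra.
pose S (b : I) : pred I := fun a => (a %/ w == b %/ w)%N && (a <= b)%N.
pose U (b : I) : pred I := fun a => (a %/ w < b %/ w)%N.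
have leUS (b a : I) : ((a <= b)%N = U b a + S b a :> nat)%N.
  rewrite /U /S; case: (leqP a b) => ab; last first.
    by rewrite andbF /= addn0 ltnNge leq_div2r// ltnW.
  by rewrite andbT; have := leq_div2r w ab; case: ltngtP.
pose B : pred I := fun b => (c < b)%N.
rewrite (eq_bigr (fun z =>
    D z * (rect_sum D (S z.1) xpredT * (B z.2)%:R) +
    D z * (rect_sum D (U z.1) xpredT * (B z.2)%:R))); last first.
  by move=> z _; rewrite (rect_sum_splitl _ _ (leUS z.1)) /B; ring.
rewrite big_split/= mulrDl; apply: (le_trans (ler_normD _ _));
  rewrite addrC lerD//.
  rewrite (partition_big (fun z => fine_block w z.1) predT)//=.
  rewrite (eq_bigr (fun j : 'I_(N %/ w).+1 =>
      rect_sum D (fun a => fine_block w a == j) B *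
      rect_sum D (fun a => (a %/ w < j)%N) xpredT)); last first.
    move=> j _; rewrite {1}/rect_sum mulr_suml.
    rewrite [RHS]big_mkcondr/=; apply: eq_bigr => z /eqP <-.
    rewrite fine_blockE /U; case: (B z.2); first by rewrite mulr1.
    by rewrite !mulr0.
  have [p0 _] := p_weights.
  apply: (@le_trans _ _ (k ^+ 2 * (t ^+ 4 * (2 / t)
      + t ^+ 6 * ((2 / t) ^+ 2 + 2 / t) * 1
      + t ^+ 8 * (2 / t) ^+ 2 * 1 ^+ 2))).
    (* The only parent has mass at most 1, hence the constant 1 for both [q0] and [r0]. *)
    apply: (@block_bilinear_le _ _ _ (fun=> tt)
      (fun j => rect_sum p (fun a => fine_block w a == j) B) _ _ (fun=> 1)) =>
        //.
    - by rewrite divr_ge0// ltW.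
    - by move=> j; exact: rect_sum_ge0.
    - move=> [] /=; apply: le_trans (rect_sum_le1 xpredT B p_weights).
      rewrite le_eqVlt; apply/orP; left; apply/eqP.
      rewrite [in RHS]/rect_sum (partition_big (fun z => fine_block w z.1)
        predT)//=.
      by apply: eq_bigr => j _; apply: eq_bigl => z; rewrite andbC.
    - by rewrite big_const card_unit /= addr0.
    - by move=> i; rewrite (le_trans _ Ft)// ler_nat -[leqRHS]card_ord max_card.
    - by rewrite card_unit expr1n.
    - move=> j; rewrite rect_sumB; apply: close; last exact: index_interval_gt.
      exact: fine_block_interval.
    - move=> j; apply: rect_diff_le => //; [exact: before_fine_interval|
        exact: index_interval_all|by rewrite sqrtr1 expr1n rect_sum_le1].
  have -> : 12 * k ^+ 2 * t ^+ 3 = k ^+ 2 * (12 * t ^+ 3) by ring.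
  rewrite ler_wpM2l ?sqr_ge0//.
  have -> : t ^+ 4 * (2 / t) + t ^+ 6 * ((2 / t) ^+ 2 + 2 / t) * 1 +
     t ^+ 8 * (2 / t) ^+ 2 * 1 ^+ 2 =
     2 * t ^+ 3 + 4 * t ^+ 4 + 2 * t ^+ 5 + 4 * t ^+ 6.
    by field; rewrite gt_eqF.
  have : t ^+ 4 <= t ^+ 3 by rewrite ler_wiXn2l// ltW.
  have : t ^+ 5 <= t ^+ 3 by rewrite ler_wiXn2l// ltW.
  have : t ^+ 6 <= t ^+ 3 by rewrite ler_wiXn2l// ltW.
  by lra.
have -> : 6 * k * t ^+ 3 = 2 * (3 * k * t ^+ 3) by ring.
apply: weights_diff_le => // z; rewrite normrM -[leRHS]mulr1 ler_pM//.
  apply: (@rect_diff_le_strip _ _ w) => //.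
  - exact: same_fine_le_interval.
  - exact: index_interval_all.
  - by left; exact: card_same_fine.
by case: (B _); rewrite ?normr1 ?normr0.
Qed.

End BilinearRemainders.

(** * Linearization on the grid *)

Section MatrixLinearization.
Context {R : realType} {N : nat}.
Local Notation I := 'I_N.+1.
Implicit Types (w p ph : I * I -> R).

Definition mean w (f : I * I -> R) : R := \sum_z w z * f z.

Definition node (a : I) : R := a%:R / N%:R.

Definition cell_cdf w (a b : I) : R :=
  rect_sum w (fun a' => (a' <= a)%N) (fun b' => (b' <= b)%N).

Lemma node_ge0 a : 0 <= node a.
Proof. by rewrite divr_ge0. Qed.

Lemma node_le1 a : node a <= 1.
Proof.
rewrite /node; have [N0|N0] := posnP N.
  have -> : (a : nat) = 0%N.
    by have := ltn_ord a; rewrite [in X in (_ < X)%N -> _]N0;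
      case: (nat_of_ord a).
  by rewrite mul0r.
by rewrite ler_pdivrMr ?ltr0n// mul1r ler_nat -ltnS.
Qed.

Lemma cell_mass_ge0 (a : I) : 0 <= cell_mass a :> R.
Proof. by rewrite divr_ge0. Qed.

Lemma cell_mass_le (a : I) : cell_mass a <= N%:R^-1 :> R.
Proof. by rewrite ler_piMl ?invr_ge0// lern1 leq_b1. Qed.

Lemma eq_mean w f g : f =1 g -> mean w f = mean w g.
Proof. by move=> fg; apply: eq_bigr => z _; rewrite fg. Qed.

Lemma meanD w f g : mean w (fun z => f z + g z) = mean w f + mean w g.
Proof. by rewrite /mean -big_split/=; apply: eq_bigr => z _;
  rewrite mulrDr. Qed.

Lemma meanN w f : mean w (fun z => - f z) = - mean w f.
Proof. by rewrite /mean -sumrN; apply: eq_bigr => z _; rewrite mulrN. Qed.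

Lemma meanB w f g : mean w (fun z => f z - g z) = mean w f - mean w g.
Proof. by rewrite meanD meanN. Qed.

Lemma meanZ w f c : mean w (fun z => c * f z) = c * mean w f.
Proof. by rewrite /mean mulr_sumr; apply: eq_bigr => z _; rewrite mulrCA. Qed.

Lemma mean_cst w c : weights w -> mean w (fun=> c) = c.
Proof. by move=> [_ w1]; rewrite /mean -mulr_suml w1 mul1r. Qed.

Lemma mean_diff p ph f :
  mean ph f = mean p f + \sum_z (ph z - p z) * f z.
Proof.
by rewrite /mean -big_split/=; apply: eq_bigr => z _; ring.
Qed.

Lemma mean_le w f g e : weights w -> (forall z, `|f z - g z| <= e) ->
  `|mean w f - mean w g| <= e.
Proof.
move=> ww fg; rewrite -meanB -(mean_cst e ww).
apply: (le_trans (ler_norm_sum _ _ _)); apply: ler_sum => z _.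
by have [w0 _] := ww; rewrite normrM ger0_norm// ler_wpM2l.
Qed.

Lemma mean_marginl w (f : I -> R) : uniform_margins w ->
  mean w (fun z => f z.1) = \sum_a cell_mass a * f a.
Proof.
move=> [wl _]; rewrite /mean (eq_bigr (fun z => w (z.1, z.2) * f z.1));
  last by case.
rewrite -(pair_bigA _ (fun a b => w (a, b) * f a))/=.
by apply: eq_bigr => a _; rewrite -mulr_suml wl.
Qed.

Lemma mean_marginr w (f : I -> R) : uniform_margins w ->
  mean w (fun z => f z.2) = \sum_b cell_mass b * f b.
Proof.
move=> [_ wr]; rewrite /mean (eq_bigr (fun z => w (z.1, z.2) * f z.2));
  last by case.
rewrite -(pair_bigA _ (fun a b => w (a, b) * f b))/= exchange_big/=.
by apply: eq_bigr => a _; rewrite -mulr_suml wr.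
Qed.

(** Fubini: for the kernel of lower quadrants, the roles of the two weights are exchanged at the
    price of passing to upper quadrants. *)
Lemma mean_rect_sum w w' (A B : I -> pred I) :
  mean w (fun z => rect_sum w' (A z.1) (B z.2)) =
  mean w' (fun z' => \sum_(z | A z.1 z'.1 && B z.2 z'.2) w z).
Proof.
rewrite /mean.
transitivity (\sum_z \sum_z' w z * w' z' * (A z.1 z'.1 && B z.2 z'.2)%:R).
  apply: eq_bigr => z _; rewrite mulr_sumr big_mkcond;
    apply: eq_bigr => z' _ /=.
  by case: ifP; rewrite ?mulr1 ?mulr0.
rewrite exchange_big/=; apply: eq_bigr => z' _.
rewrite mulr_sumr [RHS]big_mkcond; apply: eq_bigr => z _ /=.
by case: ifP; rewrite ?mulr1 ?mulr0// mulrC.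
Qed.

Hypothesis N_gt0 : (0 < N)%N.
Let N0 : (0 : R) < N%:R. Proof. by rewrite ltr0n. Qed.

Lemma sum_cell_mass_lt (m : nat) : (m <= N.+1)%N ->
  \sum_(a : I | (a < m)%N) cell_mass a = m.-1%:R / N%:R :> R.
Proof.
move=> mN; rewrite -(big_ord_widen _ (fun a : nat => (0 < a)%N%:R / N%:R) mN).
elim: m {mN} => [|m IH]; first by rewrite big_ord0 mul0r.
rewrite big_ord_recr/= IH -mulrDl -natrD; congr (_%:R / _).
by case: m {IH} => // m; rewrite addn1.
Qed.

Lemma sum_cell_mass_le_node (b : I) :
  \sum_(a : I | (a <= b)%N) cell_mass a = node b :> R.
Proof. by rewrite -[RHS](sum_cell_mass_lt (m := b.+1)). Qed.

Lemma sum_cell_mass : \sum_(a : I) cell_mass a = 1 :> R.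
Proof.
rewrite -[RHS](divff (x := N%:R)) ?gt_eqF// -[RHS](@sum_cell_mass_lt N.+1)//.
by apply: eq_bigl => a; rewrite ltn_ord.
Qed.

Lemma sum_cell_mass_ge (b : I) :
  `|\sum_(a : I | (b <= a)%N) cell_mass a - (1 - node b)| <= N%:R^-1 :> R.
Proof.
have := sum_cell_mass; rewrite (bigID (fun a : I => (a < b)%N))/=.
rewrite sum_cell_mass_lt; last by rewrite ltnW.
rewrite (eq_bigl (fun a : I => (b <= a)%N)); last by move=> a; rewrite -leqNgt.
move=> /(canRL (addKr _)) ->; rewrite /node.
have -> : - (b.-1%:R / N%:R) + 1 - (1 - b%:R / N%:R) = (b%:R - b.-1%:R) / N%:R
  :> R.
  by ring.
rewrite normrM [X in _ * X]ger0_norm ?invr_ge0//.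
rewrite ler_piMl ?invr_ge0//.
case: (nat_of_ord b) => [|m]; first by rewrite subrr normr0.
by rewrite /= -natrB// subSnn normr1.
Qed.

Lemma sum_node_cell_mass :
  `|\sum_(a : I) cell_mass a * node a - 2^-1| <= N%:R^-1 :> R.
Proof.
have -> : \sum_(a : I) cell_mass a * node a = 2^-1 + (2 * N%:R)^-1 :> R.
  transitivity ((\sum_(a : I) a%:R) / N%:R ^+ 2 : R).
    rewrite mulr_suml; apply: eq_bigr => a _; rewrite /cell_mass /node.
    have [->|a0] := posnP a; first by rewrite !mul0r.
    by rewrite mul1r; field; rewrite gt_eqF.
  have S (m : nat) : \sum_(a < m.+1) a%:R = m%:R * (m%:R + 1) / 2 :> R.
    elim: m => [|m IH]; first by rewrite big_ord1 !mul0r.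
    by rewrite big_ord_recr/= IH -[m.+1%:R]natr1; field.
  rewrite S.
  by field; rewrite gt_eqF.
rewrite addrC addKr ger0_norm ?invr_ge0 ?mulr_ge0//.
by rewrite lef_pV2 ?posrE ?mulr_gt0// ler_peMl// ler1n.
Qed.

End MatrixLinearization.

(** * Exchange of the two coordinates *)

Section Swap.
Context {R : realType} {N : nat}.
Local Notation I := 'I_N.+1.
Implicit Types (w p ph : I * I -> R).

Definition swap_weights w (z : I * I) : R := w (z.2, z.1).

Lemma sum_swap (F : I * I -> R) : \sum_z F (z.2, z.1) = \sum_z F z.
Proof.
rewrite [RHS](reindex_inj (h := fun z : I * I => (z.2, z.1)))//.
by move=> [a b] [a' b'] [-> ->].
Qed.

Lemma mean_swap w f : mean (swap_weights w) f = mean w (fun z => f (z.2, z.1)).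
Proof.
rewrite /mean -[RHS]sum_swap; apply: eq_bigr => -[a b] _.
by rewrite /swap_weights/=.
Qed.

Lemma rect_sum_swap w A B : rect_sum (swap_weights w) A B = rect_sum w B A.
Proof.
rewrite !rect_sumE -[RHS]sum_swap; apply: eq_bigr => -[a b] _.
by rewrite /swap_weights/= [(B _)%:R * _]mulrC.
Qed.

Lemma weights_swap w : weights w -> weights (swap_weights w).
Proof. by move=> [w0 w1]; split => [z|]; [exact: w0|rewrite (sum_swap w)]. Qed.

Lemma uniform_margins_swap w : uniform_margins w -> uniform_margins
  (swap_weights w).
Proof. by move=> [wl wr]; split => a; [exact: wr|exact: wl]. Qed.

Lemma rect_close_swap k t p ph :
  rect_close k t p ph -> rect_close k t (swap_weights p) (swap_weights ph).
Proof. by move=> c A B AI BI; rewrite !rect_sum_swap; exact: c. Qed.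

End Swap.

Section Linearization.
Context {R : realType} {N : nat}.
Local Notation I := 'I_N.+1.
Variables (k t : R).
Hypotheses (k_ge0 : 0 <= k) (t01 : 0 < t <= 1) (Nt : 1 <= N%:R * t ^+ 4).
Implicit Types (p ph : I * I -> R).

Let t0 : 0 < t. Proof. by case/andP: t01. Qed.
Let t1 : t <= 1. Proof. by case/andP: t01. Qed.
Let N0 : (0 : R) < N%:R.
Proof. by rewrite -(pmulr_lgt0 _ (exprn_gt0 4 t0)) (lt_le_trans ltr01). Qed.
Let N_gt0 : (0 < N)%N. Proof. by rewrite -(ltr0n R). Qed.

Lemma mesh_le : N%:R^-1 <= t ^+ 4.
Proof. by rewrite -(ler_pM2l N0) mulfV ?gt_eqF. Qed.

Definition margin_cdf p (a : I) : R := rect_sum p (fun a' => (a' <= a)%N)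
  xpredT.

(** For the cell law this is a Riemann sum of the integral of C(u, z) over z that occurs in the
    linearizing function of Spearman's rho. *)
Definition mean_section p (a : I) : R := \sum_b cell_mass b * cell_cdf p a b.

Lemma margin_cdfE p a : uniform_margins p -> margin_cdf p a = node a.
Proof. by move=> pm; rewrite /margin_cdf rect_sum_marginl//
  sum_cell_mass_le_node. Qed.

Lemma rect_sum_lt_le p (a : I) (B : pred I) : weights p -> uniform_margins p ->
  0 <= rect_sum p (fun a' => (a' <= a)%N) B - rect_sum p (fun a' => (a' < a)%N)
    B
    <= N%:R^-1.
Proof.
move=> [p0 p1] pm.
rewrite (@rect_sum_splitl _ _ p _ (fun a' => (a' < a)%N) (pred1 a)); last first.
  by move=> a' /=; rewrite -val_eqE/=; case: ltngtP.
rewrite addrAC subrr add0r rect_sum_ge0//=.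
apply: (@le_trans _ _ (rect_sum p (pred1 a) xpredT));
  first exact: rect_sum_mono.
by rewrite rect_sum_marginl// (big_pred1 a)// cell_mass_le.
Qed.

(** Inclusion-exclusion, up to the boundary column and the boundary row of cells, each of mass at
    most 1/N. *)
Lemma upper_quadrant p (a b : I) : weights p -> uniform_margins p ->
  `|rect_sum p (fun a' => (a <= a')%N) (fun b' => (b <= b')%N)
    - (1 - node a - node b + cell_cdf p a b)| <= 2 * N%:R^-1.
Proof.
move=> pw pm; have [p0 p1] := pw; have pm' := uniform_margins_swap pm.
pose ge : pred I := fun a' => (a <= a')%N;
  pose lt : pred I := fun a' => (a' < a)%N.
pose geb : pred I := fun b' => (b <= b')%N;
  pose ltb : pred I := fun b' => (b' < b)%N.
have sa (a' : I) : (true = lt a' + ge a' :> nat)%N by rewrite /lt /ge;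
  case: ltnP.
have sb (b' : I) : (true = ltb b' + geb b' :> nat)%N by rewrite /ltb /geb;
  case: ltnP.
have e1 : rect_sum p lt xpredT + rect_sum p ge xpredT = 1.
  by rewrite -(rect_sum_splitl _ (A := xpredT) _ sa).
have e2 : rect_sum p ge xpredT = rect_sum p ge ltb + rect_sum p ge geb.
  exact: rect_sum_splitr.
have e3 : rect_sum p xpredT ltb = rect_sum p lt ltb + rect_sum p ge ltb.
  exact: rect_sum_splitl.
have := @rect_sum_lt_le p a xpredT pw pm;
  rewrite -/(margin_cdf p a) margin_cdfE//.
have := @rect_sum_lt_le _ b xpredT (weights_swap pw) pm'.
rewrite -/(margin_cdf _ b) margin_cdfE// rect_sum_swap.
have := @rect_sum_lt_le _ b (fun a' => (a' <= a)%N) (weights_swap pw) pm'.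
rewrite !rect_sum_swap -/(cell_cdf p a b).
have := @rect_sum_lt_le p a ltb pw pm.
move: e1 e2 e3; rewrite -/lt -/ltb.
set x1 := rect_sum p lt xpredT; set x2 := rect_sum p ge xpredT.
set x3 := rect_sum p ge ltb; set x4 := rect_sum p ge geb.
set x5 := rect_sum p xpredT ltb; set x6 := rect_sum p lt ltb.
set x7 := rect_sum p _ ltb; set x8 := cell_cdf p a b.
move=> e1 e2 e3 h1 h2 h3 h4.
have : x5 - x7 >= 0 by rewrite subr_ge0 rect_sum_mono.
have : node b - x5 - (x8 - x7) >= 0.
  rewrite subr_ge0 -(margin_cdfE b pm') /margin_cdf rect_sum_swap.
  rewrite /x5 /x7 /x8 /cell_cdf.
  have spl A : rect_sum p A (fun b' => (b' <= b)%N) =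
      rect_sum p A ltb + rect_sum p A (pred1 b).
    apply: rect_sum_splitr => b' /=; rewrite -val_eqE/= /ltb.
    by case: ltngtP.
  by rewrite !spl ![_ + _ - _]addrAC !subrr !add0r rect_sum_mono.
rewrite ler_norml; lra.
Qed.

(** Hoeffding decomposition of m(w, w'), the mean under [w] of [cell_cdf w']: m(ph, ph) - m(p, p) =
    m(D, p) + m(p, D) + m(D, D). By Fubini and [upper_quadrant], m(p, ph) is close to a mean under
    [ph] of a function of [p], and m(D, D) is bounded by [concordance_remainder]. *)
Lemma concordance_linearization p ph :
  weights p -> weights ph -> uniform_margins p -> rect_close k t p ph ->
  `|mean ph (fun z => cell_cdf ph z.1 z.2) - mean p (fun z => cell_cdf p z.1
    z.2)
    - (2 * mean ph (fun z => cell_cdf p z.1 z.2) - mean ph (fun z => node z.1)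
       - mean ph (fun z => node z.2) + 1
       - 2 * mean p (fun z => cell_cdf p z.1 z.2))|
  <= (120 * k ^+ 2 + 12 * k + 2) * t ^+ 3.
Proof.
move=> pw phw pm cl.
have cr := concordance_remainder k_ge0 t01 Nt pw phw pm cl.
have eA : mean p (fun z => cell_cdf ph z.1 z.2) = mean ph (fun z =>
    rect_sum p (fun a' => (z.1 <= a')%N) (fun b' => (z.2 <= b')%N)).
  exact: (@mean_rect_sum _ _ p ph (fun a a' => (a' <= a)%N) (fun b b' => (b' <=
    b)%N)).
have eB : `|mean p (fun z => cell_cdf ph z.1 z.2) -
    mean ph (fun z => 1 - node z.1 - node z.2 + cell_cdf p z.1 z.2)| <= 2 *
      N%:R^-1.
  by rewrite eA; apply: mean_le => // z; exact: upper_quadrant.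
rewrite meanD !meanB mean_cst// in eB.
have eC : mean ph (fun z => cell_cdf ph z.1 z.2 - cell_cdf p z.1 z.2) =
  mean p (fun z => cell_cdf ph z.1 z.2 - cell_cdf p z.1 z.2) +
  \sum_z (ph z - p z) * rect_sum (fun z => ph z - p z)
     (fun a => (a <= z.1)%N) (fun b => (b <= z.2)%N).
  rewrite (mean_diff p); congr (_ + _); apply: eq_bigr => z _.
  by rewrite rect_sumB.
rewrite !meanB in eC.
have tN : N%:R^-1 <= t ^+ 3.
  by apply: (le_trans mesh_le); rewrite ler_wiXn2l// ltW.
move: cr eB eC.
set s := \sum_z _; set m1 := mean _ _; set m2 := mean _ _.
set m3 := mean _ _; set m4 := mean _ _; set m5 := mean _ _; set m6 := mean _ _.
rewrite !ler_norml; lra.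
Qed.

Lemma cell_mass_mean_le (f g : I -> R) (e : R) : (forall a, `|f a - g a| <= e)
  ->
  `|\sum_a cell_mass a * f a - \sum_a cell_mass a * g a| <= e.
Proof.
move=> fg; rewrite -sumrB; apply: (le_trans (ler_norm_sum _ _ _)).
rewrite -[leRHS]mul1r -(@sum_cell_mass R N N_gt0) mulr_suml;
  apply: ler_sum => a _.
by rewrite -mulrBr normrM ger0_norm ?cell_mass_ge0// ler_wpM2l ?cell_mass_ge0.
Qed.

Lemma mean_node1 p : uniform_margins p ->
  `|mean p (fun z => node z.1) - 2^-1| <= N%:R^-1.
Proof. by move=> pm; rewrite mean_marginl// sum_node_cell_mass. Qed.

Lemma mean_node2 p : uniform_margins p ->
  `|mean p (fun z => node z.2) - 2^-1| <= N%:R^-1.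
Proof. by move=> pm; rewrite mean_marginr// sum_node_cell_mass. Qed.

Lemma mean_cell_mass_rect p (A : pred I) :
  \sum_(c : I) cell_mass c * rect_sum p A (fun b => (b <= c)%N) =
  mean p (fun z => (A z.1)%:R * \sum_(c : I | (z.2 <= c)%N) cell_mass c).
Proof.
rewrite /mean.
transitivity (\sum_(c : I) \sum_z cell_mass c * (p z * ((A z.1)%:R * (z.2 <=
  c)%N%:R))).
  by apply: eq_bigr => c _; rewrite rect_sumE mulr_sumr.
rewrite exchange_big/=; apply: eq_bigr => z _.
rewrite [in RHS]big_mkcond/= 2!mulr_sumr; apply: eq_bigr => c _.
by case: ifP => _; rewrite ?(mulr1, mulr0)//; ring.
Qed.

(** As V is 1 minus the integral of 1(V <= z) over z, E[1(U < u) V] is u minus the section integral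
    of C; this is subtracted from E V = 1/2. Each of the four approximations costs 1/N. *)
Lemma mean_section_upper p (a : I) : weights p -> uniform_margins p ->
  `|mean p (fun z => (a <= z.1)%N%:R * node z.2)
    - (2^-1 - node a + mean_section p a)| <= 4 * N%:R^-1.
Proof.
move=> pw pm.
pose lt : pred I := fun a' => (a' < a)%N.
have h1 := mean_node2 pm.
have h2 : mean p (fun z => (a <= z.1)%N%:R * node z.2) =
    mean p (fun z => node z.2) - mean p (fun z => (lt z.1)%:R * node z.2).
  rewrite -meanB; apply: eq_mean => z; rewrite /lt.
  by case: ltnP; rewrite ?(mul1r, mul0r, subr0, subrr).
have h3 : `|mean p (fun z => (lt z.1)%:R * node z.2) -
    mean p (fun z => (lt z.1)%:R -
      (lt z.1)%:R * \sum_(c : I | (z.2 <= c)%N) cell_mass c)| <= N%:R^-1.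
  apply: mean_le => // z; case: (lt z.1); last first.
    by rewrite !mul0r !subr0 normr0 invr_ge0.
  rewrite /= !mul1r; have := @sum_cell_mass_ge R N N_gt0 z.2.
  by set S := \sum_(c | _) _; rewrite !ler_norml; lra.
rewrite meanB -mean_cell_mass_rect in h3.
have h4 : mean p (fun z => (lt z.1)%:R) = rect_sum p lt xpredT.
  by rewrite rect_sumE; apply: eq_bigr => z _; rewrite mulr1.
have /andP[h5 h6] := @rect_sum_lt_le p a xpredT pw pm.
rewrite -/(margin_cdf p a) margin_cdfE// -/lt in h5 h6.
have h7 : `|\sum_(c : I) cell_mass c * rect_sum p lt (fun b => (b <= c)%N)
    - mean_section p a| <= N%:R^-1.
  apply: cell_mass_mean_le => c; rewrite distrC.
  have /andP[? ?] := @rect_sum_lt_le p a (fun b => (b <= c)%N) pw pm.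
  by rewrite ger0_norm.
rewrite h2; rewrite h4 in h3; move: h1 h3 h5 h6 h7.
set m1 := mean _ _; set m2 := mean _ _; set m3 := rect_sum _ _ _.
set m4 := \sum_c _; rewrite !ler_norml; lra.
Qed.

(** Layer-cake formula: it turns the factor [node z.2] into an average over [c] of the indicators
    treated in [margin_remainder]. *)
Lemma node_sum (b : I) : node b = N%:R^-1 * \sum_(c < N) (c < b)%N%:R :> R.
Proof.
rewrite /node mulrC; congr (_ * _).
rewrite -natr_sum; congr (_%:R).
have bN : (b <= N)%N by rewrite -ltnS.
rewrite -[LHS]card_ord -sum1_card (big_ord_widen _ (fun=> 1%N) bN) big_mkcond.
by apply: eq_bigr => c _; case: ifP.
Qed.

(** Write the outer [ph] as [p] plus D. The D part is an average of the forms of [margin_remainder]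
    over thresholds; the [p] part is linear in the empirical margin and becomes, by Fubini, the mean
    under [ph] of the quantity in [mean_section_upper]. *)
Lemma margin_linearization p ph :
  weights p -> weights ph -> uniform_margins p -> rect_close k t p ph ->
  `|mean ph (fun z => (margin_cdf ph z.1 - node z.1) * node z.2)
    - (2^-1 - mean ph (fun z => node z.1) + mean ph (fun z => mean_section p
        z.1)
       - mean p (fun z => node z.1 * node z.2))|
  <= (12 * k ^+ 2 + 6 * k + 4) * t ^+ 3.
Proof.
move=> pw phw pm cl.
have tN : N%:R^-1 <= t ^+ 3.
  by apply: (le_trans mesh_le); rewrite ler_wiXn2l// ltW.
have h1 : `|\sum_z (ph z - p z) * ((margin_cdf ph z.1 - node z.1) * node z.2)|
    <= (12 * k ^+ 2 + 6 * k) * t ^+ 3.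
  pose F (c : nat) := \sum_z (ph z - p z) *
    (rect_sum (fun z => ph z - p z) (fun a => (a <= z.1)%N) xpredT
     * (c < z.2)%N%:R).
  have -> : \sum_z (ph z - p z) * ((margin_cdf ph z.1 - node z.1) * node z.2) =
      N%:R^-1 * \sum_(c < N) F c.
    rewrite /F exchange_big/= mulr_sumr; apply: eq_bigr => z _.
    rewrite -(margin_cdfE _ pm) /margin_cdf rect_sumB node_sum -mulr_sumr
      -mulr_sumr.
    by ring.
  rewrite normrM ger0_norm ?invr_ge0// mulrC ler_pdivrMr//.
  apply: (le_trans (ler_norm_sum _ _ _)).
  rewrite mulr_natr -[X in _ *+ X]card_ord -sumr_const; apply: ler_sum => c _.
  exact: (margin_remainder k_ge0 t01 Nt pw phw pm cl c).
have h2 : mean p (fun z => margin_cdf ph z.1 * node z.2) =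
    mean ph (fun z' => mean p (fun z => (z'.1 <= z.1)%N%:R * node z.2)).
  rewrite /mean; transitivity (\sum_z \sum_z'
      p z * ph z' * ((z'.1 <= z.1)%N%:R * node z.2)).
    apply: eq_bigr => z _; rewrite /margin_cdf rect_sumE mulr_suml mulr_sumr.
    by apply: eq_bigr => z' _; rewrite mulr1; ring.
  rewrite exchange_big/=; apply: eq_bigr => z' _; rewrite mulr_sumr.
  by apply: eq_bigr => z _; ring.
have h3 : `|mean p (fun z => margin_cdf ph z.1 * node z.2) -
    mean ph (fun z => 2^-1 - node z.1 + mean_section p z.1)| <= 4 * N%:R^-1.
  by rewrite h2; apply: mean_le => // z; exact: mean_section_upper.
rewrite meanD meanB mean_cst// in h3.
have h4 := mean_diff p ph (fun z => (margin_cdf ph z.1 - node z.1) * node z.2).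
have h5 : mean p (fun z => (margin_cdf ph z.1 - node z.1) * node z.2) =
    mean p (fun z => margin_cdf ph z.1 * node z.2) -
    mean p (fun z => node z.1 * node z.2).
  by rewrite -meanB; apply: eq_mean => z; ring.
rewrite h4 h5; move: h1 h3.
set s := \sum_z _; set m1 := mean _ _; set m2 := mean _ _.
set m3 := mean _ _; set m4 := mean _ _.
rewrite !ler_norml; lra.
Qed.

(** The integral of C is E (1 - U)(1 - V), which equals E UV because both margins have mean 1/2. *)
Lemma copula_integral_mean p : weights p -> uniform_margins p ->
  `|\sum_a cell_mass a * mean_section p a - mean p (fun z => node z.1 * node
    z.2)|
  <= 4 * N%:R^-1.
Proof.
move=> pw pm.
have h1 : \sum_a cell_mass a * mean_section p a = mean p (fun z =>
    (\sum_(a : I | (z.1 <= a)%N) cell_mass a) *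
    (\sum_(b : I | (z.2 <= b)%N) cell_mass b)).
  rewrite /mean (eq_bigr (fun a : I => \sum_z p z * (cell_mass a * (z.1 <=
    a)%N%:R
     * \sum_(b : I | (z.2 <= b)%N) cell_mass b))); last first.
    move=> a _; rewrite /mean_section (mean_cell_mass_rect p) mulr_sumr;
      apply: eq_bigr => z _.
    by ring.
  rewrite exchange_big/=; apply: eq_bigr => z _; rewrite -mulr_sumr -mulr_suml.
  congr (_ * (_ * _)); rewrite [RHS]big_mkcond; apply: eq_bigr => a _ /=.
  by case: ifP; rewrite ?mulr1 ?mulr0.
have h2 : `|\sum_a cell_mass a * mean_section p a -
    mean p (fun z => 1 - node z.1 - node z.2 + node z.1 * node z.2)| <= 2 *
      N%:R^-1.
  rewrite h1; apply: mean_le => // z.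
  have := @sum_cell_mass_ge R N N_gt0 z.1;
    have := @sum_cell_mass_ge R N N_gt0 z.2.
  have := node_ge0 (R := R) z.2; have := node_le1 (R := R) z.2.
  have : 0 <= \sum_(a : I | (z.1 <= a)%N) (cell_mass a : R) <= 1.
    rewrite sumr_ge0/=; last by move=> a _; rewrite cell_mass_ge0.
    rewrite -(@sum_cell_mass R N N_gt0) [leRHS](bigID (fun a : I => z.1 <=
      a)%N)/=.
    by rewrite lerDl sumr_ge0// => a _; rewrite cell_mass_ge0.
  set x := \sum_(a | _) _; set y := \sum_(a | _) _.
  move=> /andP[x0 x1] ? ? hy hx.
  have -> : x * y - (1 - node z.1 - node z.2 + node z.1 * node z.2) =
    x * (y - (1 - node z.2)) + (x - (1 - node z.1)) * (1 - node z.2) by ring.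
  have -> : 2 * N%:R^-1 = 1 * N%:R^-1 + N%:R^-1 * 1 :> R by ring.
  apply: (le_trans (ler_normD _ _)); rewrite lerD// normrM ler_pM//.
    by rewrite ger0_norm.
  by rewrite ler_norml; lra.
have h3 := mean_node1 pm; have h4 := mean_node2 pm.
rewrite meanD !meanB mean_cst// in h2.
move: h2 h3 h4; set m1 := mean _ _; set m2 := mean _ _; set m3 := mean _ _.
rewrite !ler_norml; lra.
Qed.

(** Expand the product of the two empirical margins around U V. The product of both deviations is
    O(t^4) by the global bound; the two terms with one deviation fall under [margin_linearization],
    transposed for the second. Of the three copies of E UV, two come from there and one from the
    integral of C. *)
Lemma rank_correlation_linearization p ph :
  weights p -> weights ph -> uniform_margins p -> rect_close k t p ph ->
  `|mean ph (fun z => margin_cdf ph z.1 * margin_cdf (swap_weights ph) z.2)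
    - \sum_a cell_mass a * mean_section p a
    - (mean ph (fun z => (1 - node z.1) * (1 - node z.2))
       - 3 * mean p (fun z => node z.1 * node z.2)
       + mean ph (fun z => mean_section p z.1)
       + mean ph (fun z => mean_section (swap_weights p) z.2))|
  <= (28 * k ^+ 2 + 12 * k + 12) * t ^+ 3.
Proof.
move=> pw phw pm cl.
have tN : N%:R^-1 <= t ^+ 3.
  by apply: (le_trans mesh_le); rewrite ler_wiXn2l// ltW.
have h1 := margin_linearization pw phw pm cl.
have h2 := margin_linearization (weights_swap pw) (weights_swap phw)
  (uniform_margins_swap pm) (rect_close_swap cl).
rewrite !mean_swap/= in h2.
have h3 := copula_integral_mean pw pm.
have h4 : `|mean ph (fun z => (margin_cdf ph z.1 - node z.1) *
    (margin_cdf (swap_weights ph) z.2 - node z.2)) - mean ph (fun=> 0)|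
    <= 4 * k ^+ 2 * t ^+ 3.
  apply: mean_le => // z; rewrite subr0 normrM.
  apply: (@le_trans _ _ ((2 * k * t ^+ 2) * (2 * k * t ^+ 2))).
    rewrite ler_pM//.
      rewrite -(margin_cdfE _ pm) /margin_cdf -rect_sumB.
      apply: rect_diff_le_global => //;
        [exact: index_interval_le|exact: index_interval_all].
    rewrite -(margin_cdfE _ (uniform_margins_swap pm)) /margin_cdf -rect_sumB.
    apply: (rect_diff_le_global k_ge0 t01 (weights_swap pw) (rect_close_swap
      cl)).
      exact: index_interval_le.
    exact: index_interval_all.
  have -> : 2 * k * t ^+ 2 * (2 * k * t ^+ 2) = 4 * k ^+ 2 * t ^+ 4 by ring.
  by rewrite ler_wpM2l ?mulr_ge0 ?sqr_ge0// ler_wiXn2l// ltW.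
rewrite mean_cst// subr0 in h4.
have h5 : mean ph (fun z => margin_cdf ph z.1 * margin_cdf (swap_weights ph)
  z.2) =
  mean ph (fun z => node z.1 * node z.2) +
  mean ph (fun z => (margin_cdf ph z.1 - node z.1) * node z.2) +
  mean ph (fun z => (margin_cdf (swap_weights ph) z.2 - node z.2) * node z.1) +
  mean ph (fun z => (margin_cdf ph z.1 - node z.1) *
    (margin_cdf (swap_weights ph) z.2 - node z.2)).
  by rewrite -!meanD; apply: eq_mean => z; ring.
have h6 : mean ph (fun z => (1 - node z.1) * (1 - node z.2)) =
    1 - mean ph (fun z => node z.1) - mean ph (fun z => node z.2) +
    mean ph (fun z => node z.1 * node z.2).
  by rewrite -[in RHS](mean_cst 1 phw) -!meanB -meanD; apply: eq_mean => z;
    ring.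
have h7 : mean p (fun z => node z.2 * node z.1) = mean p (fun z => node z.1 *
  node z.2).
  by apply: eq_mean => z; rewrite mulrC.
rewrite h7 in h2; rewrite h5 h6; move: h1 h2 h3 h4.
set m1 := mean _ _; set m2 := mean _ _; set m3 := mean _ _; set m4 := mean _ _.
set m5 := mean _ _; set m6 := mean _ _; set m7 := mean _ _; set m8 := mean _ _.
set m9 := mean _ _; set m10 := \sum_a _.
rewrite !ler_norml; lra.
Qed.

End Linearization.

(** * Rank statistics and cell frequencies *)

Section Telescope.
Context {R : realType}.
Variables (q : nat -> R) (e : R).
Hypotheses (q0 : forall a, 0 <= q a) (qe : forall a, q a <= e).
Local Notation S := (fun m => \sum_(a < m) q a).

(** Discrete form of d(S^2) = 2 S dS: each increment of S^2 misses 2 q S by q^2, which is at most e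
    q. *)
Lemma telescope_square (m : nat) :
  `|\sum_(a < m) 2 * (q a * S a.+1) - S m ^+ 2| <= e * S m.
Proof.
elim: m => [|m IH]; first by rewrite !big_ord0 expr0n subrr normr0 mulr0.
rewrite big_ord_recr/= [X in _ - X ^+ 2]big_ord_recr/= [X in e *
  X]big_ord_recr/=.
move: IH; rewrite [in X in _ + X - _]big_ord_recr/=.
have := q0 m; have := qe m; rewrite !ler_norml.
set T := \sum_(i < m) _ ; set s := \sum_(i < m) _ => h1 h2 /andP[h3 h4].
by apply/andP; split; nra.
Qed.

Lemma telescope_cube (m : nat) : S m <= 1 ->
  `|\sum_(a < m) 3 * (q a * S a.+1 ^+ 2) - S m ^+ 3| <= 3 * e * S m.
Proof.
elim: m => [|m IH]; first by rewrite !big_ord0 expr0n subrr normr0 mulr0.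
rewrite [X in X <= 1]big_ord_recr/= => S1.
rewrite big_ord_recr/= [X in _ - X ^+ 3]big_ord_recr/= [X in 3 * e *
  X]big_ord_recr/=.
rewrite [in X in _ + X - _]big_ord_recr/=.
have := q0 m; have qem := qe m; move: IH S1; rewrite !ler_norml.
have : 0 <= \sum_(i < m) q i by rewrite sumr_ge0.
set T := \sum_(i < m) 3 * _ ; set s := \sum_(i < m) _; set x := q m in qem *.
move=> s0 IH S1 x0; have {IH} /andP[h3 h4] := IH ltac:(lra).
(* The error of one increment is at most 3 e x because x <= e and s + x <= 1. *)
have -> : T + 3 * (x * (s + x) ^+ 2) - (s + x) ^+ 3 =
  (T - s ^+ 3) + x ^+ 2 * (3 * s + 2 * x) by ring.
have x2 : x ^+ 2 <= e * x by rewrite expr2 ler_wpM2r.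
have x20 := sqr_ge0 x.
have : x ^+ 2 * (3 * s + 2 * x) <= e * x * 3.
  by rewrite ler_pM//; lra.
have : 0 <= x ^+ 2 * (3 * s + 2 * x) by rewrite mulr_ge0//; lra.
have : 0 <= e * x by rewrite mulr_ge0// (le_trans x0).
set y := x ^+ 2 * _.
have -> : 3 * e * (s + x) = 3 * e * s + e * x * 3 by ring.
by move=> *; apply/andP; split; lra.
Qed.

End Telescope.

Section SampleMatrix.
Context {R : realType} {n N : nat}.
Local Notation I := 'I_N.+1.
Variables (a b : 'I_n -> I).

Definition cell_freq (z : I * I) : R :=
  n%:R^-1 * \sum_(i < n) ((a i, b i) == z)%:R.

Lemma mean_cell_freq (f : I * I -> R) :
  mean cell_freq f = n%:R^-1 * \sum_(i < n) f (a i, b i).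
Proof.
rewrite /mean mulr_sumr.
under eq_bigr do rewrite -mulrA mulrC mulr_suml mulr_suml.
rewrite exchange_big/=; apply: eq_bigr => i _.
rewrite (bigD1 (a i, b i))//= eqxx mul1r big1 ?addr0 1?mulrC// => z zi.
by rewrite eq_sym (negbTE zi) !mul0r.
Qed.

Lemma rect_sum_cell_freq (A B : pred I) :
  rect_sum cell_freq A B = n%:R^-1 * \sum_(i < n) (A (a i) && B (b i))%:R.
Proof.
rewrite rect_sumE -/(mean _ _) mean_cell_freq; congr (_ * _).
by apply: eq_bigr => i _ /=; case: (A _); case: (B _); rewrite ?(mulr1, mulr0).
Qed.

Lemma cell_freq_weights : (0 < n)%N -> weights cell_freq.
Proof.
move=> n0; split.
  by move=> z; rewrite mulr_ge0 ?invr_ge0// sumr_ge0.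
have := mean_cell_freq (fun=> 1); rewrite /mean.
under eq_bigr do rewrite mulr1.
by move=> ->; rewrite sumr_const card_ord mulVf// pnatr_eq0 -lt0n.
Qed.

End SampleMatrix.

Lemma cell_freq_swap {R : realType} n N (a b : 'I_n -> 'I_N.+1) :
  swap_weights (@cell_freq R n N a b) =1 cell_freq b a.
Proof.
move=> [i j]; rewrite /swap_weights /cell_freq/=; congr (_ * _).
by apply: eq_bigr => s _; rewrite !xpair_eqE andbC.
Qed.

Section MarginMoments.
Context {R : realType} {N : nat}.
Local Notation I := 'I_N.+1.
Variables (w : I * I -> R) (e : R).
Hypotheses (ww : weights w) (we : forall a, rect_sum w (pred1 a) xpredT <= e).

(** Indexed by all naturals, with value 0 beyond [N], to fit the telescoping sums. *)
Let q (m : nat) : R := rect_sum w (fun a : I => a == m :> nat) xpredT.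

Let q_ge0 m : 0 <= q m. Proof. by case: ww => w0 _; exact: rect_sum_ge0. Qed.

Let q_le m : q m <= e.
Proof.
have e0 : 0 <= e by apply: le_trans (we ord0); case: ww => w0 _;
  exact: rect_sum_ge0.
have [mN|Nm] := ltnP m N.+1; first exact: (we (Ordinal mN)).
rewrite /q /rect_sum big1// => z /andP[/eqP zm _].
by have := ltn_ord z.1; rewrite zm ltnNge Nm.
Qed.

Let q_sum m : \sum_(a < m) q a = rect_sum w (fun a => (a < m)%N) xpredT.
Proof.
rewrite /q; elim: m => [|m IH].
  by rewrite big_ord0 /rect_sum big_pred0.
rewrite big_ord_recr/= IH -(@rect_sum_splitl _ _ w (fun a => (a < m.+1)%N))//.
by move=> a; rewrite ltnS; case: ltngtP.
Qed.

Let q_total : \sum_(a < N.+1) q a = 1.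
Proof.
rewrite q_sum; case: ww => _ <-; apply: eq_bigl => z.
by rewrite ltn_ord.
Qed.

Lemma mean_margin_cdf (f : I -> R) :
  mean w (fun z => f z.1) = \sum_(a < N.+1) q a * f a.
Proof.
rewrite /mean (partition_big (fun z => z.1) predT)//=; apply: eq_bigr => a _.
rewrite /q /rect_sum mulr_suml; apply: eq_big => [z|z /eqP ->]//=.
by rewrite -val_eqE andbT.
Qed.

Lemma margin_cdf_first_moment :
  `|2 * mean w (fun z => margin_cdf w z.1) - 1| <= e.
Proof.
rewrite mean_margin_cdf mulr_sumr.
have := telescope_square q_ge0 q_le N.+1; rewrite q_total expr1n mulr1.
by under eq_bigr do rewrite q_sum.
Qed.

Lemma margin_cdf_second_moment :
  `|3 * mean w (fun z => margin_cdf w z.1 ^+ 2) - 1| <= 3 * e.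
Proof.
rewrite (mean_margin_cdf (fun a => margin_cdf w a ^+ 2)) mulr_sumr.
have := @telescope_cube _ _ _ q_ge0 q_le N.+1; rewrite q_total expr1n mulr1.
under eq_bigr do rewrite q_sum.
by apply.
Qed.

End MarginMoments.

Section RankStatistics.
Context {R : realType} {d n N : nat}.
Local Notation I := 'I_N.+1.
Variables (x : 'I_n -> d.-tuple R).

(** The order of the cells decides the order of the observations except inside one cell line, so a
    rank is known up to the frequency of that line. Tied observations always share a line. *)
Lemma pseudo_obs_margin_cdf (l : 'I_d) (a b : 'I_n -> I) (e : R) i :
  let ph := @cell_freq R n N a b in
  (forall i j, (a i < a j)%N -> tnth (x i) l < tnth (x j) l) ->
  (forall c, rect_sum ph (pred1 c) xpredT <= e) ->
  margin_cdf ph (a i) - e <= pseudo_obs x i l <= margin_cdf ph (a i).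
Proof.
move=> ph al ae; rewrite /pseudo_obs mulrC /margin_cdf rect_sum_cell_freq /rank
  -sum1_card natr_sum.
rewrite lerBlDr.
have -> : \sum_(k in [pred k | tnth (x k) l <= tnth (x i) l]) 1%:R =
    \sum_k (tnth (x k) l <= tnth (x i) l)%R%:R :> R.
  by rewrite big_mkcond; apply: eq_bigr => k _; rewrite inE; case: ifP.
apply/andP; split; last first.
  rewrite ler_wpM2l ?invr_ge0//; apply: ler_sum => k _.
  rewrite andbT ler_nat; case: (leqP (a k) (a i)) => [_|/al];
    first by rewrite leq_b1.
  by rewrite ltNge; case: (_ <= _).
have := ae (a i); rewrite rect_sum_cell_freq => h;
  apply: (le_trans _ (lerD (lexx _) h)).
rewrite -mulrDr ler_wpM2l ?invr_ge0// -big_split/=; apply: ler_sum => k _.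
rewrite !andbT -natrD ler_nat; case: (ltngtP (a k) (a i)) => //= [/al/ltW
  ->//|/eqP].
by rewrite val_eqE => ->; rewrite addn1.
Qed.

Variables (l m : 'I_d) (a b : 'I_n -> I) (e : R).
Local Notation ph := (@cell_freq R n N a b).
Hypotheses (n_ge2 : (2 <= n)%N).
Hypotheses (al : forall i j, (a i < a j)%N -> tnth (x i) l < tnth (x j) l).
Hypotheses (bm : forall i j, (b i < b j)%N -> tnth (x i) m < tnth (x j) m).
Hypotheses (ae : forall c, rect_sum ph (pred1 c) xpredT <= e).
Hypotheses (be : forall c, rect_sum (swap_weights ph) (pred1 c) xpredT <= e).

Let n0 : (0 : R) < n%:R. Proof. by rewrite ltr0n ltnW. Qed.
Let n2 : (2 : R) <= n%:R. Proof. by rewrite ler_nat. Qed.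
Let phw : weights ph. Proof. by apply: cell_freq_weights; rewrite ltnW. Qed.
Let e0 : 0 <= e.
Proof. by apply: le_trans (ae ord0); case: phw => w0 _;
  exact: rect_sum_ge0. Qed.

Lemma margin_cdf_swap_freq c :
  margin_cdf (swap_weights ph) c = margin_cdf (@cell_freq R n N b a) c.
Proof. by apply: eq_bigr => z _; exact: cell_freq_swap. Qed.

Lemma pseudo_obs_margin_cdf_swap i :
  margin_cdf (swap_weights ph) (b i) - e <= pseudo_obs x i m
    <= margin_cdf (swap_weights ph) (b i).
Proof.
rewrite margin_cdf_swap_freq; apply: pseudo_obs_margin_cdf => // c.
have -> : rect_sum (@cell_freq R n N b a) (pred1 c) xpredT =
    rect_sum (swap_weights ph) (pred1 c) xpredT.
  by apply: eq_bigr => z _; rewrite cell_freq_swap.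
exact: be.
Qed.

Lemma sample_mean_le (F G : 'I_n -> R) (c : R) : (forall i, `|F i - G i| <= c)
  ->
  `|n%:R^-1 * \sum_i F i - n%:R^-1 * \sum_i G i| <= c.
Proof.
move=> FG; rewrite -mulrBr -sumrB normrM ger0_norm ?invr_ge0// mulrC.
rewrite ler_pdivrMr//; apply: (le_trans (ler_norm_sum _ _ _)).
by rewrite mulr_natr -[X in _ *+ X]card_ord -sumr_const ler_sum.
Qed.

Lemma pseudo_obs_ge0 i j : 0 <= pseudo_obs x i j.
Proof. by rewrite divr_ge0. Qed.

Lemma pseudo_obs_le1 i j : pseudo_obs x i j <= 1.
Proof.
rewrite ler_pdivrMr// mul1r ler_nat -[leqRHS]card_ord.
exact: max_card.
Qed.

(** With [V] the mean squared difference of the pseudo-observations, rho-hat is 1 - 6 V - 6 V / (n^2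
    - 1). Up to ties [V] is the mean of (G - H)^2 for the empirical margins G and H; their second
    moments are close to 1/3, which turns 1 - 6 V into 12 times the mean of GH, minus 3. *)
Lemma spearman_hat_mean :
  `|spearman_hat x l m - (12 * mean ph (fun z =>
      margin_cdf ph z.1 * margin_cdf (swap_weights ph) z.2) - 3)|
  <= 36 * e + 6 * n%:R^-1.
Proof.
have phw' := weights_swap phw.
pose G := margin_cdf ph; pose H := margin_cdf (swap_weights ph).
pose V := n%:R^-1 * \sum_i (pseudo_obs x i l - pseudo_obs x i m) ^+ 2.
have h1 : `|V - mean ph (fun z => (G z.1 - H z.2) ^+ 2)| <= 4 * e.
  rewrite mean_cell_freq; apply: sample_mean_le => i /=.
  have := pseudo_obs_margin_cdf i al ae; have := pseudo_obs_margin_cdf_swap i.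
  have := pseudo_obs_ge0 i l; have := pseudo_obs_ge0 i m.
  have := pseudo_obs_le1 i l; have := pseudo_obs_le1 i m.
  have : 0 <= G (a i) by case: phw => w0 _; exact: rect_sum_ge0.
  have : 0 <= H (b i) by case: phw' => w0 _; exact: rect_sum_ge0.
  have : G (a i) <= 1 by exact: rect_sum_le1.
  have : H (b i) <= 1 by exact: rect_sum_le1.
  rewrite -/G -/H; move: (pseudo_obs _ _ _) (pseudo_obs _ _ _) (G _) (H _).
  move=> r s g h h1 g1 h0 g0 ? ? ? ? /andP[? ?] /andP[? ?].
  rewrite subr_sqr normrM [4 * e](_ : _ = (2 * e) * 2); last by ring.
  by rewrite ler_pM// ler_norml; apply/andP; split; lra.
have h2 : mean ph (fun z => (G z.1 - H z.2) ^+ 2) =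
    mean ph (fun z => G z.1 ^+ 2) + mean ph (fun z => H z.2 ^+ 2) -
    2 * mean ph (fun z => G z.1 * H z.2).
  by rewrite -meanZ -meanD -meanB; apply: eq_mean => z; ring.
have h3 := margin_cdf_second_moment phw ae.
have h4 := margin_cdf_second_moment phw' be.
rewrite mean_swap/= in h4.
have V0 : 0 <= V by rewrite mulr_ge0 ?invr_ge0// sumr_ge0// => i _;
  rewrite sqr_ge0.
have V1 : V <= 1.
  rewrite /V mulrC ler_pdivrMr// mul1r -[X in _ <= X%:R]card_ord -sum1_card
    natr_sum.
  apply: ler_sum => i _.
  have := pseudo_obs_ge0 i l; have := pseudo_obs_ge0 i m.
  have := pseudo_obs_le1 i l; have := pseudo_obs_le1 i m.
  move=> ? ? ? ?; rewrite -(ger0_norm (sqr_ge0 _)) normrX expr_le1//.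
  by rewrite ler_norml; lra.
have nn : n%:R + 1 <= n%:R ^+ 2 - 1 :> R.
  by have := ler_wpM2r (ltW n0) n2; rewrite -expr2; have := n2; lra.
have h5 : spearman_hat x l m = 1 - 6 * V - 6 * V / (n%:R ^+ 2 - 1).
  rewrite /spearman_hat /V.
  have -> : \sum_(i < n) ((rank x i l)%:R - (rank x i m)%:R) ^+ 2 =
     n%:R ^+ 2 * \sum_(i < n) (pseudo_obs x i l - pseudo_obs x i m) ^+ 2.
    rewrite mulr_sumr; apply: eq_bigr => i _; rewrite /pseudo_obs.
    by field; rewrite gt_eqF.
  have n1 : n%:R - 1 != 0 :> R by rewrite gt_eqF// subr_gt0 ltr1n.
  have n2' : n%:R + 1 != 0 :> R by rewrite gt_eqF// addr_gt0.
  have n3 : n%:R ^+ 2 - 1 != 0 :> R by rewrite gt_eqF//; apply: lt_le_trans nn;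
    rewrite addr_gt0.
  by field; rewrite n1 n2' n3 gt_eqF.
have h6 : 0 <= V / (n%:R ^+ 2 - 1) <= n%:R^-1.
  have nn0 : 0 < n%:R ^+ 2 - 1 :> R by apply: lt_le_trans nn; rewrite addr_gt0.
  rewrite divr_ge0 ?(ltW nn0)//= ler_pdivrMr//; apply: (le_trans V1).
  rewrite -[leLHS](mulVf (lt0r_neq0 n0)) ler_wpM2l ?invr_ge0//.
  by rewrite (le_trans _ nn)// lerDl.
move/andP: h6 => [h6 h7]; rewrite h5; move: h1 h3 h4.
rewrite h2 -/G -/H; move: h6 h7; rewrite !ler_norml.
set m1 := mean _ _; set m2 := mean _ _; set m3 := mean _ _.
set y := V / _; have -> : 6 * V / (n%:R ^+ 2 - 1) = 6 * y by rewrite -mulrA.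
by clearbody y m1 m2 m3 V; move: (n%:R^-1) => ni *; lra.
Qed.

(** The product of signs equals (2 1(a' <= a) - 1)(2 1(b' <= b) - 1) unless the two observations
    share a column or a row of cells, each of frequency at most [e]; then they differ by at most 2.
    Expanding leaves [cell_cdf] and first moments of the margins, close to 1/2. Replacing n (n - 1)
    by n^2 costs 2/n. *)
Lemma kendall_hat_mean :
  `|kendall_hat x l m - (4 * mean ph (fun z => cell_cdf ph z.1 z.2) - 1)|
  <= 6 * e + 2 * n%:R^-1.
Proof.
have phw' := weights_swap phw.
pose s i j := Num.sg (tnth (x i) l - tnth (x j) l) *
  Num.sg (tnth (x i) m - tnth (x j) m).
pose c i j : R := (2 * (a j <= a i)%N%:R - 1) * (2 * (b j <= b i)%N%:R - 1).
pose full := \sum_i \sum_j s i j.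
have s1 i j : `|s i j| <= 1.
  rewrite /s normrM !normr_sg.
  by case: (_ != 0); case: (_ != 0); rewrite ?mulr1 ?mulr0.
have h1 : kendall_hat x l m = full / (n%:R * (n%:R - 1)).
  rewrite /kendall_hat mulrC mulrA; congr (_ / _).
  have -> : full = \sum_(i : 'I_n) \sum_(j : 'I_n | (i < j)%N) s i j +
      \sum_(i : 'I_n) \sum_(j : 'I_n | (j < i)%N) s i j.
    rewrite -big_split; apply: eq_bigr => i _ /=.
    rewrite (bigID (fun j : 'I_n => (i < j)%N))/=; congr (_ + _).
    rewrite (bigD1 i) ?ltnn//= /s subrr sgr0 mul0r add0r.
    by apply: eq_bigl => j; rewrite -leqNgt ltn_neqAle andbC.
  rewrite [X in _ = _ + X](exchange_big_dep predT)//=.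
  rewrite mulr_natr mulr2n; congr (_ + _); apply: eq_bigr => i _.
  apply: eq_bigr => j _; rewrite /s -[tnth (x j) l - _]opprB.
  by rewrite -[tnth (x j) m - _]opprB !sgrN mulrNN.
have fullE : n%:R^-1 * (n%:R^-1 * full) =
    n%:R^-1 * \sum_i (n%:R^-1 * \sum_j s i j) by rewrite -mulr_sumr.
have full_le : `|n%:R^-1 * (n%:R^-1 * full)| <= 1.
  have sm (F : 'I_n -> R) : (forall i, `|F i| <= 1) -> `|n%:R^-1 * \sum_i F i|
    <= 1.
    move=> F1; have := @sample_mean_le F (fun=> 0) 1.
    by rewrite big1_eq mulr0 subr0; apply => i; rewrite subr0.
  by rewrite fullE; apply: (sm) => i; apply: (sm).
have h2 : `|n%:R^-1 * (n%:R^-1 * full) -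
    mean ph (fun z => mean ph (fun z' =>
      (2 * (z'.1 <= z.1)%N%:R - 1) * (2 * (z'.2 <= z.2)%N%:R - 1)))| <= 4 * e.
  rewrite fullE mean_cell_freq; apply: sample_mean_le => i;
    rewrite mean_cell_freq/=.
  rewrite -mulrBr -sumrB normrM ger0_norm ?invr_ge0//.
  have -> : 4 * e = 2 * e + 2 * e by ring.
  apply: (le_trans _ (lerD (ler_wpM2l _ (ae (a i))) (ler_wpM2l _ (be (b i)))))
    => //.
  rewrite rect_sum_swap !rect_sum_cell_freq.
  rewrite !mulrA ![2 * _]mulrC -!mulrA -mulrDr ler_wpM2l ?invr_ge0//.
  apply: (le_trans (ler_norm_sum _ _ _)); rewrite !mulr_sumr -big_split/=.
  apply: ler_sum => j _; rewrite andbT.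
  have sc : `|s i j - c i j| <= 2.
    have := s1 i j; rewrite /c; case: (_ <= _)%N; case: (_ <= _)%N;
      rewrite !ler_norml /=; lra.
  have al1 := @al i j; have al2 := @al j i.
  have bm1 := @bm i j; have bm2 := @bm j i.
  have sP (u v : R) : u < v -> Num.sg (u - v) = -1 /\ Num.sg (v - u) = 1.
    by move=> uv; rewrite ltr0_sg ?gtr0_sg ?subr_gt0 ?subr_lt0.
  rewrite -/(s i j) -/(c i j).
  case: (eqVneq (a j) (a i)) => [|aij].
    move=> _; apply: (le_trans sc); rewrite mulr1 lerDl.
    by case: (_ == _); rewrite ?mulr1 ?mulr0.
  case: (eqVneq (b j) (b i)) => [|bij].
    by move=> _; apply: (le_trans sc); rewrite mulr0 mulr1 add0r.
  rewrite !mulr0 addr0 /s /c.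
  case: (ltngtP (a j) (a i)) aij => [/al2/sP[A1 A2]|/al1/sP[A1 A2]|/eqP];
    last first.
  - by rewrite val_eqE => ->.
  - case: (ltngtP (b j) (b i)) bij => [/bm2/sP[B1 B2]|/bm1/sP[B1 B2]|/eqP];
      last first.
    + by rewrite val_eqE => ->.
    + by rewrite A1 B1 => _ _ /=; rewrite normr_le0; apply/eqP; ring.
    + by rewrite A1 B2 => _ _ /=; rewrite normr_le0; apply/eqP; ring.
  - case: (ltngtP (b j) (b i)) bij => [/bm2/sP[B1 B2]|/bm1/sP[B1 B2]|/eqP];
      last first.
    + by rewrite val_eqE => ->.
    + by rewrite A2 B1 => _ _ /=; rewrite normr_le0; apply/eqP; ring.
    + by rewrite A2 B2 => _ _ /=; rewrite normr_le0; apply/eqP; ring.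
have h3 : mean ph (fun z => mean ph (fun z' =>
      (2 * (z'.1 <= z.1)%N%:R - 1) * (2 * (z'.2 <= z.2)%N%:R - 1))) =
    4 * mean ph (fun z => cell_cdf ph z.1 z.2) - 2 * mean ph (fun z =>
      margin_cdf ph z.1)
    - 2 * mean ph (fun z => margin_cdf (swap_weights ph) z.2) + 1.
  rewrite -[X in _ = _ + X](mean_cst _ phw) -!meanZ -!meanB -meanD.
  apply: eq_mean => z.
  rewrite /cell_cdf /margin_cdf rect_sum_swap !rect_sumE -!/(mean _ _).
  rewrite -[X in _ = _ + X](mean_cst _ phw) -!meanZ -!meanB -meanD.
  by apply: eq_mean => z'; rewrite /=; ring.
have h4 := margin_cdf_first_moment phw ae.
have h5 := margin_cdf_first_moment phw' be; rewrite mean_swap/= in h5.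
have h6 : full / (n%:R * (n%:R - 1)) = n%:R^-1 * (n%:R^-1 * full) +
    n%:R^-1 * (n%:R^-1 * full) * (n%:R - 1)^-1.
  by field; rewrite !gt_eqF// subr_gt0 ltr1n.
have h7 : `|n%:R^-1 * (n%:R^-1 * full) * (n%:R - 1)^-1| <= 2 * n%:R^-1.
  rewrite normrM -[leRHS]mul1r ler_pM//.
  rewrite ger0_norm ?invr_ge0 ?subr_ge0 ?ler1n 1?ltnW//.
  rewrite -ler_pdivrMr ?invr_gt0// invrK mulrC ler_pdivrMr ?subr_gt0 ?ltr1n//.
  by have := n2; lra.
rewrite h1 h6; rewrite h3 in h2; move: h2 h4 h5 h7.
set y := _ * (n%:R - 1)^-1; set f := n%:R^-1 * _.
set m1 := mean _ _; set m2 := mean _ _; set m3 := mean _ _.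
rewrite !ler_norml; clearbody y f m1 m2 m3.
by move: (n%:R^-1) => ni *; lra.
Qed.

End RankStatistics.

Lemma norm_andb_le {R : realType} (p q r s : bool) :
  `|(p && q)%:R - (r && s)%:R| <= `|p%:R - r%:R| + `|q%:R - s%:R| :> R.
Proof.
by case: p q r s => [] [] [] []; rewrite /= ?subrr ?subr0 ?sub0r ?normrN ?normr0
  ?normr1; lra.
Qed.

(** Here [c] is the cell of the empirical median. The next cell adds at most [e], so the margin at
    [c] exceeds 1/2 - e. By the sandwich for ranks, an observation on which the indicators disagree
    lies beyond [c] in a cell of margin at most 1/2 + e; such cells have total frequency at most 2
    e. *)
Lemma half_quantile {R : realType} {d n N : nat} (x : 'I_n -> d.-tuple R)
    (l : 'I_d) (a b : 'I_n -> 'I_N.+1) (e : R) :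
  let ph := cell_freq a b in
  (0 < n)%N ->
  (forall i j, (a i < a j)%N -> tnth (x i) l < tnth (x j) l) ->
  (forall c, rect_sum ph (pred1 c) xpredT <= e) -> e <= 4^-1 ->
  exists2 c : 'I_N.+1, `|margin_cdf ph c - 2^-1| <= e &
    n%:R^-1 * \sum_i `|(pseudo_obs x i l <= 2^-1)%R%:R - (a i <= c)%N%:R| <= 2
      * e.
Proof.
move=> ph n_gt0 al ae e4; have phw : weights ph by exact: cell_freq_weights.
have n0 : (0 : R) < n%:R by rewrite ltr0n.
have ph0 := phw.1.
have e0 : 0 <= e by apply: le_trans (ae ord0); exact: rect_sum_ge0.
have G0 : margin_cdf ph ord0 <= e.
  apply: le_trans (ae ord0); apply: rect_sum_mono => // c.
  by rewrite !unfold_in /= leqn0 -val_eqE.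
have Gmono (c c' : 'I_N.+1) : (c <= c')%N -> margin_cdf ph c <= margin_cdf ph
  c'.
  by move=> cc; apply: rect_sum_mono => // a';
    rewrite !unfold_in /= => /leq_trans; apply.
have maxi (v : R) : e <= v -> exists2 c : 'I_N.+1, margin_cdf ph c <= v &
    forall c' : 'I_N.+1, margin_cdf ph c' <= v -> (c' <= c)%N.
  move=> ev; have Pv : margin_cdf ph ord0 <= v by exact: le_trans ev.
  pose F (c : 'I_N.+1) : nat := c.
  by case: (@arg_maxnP _ ord0 (fun c => margin_cdf ph c <= v) F Pv) => c cv cm;
    exists c.
(* The maximum is over a nonempty set: the margin at the first index is at most [e], below 1/2. *)
have [c cv cm] := maxi 2^-1 ltac:(lra).
have [c' cv' cm'] := maxi (2^-1 + e) ltac:(lra).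
have cN : (c.+1 < N.+1)%N.
  rewrite ltnS ltn_neqAle -ltnS ltn_ord andbT; apply/eqP => cN.
  have : margin_cdf ph c = 1.
    rewrite -phw.2; apply: eq_bigl => z /=; rewrite andbT cN.
    by rewrite -ltnS ltn_ord.
  by move=> G1; rewrite G1 in cv; lra.
have G1 : 2^-1 < margin_cdf ph (Ordinal cN).
  by rewrite ltNge; apply/negP => /cm /=; rewrite ltnn.
have G2 : margin_cdf ph (Ordinal cN) = margin_cdf ph c +
    rect_sum ph (pred1 (Ordinal cN)) xpredT.
  apply: rect_sum_splitl => a' /=; rewrite -val_eqE/=.
  rewrite [(a' <= c.+1)%N]leq_eqVlt ltnS.
  by case: eqVneq => [->|_]; rewrite ?ltnn ?addn0.
have G3 := ae (Ordinal cN).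
exists c; first by rewrite ler_norml; apply/andP; split; lra.
have cc' : margin_cdf ph c' = margin_cdf ph c +
    rect_sum ph (fun k => (c < k <= c')%N) xpredT.
  apply: rect_sum_splitl => k /=.
  have : (c <= c')%N by apply: cm'; lra.
  by case: (leqP k c) => kc cc; rewrite /= ?(leq_trans kc cc).
apply: (@le_trans _ _ (rect_sum ph (fun k => (c < k <= c')%N) xpredT));
  last by lra.
rewrite rect_sum_cell_freq ler_wpM2l ?invr_ge0//; apply: ler_sum => i _.
have /andP[h1 h2] := pseudo_obs_margin_cdf i al ae.
rewrite andbT; case: (leqP (a i) c) => [aic|cai] /=.
  have -> : pseudo_obs x i l <= 2^-1 by apply: (le_trans h2);
    apply: le_trans cv; exact: Gmono.
  by rewrite subrr normr0.
rewrite subr0; case: (lerP (pseudo_obs x i l)) => // h3; last by rewrite normr0.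
by rewrite cm' ?normr1//; move: h1 h3; rewrite -/ph; lra.
Qed.

(** * The deviation process near the medians *)

Section Oscillation.
Context {R : realType} {N : nat}.
Local Notation I := 'I_N.+1.
Variables (k t : R) (p ph : I * I -> R).
Local Notation D := (fun z => ph z - p z).
Hypotheses (k_ge0 : 0 <= k) (t01 : 0 < t <= 1) (Nt : 1 <= N%:R * t ^+ 4).
Hypotheses (pw : weights p) (pm : uniform_margins p) (cl : rect_close k t p ph).

Let t0 : 0 < t. Proof. by case/andP: t01. Qed.
Let t1 : t <= 1. Proof. by case/andP: t01. Qed.

(** A line of cells has probability at most 1/N <= t^4, so the Gaussian term t^2 sqrt(p) is itself
    of order t^4. *)
Lemma line_freq_le (c : I) : rect_sum ph (pred1 c) xpredT <= (1 + 2 * k) * t ^+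
  4.
Proof.
have h1 : rect_sum p (pred1 c) xpredT <= t ^+ 4.
  rewrite rect_sum_marginl// (big_pred1 c)//.
  exact: le_trans (cell_mass_le _) (mesh_le t01 Nt).
have h2 : `|rect_sum D (pred1 c) xpredT| <= k * (t ^+ 2 * t ^+ 2 + t ^+ 4).
  apply: rect_diff_le => //; [exact: index_interval1|exact: index_interval_all|
    by rewrite -exprM|exact: sqr_ge0].
rewrite rect_sumB ler_norml -exprD in h2; move/andP: h2 => [_ h2].
by rewrite addnn in h2; lra.
Qed.

(** The strip between [c] and [h] has mass |[node c - node h]|. Since 1 + 4 k <= (1 + 4 k)^2, the
    number (1 + 4 k) t bounds the root of this mass. *)
Lemma oscillation (c h : I) (B : pred I) : index_interval B ->
  `|node c - node h| <= (1 + 4 * k) * t ^+ 2 ->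
  `|rect_sum D (fun a => (a <= c)%N) B - rect_sum D (fun a => (a <= h)%N) B|
  <= k * (2 + 4 * k) * t ^+ 3.
Proof.
move=> BI; wlog ch : c h / (c <= h)%N.
  move=> H; case: (leqP c h) => [/H//|/ltnW hc].
  by move=> nn; rewrite distrC; apply: H => //; rewrite distrC.
have spl w (B' : pred I) : rect_sum w (fun a => (a <= h)%N) B' =
    rect_sum w (fun a => (a <= c)%N) B' + rect_sum w (fun a => (c < a <= h)%N)
      B' :> R.
  apply: rect_sum_splitl => a.
  by case: (leqP a c) => ac; rewrite /= ?(leq_trans ac ch).
move=> nn; rewrite spl opprD addrA subrr sub0r normrN.
have sI : index_interval (fun a : I => (c < a <= h)%N) by exists c.+1, h.+1.
have k1 : 0 <= 1 + 4 * k by rewrite addr_ge0// mulr_ge0.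
apply: (le_trans (rect_diff_le (q := (1 + 4 * k) * t) k_ge0 cl sI BI _ _)).
- apply: (@le_trans _ _ (rect_sum p (fun a => (c < a <= h)%N) xpredT)).
    by apply: rect_sum_mono => //; case: pw.
  have := spl p xpredT; rewrite -/(margin_cdf p c) -/(margin_cdf p h)
    !margin_cdfE//.
  move=> e; have {e}-> : rect_sum p (fun a => (c < a <= h)%N) xpredT = node h -
    node c.
    by rewrite e addrC addKr.
  rewrite distrC in nn; apply: (le_trans (ler_norm _)); apply: (le_trans nn).
  rewrite exprMn ler_wpM2r ?sqr_ge0// expr2 ler_peMl//.
  by rewrite lerDl mulr_ge0.
- by rewrite mulr_ge0// ltW.
rewrite -mulrA ler_wpM2l//.
have -> : t ^+ 2 * ((1 + 4 * k) * t) = (1 + 4 * k) * t ^+ 3 by ring.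
have : t ^+ 4 <= t ^+ 3 by rewrite ler_wiXn2l// ltW.
by lra.
Qed.

End Oscillation.

Section BlomqvistMatrix.
Context {R : realType} {d n N : nat}.
Local Notation I := 'I_N.+1.
Variables (x : 'I_n -> d.-tuple R) (l m : 'I_d) (a b : 'I_n -> I).
Variables (k t : R) (p : I * I -> R) (h : I) (g1 g2 B : R).
Local Notation ph := (@cell_freq R n N a b).
Local Notation D := (fun z => ph z - p z).
Local Notation le c := (fun a' : I => (a' <= c)%N).
Hypotheses (n_gt0 : (0 < n)%N).
Hypotheses (al : forall i j, (a i < a j)%N -> tnth (x i) l < tnth (x j) l).
Hypotheses (bm : forall i j, (b i < b j)%N -> tnth (x i) m < tnth (x j) m).
Hypotheses (k_ge0 : 0 <= k) (t01 : 0 < t <= 1) (Nt : 1 <= N%:R * t ^+ 4).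
Hypotheses (pw : weights p) (pm : uniform_margins p) (cl : rect_close k t p ph).
Hypotheses (t_small : (1 + 4 * k) * t ^+ 2 <= 4^-1) (h_half : node h = 2^-1 :>
  R).
Hypotheses (g1_le1 : `|g1| <= 1) (g2_le1 : `|g2| <= 1) (B_ge0 : 0 <= B).
Hypothesis taylor : forall c1 c2 : I,
  4^-1 <= (node c1 : R) <= 3 / 4 -> 4^-1 <= (node c2 : R) <= 3 / 4 ->
  `|cell_cdf p c1 c2 - cell_cdf p h h - g1 * (node c1 - 2^-1)
    - g2 * (node c2 - 2^-1)| <=
  B * ((node c1 - 2^-1) ^+ 2 + (node c2 - 2^-1) ^+ 2).

Let t0 : 0 < t. Proof. by case/andP: t01. Qed.
Let t1 : t <= 1. Proof. by case/andP: t01. Qed.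

(** Up to 4 e the left-hand value is [cell_cdf ph] at the empirical medians [c1], [c2], that is,
    C(c1, c2) + D(c1, c2). [oscillation] moves the D term to [h], and Taylor's formula linearizes C.
    As node c1 plus the marginal deviation at [c1] is 1/2 up to [e], the difference node c1 - 1/2
    may be replaced by minus the marginal deviation at [h]: Bahadur's representation of the
    median. *)
Lemma empirical_copula_half :
  `|empirical_copula x l m 2^-1 2^-1 - cell_cdf p h h
    - (rect_sum D (le h) (le h) - g1 * rect_sum D (le h) xpredT
       - g2 * rect_sum D xpredT (le h))|
  <= (4 * k * (2 + 4 * k) + 6 * (1 + 2 * k) + 2 * B * (1 + 4 * k) ^+ 2) * t ^+
    3.
Proof.
have k1 : 0 <= 1 + 4 * k by rewrite addr_ge0// mulr_ge0.
have k2 : 0 <= 1 + 2 * k by rewrite addr_ge0// mulr_ge0.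
set e := (1 + 2 * k) * t ^+ 4.
have t43 : t ^+ 4 <= t ^+ 3 by rewrite ler_wiXn2l// ltW.
have t42 : t ^+ 4 <= t ^+ 2 by rewrite ler_wiXn2l// ltW.
have e3 : e <= (1 + 2 * k) * t ^+ 3 by rewrite ler_wpM2l.
have e2 : e <= (1 + 2 * k) * t ^+ 2 by rewrite ler_wpM2l.
have kt2 : 0 <= k * t ^+ 2 by rewrite mulr_ge0// sqr_ge0.
have e4 : e <= 4^-1.
  by apply: (le_trans e2); apply: le_trans t_small; rewrite !mulrDl !mul1r; lra.
have pw' := weights_swap pw; have pm' := uniform_margins_swap pm.
have cl' := rect_close_swap cl.
have phE : forall z, swap_weights ph z = @cell_freq R n N b a z by exact:
  cell_freq_swap.
have ae c : rect_sum ph (pred1 c) xpredT <= e.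
  exact: (line_freq_le k_ge0 t01 Nt pm cl).
have be c : rect_sum (@cell_freq R n N b a) (pred1 c) xpredT <= e.
  rewrite /rect_sum (eq_bigr _ (fun z _ => esym (phE z))).
  exact: (line_freq_le k_ge0 t01 Nt pm' cl').
have [c1 q1 r1] := half_quantile n_gt0 al ae e4.
have [c2 q2 r2] := half_quantile n_gt0 bm be e4.
have mE : margin_cdf (@cell_freq R n N b a) c2 = rect_sum ph xpredT (le c2).
  by rewrite -rect_sum_swap; apply: eq_bigr => z _; rewrite phE.
rewrite mE in q2.
have dE1 (c : I) : rect_sum D (le c) xpredT = margin_cdf ph c - node c.
  by rewrite rect_sumB -[rect_sum p _ _]/(margin_cdf p c) margin_cdfE.
have dE2 (c : I) : rect_sum D xpredT (le c) = rect_sum ph xpredT (le c) - node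
  c.
  rewrite rect_sumB; congr (_ - _).
  by rewrite -rect_sum_swap -[rect_sum _ _ _]/(margin_cdf _ c) margin_cdfE.
(* Origin of 1 + 4 k: the error e <= (1 + 2 k) t^2 of the median plus the global deviation 2 k
   t^2. *)
have n1 : `|node c1 - node h| <= (1 + 4 * k) * t ^+ 2.
  have := rect_diff_le_global k_ge0 t01 pw cl (index_interval_le c1)
    index_interval_all.
  rewrite dE1 h_half; move: q1; rewrite !ler_norml; lra.
have n2 : `|node c2 - node h| <= (1 + 4 * k) * t ^+ 2.
  have := rect_diff_le_global k_ge0 t01 pw cl index_interval_all
    (index_interval_le c2).
  rewrite dE2 h_half; move: q2; rewrite !ler_norml; lra.
have o1 := oscillation k_ge0 t01 pw pm cl index_interval_all n1.
have o2 := oscillation k_ge0 t01 pw' pm' cl' index_interval_all n2.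
have o3 := oscillation k_ge0 t01 pw pm cl (index_interval_le c2) n1.
have o4 := oscillation k_ge0 t01 pw' pm' cl' (index_interval_le h) n2.
rewrite !(rect_sumB (swap_weights ph)) !rect_sum_swap -!rect_sumB in o2 o4.
have h1 : `|empirical_copula x l m 2^-1 2^-1 - cell_cdf ph c1 c2| <= 2 * e + 2
  * e.
  rewrite /empirical_copula /cell_cdf rect_sum_cell_freq -mulrBr -sumrB.
  rewrite normrM ger0_norm ?invr_ge0//.
  apply: (le_trans _ (lerD r1 r2)); rewrite -mulrDr ler_wpM2l ?invr_ge0//.
  apply: (le_trans (ler_norm_sum _ _ _)); rewrite -big_split;
    apply: ler_sum => i _ /=.
  exact: norm_andb_le.
have h2 : cell_cdf ph c1 c2 = cell_cdf p c1 c2 + rect_sum D (le c1) (le c2).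
  by rewrite rect_sumB addrC subrK.
rewrite h_half in n1 n2.
have h3 : `|cell_cdf p c1 c2 - cell_cdf p h h - g1 * (node c1 - 2^-1)
    - g2 * (node c2 - 2^-1)| <= 2 * B * (1 + 4 * k) ^+ 2 * t ^+ 3.
  apply: (le_trans (taylor _ _)).
  - by move: n1 t_small; rewrite ler_norml; lra.
  - by move: n2 t_small; rewrite ler_norml; lra.
  have sq (y : R) : `|y| <= (1 + 4 * k) * t ^+ 2 -> y ^+ 2 <= (1 + 4 * k) ^+ 2
    * t ^+ 3.
    move=> yk; apply: (@le_trans _ _ (((1 + 4 * k) * t ^+ 2) ^+ 2)).
      rewrite -(real_normK (num_real y)) ler_sqr ?nnegrE//.
      by rewrite mulr_ge0// sqr_ge0.
    by rewrite exprMn -exprM ler_wpM2l ?sqr_ge0.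
  rewrite [2 * B]mulrC -!mulrA ler_wpM2l//.
  by have := sq _ n1; have := sq _ n2; lra.
have gle (g y w : R) : `|g| <= 1 -> `|y| <= w -> `|g * y| <= w.
  by move=> g1' yw; rewrite normrM -[w]mul1r ler_pM.
have h4 : `|g1 * (rect_sum D (le h) xpredT + (node c1 - 2^-1))|
    <= k * (2 + 4 * k) * t ^+ 3 + e.
  apply: gle => //; move: o1 q1; rewrite !dE1 !ler_norml; lra.
have h5 : `|g2 * (rect_sum D xpredT (le h) + (node c2 - 2^-1))|
    <= k * (2 + 4 * k) * t ^+ 3 + e.
  apply: gle => //; move: o2 q2; rewrite !dE2 !ler_norml; lra.
move: h1 h3 h4 h5 o3 o4; rewrite h2 !mulrDr.
set u1 := rect_sum _ _ _; set u2 := rect_sum _ _ _; set u3 := rect_sum _ _ _.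
set u4 := rect_sum _ _ _; set u5 := rect_sum _ _ _.
set v1 := cell_cdf _ _ _; set v2 := cell_cdf _ _ _;
  set v3 := empirical_copula _ _ _ _ _.
move: e3; rewrite !mulrN; clearbody e u1 u2 u3 u4 u5 v1 v2 v3.
set y1 := g1 * node c1; set y2 := g2 * node c2.
set y3 := g1 * 2^-1; set y4 := g2 * 2^-1.
set y5 := g1 * u2; set y6 := g2 * u3; set y7 := t ^+ 3.
rewrite !ler_norml; lra.
Qed.

End BlomqvistMatrix.

(** * Bernstein's inequality for iid samples *)

Section BernoulliTail.
Context {R : realType}.

(** Follows from exp(x) <= 1 / (1 - x). All negative [x] are included, so that both tails use the
    same inequality. *)
Lemma expR_le_quadratic (x : R) : x <= 2^-1 -> expR x <= 1 + x + 2 * x ^+ 2.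
Proof.
move=> x2; have h : 1 - x <= expR (- x) by exact: expR_ge1Dx.
have x1 : 0 < 1 - x by lra.
rewrite -[x in expR x]opprK expRN; apply: (@le_trans _ _ (1 - x)^-1).
  by rewrite lef_pV2 ?posrE ?expR_gt0.
rewrite -div1r ler_pdivrMr//.
have -> : (1 + x + 2 * x ^+ 2) * (1 - x) = 1 + x ^+ 2 * (1 - 2 * x) by ring.
by rewrite lerDl mulr_ge0 ?sqr_ge0//; lra.
Qed.

(** The law of the set of successes in n independent trials, which makes a binomial tail a finite
    sum. *)
Definition bernoulli_weight (n : nat) (p : R) (J : {set 'I_n}) : R :=
  \prod_(i < n) (if i \in J then p else 1 - p).

(** Chernoff's bound. The event is stated through the product with [lam], so that a negative [lam]
    gives the lower tail. *)
Lemma bernoulli_exp_tail (n : nat) (p lam v : R) : 0 <= p <= 1 -> lam <= 2^-1 ->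
  \sum_(J : {set 'I_n} | v <= lam * (#|J|%:R - n%:R * p)) bernoulli_weight p J
  <= expR (2 * n%:R * p * lam ^+ 2 - v).
Proof.
move=> /andP[p0 p1] l2.
have q0 (J : {set 'I_n}) : 0 <= bernoulli_weight p J.
  by apply: prodr_ge0 => i _; case: ifP => _ //; rewrite subr_ge0.
apply: (@le_trans _ _ (\sum_(J : {set 'I_n})
    expR (lam * (#|J|%:R - n%:R * p) - v) * bernoulli_weight p J)).
  rewrite [leLHS]big_mkcond; apply: ler_sum => J _; case: ifP => [h|_].
    by rewrite ler_peMl// -[leLHS]expR0 ler_expR subr_ge0.
  by rewrite mulr_ge0// expR_ge0.
have -> : \sum_(J : {set 'I_n}) expR (lam * (#|J|%:R - n%:R * p) - v)
      * bernoulli_weight p J =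
    expR (- (lam * n%:R * p) - v) * (expR lam * p + (1 - p)) ^+ n.
  (* Factorization of the moment generating function: the n-th power of a two-term sum is expanded
     over the success sets. *)
  rewrite -[n in _ ^+ n]card_ord -prodr_const bigA_distr mulr_sumr.
  apply: eq_bigr => J _.
  have -> : lam * (#|J|%:R - n%:R * p) - v =
      (- (lam * n%:R * p) - v) + #|J|%:R * lam by ring.
  rewrite expRD expRM_natl -mulrA; congr (_ * _).
  rewrite -prodr_const big_mkcond -big_split/=; apply: eq_bigr => i _.
  by case: ifP; rewrite ?mul1r.
have le1 : expR lam * p + (1 - p) <= expR (p * (lam + 2 * lam ^+ 2)).
  apply: le_trans (expR_ge1Dx _).
  have := ler_wpM2r p0 (expR_le_quadratic l2); lra.
apply: (@le_trans _ _ (expR (- (lam * n%:R * p) - v) *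
    expR (p * (lam + 2 * lam ^+ 2)) ^+ n)).
  rewrite ler_wpM2l ?expR_ge0// lerXn2r ?nnegrE ?expR_ge0//.
  by rewrite addr_ge0 ?mulr_ge0 ?expR_ge0// subr_ge0.
rewrite -expRM_natl -expRD ler_expR le_eqVlt; apply/orP; left; apply/eqP; ring.
Qed.

Lemma bernoulli_deviation (n : nat) (p t k : R) : (0 < n)%N -> 0 <= p <= 1 ->
  0 < t -> 0 <= k ->
  \sum_(J : {set 'I_n} | k * (t ^+ 2 * Num.sqrt p + t ^+ 4)
      < `|n%:R^-1 * #|J|%:R - p|) bernoulli_weight p J
  <= 2 * expR (- ((k - 1) / 2 * (n%:R * t ^+ 4))).
Proof.
move=> n_gt0 p01 t0 k0; have /andP[p0 p1] := p01.
have n0 : (0 : R) < n%:R by rewrite ltr0n.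
have q0 (J : {set 'I_n}) : 0 <= bernoulli_weight p J.
  by apply: prodr_ge0 => i _; case: ifP => _ //; rewrite subr_ge0.
have t4 : 0 < t ^+ 4 by rewrite exprn_gt0.
have t2 : 0 < t ^+ 2 by rewrite exprn_gt0.
(* The Gaussian choice is t^2 / (2 sqrt(p)), replaced by 1/2 in the Poisson range p <= t^4. Either
   way the variance term 2 p lam^2 is at most t^4 / 2 and the linear gain at least k t^4 / 2, whence
   the exponent (k - 1) / 2. *)
have [lam [lam0 lam2 lamv lamp]] : exists lam : R, [/\ 0 < lam, lam <= 2^-1,
    t ^+ 4 / 2 <= lam * (t ^+ 2 * Num.sqrt p + t ^+ 4) &
    2 * p * lam ^+ 2 <= t ^+ 4 / 2].
  have [pt|tp] := lerP p (t ^+ 4).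
    exists 2^-1; split => //; rewrite ?invr_gt0//.
      have : 0 <= t ^+ 2 * Num.sqrt p by rewrite mulr_ge0 ?sqrtr_ge0// ltW.
      by lra.
    by rewrite exprVn; lra.
  have s0 : 0 < Num.sqrt p by rewrite sqrtr_gt0 (lt_trans t4).
  have ts : t ^+ 2 <= Num.sqrt p.
    rewrite -[leLHS](ger0_norm (ltW t2)) -sqrtr_sqr ler_wsqrtr//.
    by rewrite -exprM ltW.
  exists (t ^+ 2 / Num.sqrt p / 2); split.
  - by rewrite !divr_gt0.
  - by rewrite -[leRHS]mul1r ler_wpM2r ?invr_ge0// ler_pdivrMr// mul1r.
  - have -> : t ^+ 2 / Num.sqrt p / 2 * (t ^+ 2 * Num.sqrt p + t ^+ 4) =
      t ^+ 4 / 2 + t ^+ 2 / Num.sqrt p / 2 * t ^+ 4 by field; rewrite gt_eqF.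
    by rewrite lerDl mulr_ge0 ?divr_ge0 ?ltW.
  - have -> : 2 * p * (t ^+ 2 / Num.sqrt p / 2) ^+ 2 =
      2 * (Num.sqrt p ^+ 2) * (t ^+ 2 / Num.sqrt p / 2) ^+ 2 by rewrite
        sqr_sqrtr.
    rewrite le_eqVlt; apply/orP; left; apply/eqP; field; rewrite gt_eqF//.
set v := n%:R * (k * (t ^+ 4 / 2)).
have tail (s : R) : s = 1 \/ s = -1 ->
    \sum_(J : {set 'I_n} | v <= s * lam * (#|J|%:R - n%:R * p))
      bernoulli_weight p J
    <= expR (- ((k - 1) / 2 * (n%:R * t ^+ 4))).
  move=> s1; have s2 : s ^+ 2 = 1 by case: s1 => ->; rewrite ?sqrrN expr1n.
  have sl : s * lam <= 2^-1 by case: s1 => ->; lra.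
  apply: (le_trans (bernoulli_exp_tail n v p01 sl)); rewrite ler_expR.
  have := ler_wpM2l (ltW n0) lamp; rewrite exprMn s2 /v; lra.
have := lerD (tail 1 (or_introl erefl)) (tail (-1) (or_intror erefl)).
have -> : forall y : R, y + y = 2 * y by move=> y; ring.
apply: le_trans; rewrite big_mkcond [X in _ <= X + _]big_mkcond.
rewrite [X in _ <= _ + X]big_mkcond -big_split; apply: ler_sum => J _ /=.
case: ifP => [dev|_]; last by apply: addr_ge0; case: ifP.
have := q0 J; set q := bernoulli_weight p J => q0J.
suff : (v <= 1 * lam * (#|J|%:R - n%:R * p)) || (v <= -1 * lam * (#|J|%:R -
  n%:R * p)).
  by case: ifP; case: ifP => // _ _ _; lra.
set y := n%:R^-1 * #|J|%:R - p in dev.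
have -> : #|J|%:R - n%:R * p = n%:R * y by rewrite /y; field; rewrite gt_eqF.
have vle z : k * (t ^+ 2 * Num.sqrt p + t ^+ 4) <= z -> v <= lam * (n%:R * z).
  move=> kz; rewrite /v [leRHS]mulrCA ler_wpM2l ?(ltW n0)//.
  apply: (@le_trans _ _ (lam * (k * (t ^+ 2 * Num.sqrt p + t ^+ 4)))).
    by rewrite [leRHS]mulrCA ler_wpM2l.
  by rewrite ler_wpM2l// ltW.
move: dev; rewrite ltr_normr => /orP[/ltW/vle|/ltW/vle] h; apply/orP;
  [left|right].
  by rewrite mul1r.
by rewrite mulN1r mulNr -mulrN -mulrN.
Qed.

End BernoulliTail.

(** * Events determined by a map with finite range *)

Section FiniteMap.
Context {d : measure_display} {T : measurableType d} {R : realType}.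
Variables (Z : finType) (h : T -> Z).
Hypothesis mh : forall z, measurable [set w | h w = z].

Lemma measurable_finite_map (S : pred Z) : measurable [set w | S (h w)].
Proof.
have -> : [set w | S (h w)] = \bigcup_(z in [set` S]) [set w | h w = z].
  by apply/seteqP; split => [w Sw|w [z Sz /= ->//]]; exists (h w).
by apply: fin_bigcup_measurable => //; exact: finite_finpred.
Qed.

Lemma measure_finite_map (mu : {measure set T -> \bar R}) (D : set T) (S : pred
  Z) :
  measurable D ->
  mu (D `&` [set w | S (h w)]) = (\sum_(z | S z) mu (D `&` [set w | h w =
    z]))%E.
Proof.
move=> mD; have -> : D `&` [set w | S (h w)] =
    \bigcup_(z in [set` S]) (D `&` [set w | h w = z]).
  by apply/seteqP; split => [w [Dw Sw]|w [z Sz [Dw /= hz]]]; [exists (h w)|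
    split => //=; rewrite hz].
rewrite measure_fin_bigcup//; first last.
- by move=> z _; exact: measurableI.
- by move=> z z' _ _ [w [[_ /= <-] [_ /= <-]]].
by rewrite -(@bigfs _ _ _ _ (index_enum Z)) ?index_enum_uniq// => z _;
  rewrite mem_index_enum.
Qed.

Lemma prob_finite_map (P : probability T R) (S : pred Z) :
  fine (P [set w | S (h w)]) = \sum_(z | S z) fine (P [set w | h w = z]).
Proof.
rewrite -[X in P X]setTI measure_finite_map// -sum_fine => [|z _].
  by apply: eq_bigr => z _; rewrite setTI.
by rewrite setTI fin_num_measure.
Qed.

End FiniteMap.

Section IidDeviation.
Context {d0 d1 : measure_display} {T : measurableType d0} {E : measurableType
  d1}
  {R : realType}.
Variables (P : probability T R) (law : probability E R) (n : nat).
Variables (X : 'I_n -> {RV P >-> E}) (f : pred E).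
Hypotheses (iid : iid_sample law X) (mf : measurable [set y | f y]).
Local Notation p := (fine (law [set y | f y])).

Definition success_set (w : T) : {set 'I_n} := [set i | f (X i w)]%SET.

Lemma success_setE (J : {set 'I_n}) :
  [set w | success_set w = J] = \bigcap_(i in [set` [set: 'I_n]%SET])
    (X i @^-1` (if i \in J then [set y | f y] else ~` [set y | f y])).
Proof.
apply/seteqP; split => [w /= <- i _|w /= h].
  by rewrite /= inE; case: ifPn => //= /negP.
apply/setP => i; have := h i; rewrite /= inE => /(_ isT); rewrite inE.
by case: ifPn => _ /=; [move=> ->|move=> /negP/negbTE ->].
Qed.

Lemma measurable_success_set (J : {set 'I_n}) : measurable [set w | success_set
  w = J].
Proof.
rewrite success_setE; apply: fin_bigcap_measurable; first exact: finite_finpred.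
move=> i _; rewrite -[X in measurable X]setTI; apply: measurable_funP => //.
by case: ifP => // _; exact: measurableC.
Qed.

Lemma prob_success_set (J : {set 'I_n}) :
  fine (P [set w | success_set w = J]) = bernoulli_weight p J.
Proof.
have [ind idl] := iid.
rewrite success_setE ind => [|i]; last by case: ifP => // _; exact: measurableC.
have -> : forall F : 'I_n -> \bar R, (\prod_(i in [set: 'I_n]%SET) F i =
    \prod_i F i)%E by move=> F; apply: eq_bigl => i; rewrite inE.
have q i : P (X i @^-1` (if i \in J then [set y | f y] else ~` [set y | f y]))
    = (if i \in J then p else 1 - p)%:E.
  rewrite -[LHS]/(distribution P (X i) _) idl; last first.
    by case: ifP => // _; exact: measurableC.
  case: ifP => _; first by rewrite fineK// fin_num_measure.
  by rewrite probability_setC// EFinB fineK// fin_num_measure.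
rewrite (eq_bigr _ (fun i _ => q i)) /bernoulli_weight.
by rewrite prodEFin.
Qed.

Definition deviates (k t : R) (w : T) : bool :=
  k * (t ^+ 2 * Num.sqrt p + t ^+ 4)
    < `|n%:R^-1 * \sum_(i < n) (f (X i w))%:R - p|.

(** The event depends on the sample only through the set of successful indices, whose law is
    [bernoulli_weight]. *)
Lemma deviation_prob (k t : R) : (0 < n)%N -> 0 < t -> 0 <= k ->
  measurable [set w | deviates k t w] /\
  (P [set w | deviates k t w] <=
   (2 * expR (- ((k - 1) / 2 * (n%:R * t ^+ 4))))%:E)%E.
Proof.
move=> n0 t0 k0.
pose S (J : {set 'I_n}) := k * (t ^+ 2 * Num.sqrt p + t ^+ 4)
  < `|n%:R^-1 * #|J|%:R - p|.
have -> : [set w | deviates k t w] = [set w | S (success_set w)].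
  apply: eq_set => w; rewrite /deviates /S.
  suff -> : \sum_(i < n) (f (X i w))%:R = #|success_set w|%:R :> R by [].
  rewrite -sum1_card natr_sum [RHS]big_mkcond; apply: eq_bigr => i _.
  by rewrite inE; case: (f _).
have mS := measurable_finite_map measurable_success_set S.
split => //; rewrite -[leLHS]fineK ?fin_num_measure//.
rewrite lee_fin (prob_finite_map measurable_success_set).
rewrite (eq_bigr _ (fun J _ => prob_success_set J)).
apply: bernoulli_deviation => //.
by rewrite fine_ge0//= -lee_fin fineK ?probability_le1 ?fin_num_measure.
Qed.

End IidDeviation.

(** * The copula and its integrals on the grid *)

Section ProbabilityIntegralTransform.
Context {R : realType} {d : nat} (law : probability (d.-tuple R) R).
Hypothesis F_cont : forall j, continuous (marginal_cdf law j).
Local Notation F := (marginal_cdf law).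

Lemma marginal_cdfE j x : F j x = fine (law [set v | tnth v j <= x]).
Proof.
by rewrite /marginal_cdf /cdf /distribution /pushforward; congr (fine (law _)).
Qed.

Lemma marginal_cdf_nondecreasing j : {homo F j : x y / x <= y}.
Proof. by move=> x y xy; rewrite fine_le ?fin_num_measure// cdf_nondecreasing.
  Qed.

Lemma marginal_cdf_ge0 j x : 0 <= F j x.
Proof. by rewrite fine_ge0. Qed.

Lemma marginal_cdf_le1 j x : F j x <= 1.
Proof. by rewrite -lee_fin fineK ?fin_num_measure// probability_le1. Qed.

Lemma pit_ge0 x j : 0 <= tnth (pit law x) j.
Proof. by rewrite tnth_mktuple marginal_cdf_ge0. Qed.

Lemma pit_le1 x j : tnth (pit law x) j <= 1.
Proof. by rewrite tnth_mktuple marginal_cdf_le1. Qed.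

Lemma marginal_cdf_surj j (s : R) : 0 < s < 1 -> exists x, F j x = s.
Proof.
move=> /andP[s0 s1].
have c1 : F j x @[x --> +oo] --> (1 : R) by exact/fine_cvg/cvg_cdfy1.
have c0 : F j x @[x --> -oo] --> (0 : R) by exact/fine_cvg/cvg_cdfNy0.
have [b sb] := @filter_ex _ _ _ _ (cvgr_gt _ c1 _ s1).
have [a as0] := @filter_ex _ _ _ _ (cvgr_lt _ c0 _ s0).
have ab : a <= b.
  rewrite leNgt; apply/negP => /ltW /(marginal_cdf_nondecreasing j).
  by rewrite leNgt (lt_trans as0 sb).
have [||x _ <-] := @IVT R (F j) a b s ab; last by exists x.
- exact: continuous_subspaceT (F_cont (j := j)).
- by rewrite ge_min le_max (ltW as0) (ltW sb) orbT.
Qed.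

Lemma measurable_pit_le j (s : R) : measurable [set x | tnth (pit law x) j <=
  s].
Proof.
have m : measurable_fun setT (fun x => tnth (pit law x) j).
  apply: (measurableT_comp (measurable_tnth j)); exact: measurable_pit.
rewrite -[X in measurable X]setTI.
have -> : [set x | tnth (pit law x) j <= s] =
    (fun x => tnth (pit law x) j) @^-1` `]-oo, s].
  by apply/seteqP; split => x; rewrite /= in_itv.
by apply: m => //; exact: measurable_itv.
Qed.

Lemma fine_law_le (A B : set (d.-tuple R)) : measurable A -> measurable B ->
  A `<=` B -> fine (law A) <= fine (law B).
Proof.
move=> mA mB AB; rewrite fine_le ?fin_num_measure//.
by rewrite le_measure// inE.
Qed.

(** The cdf may have flat pieces and no inverse. The event is compared with [tnth v j <= x], where F
    x = s for the lower bound and F x = r > s for the upper one, and r decreases to s. The values 0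
    and 1, which F need not attain, are handled apart. *)
Lemma pit_uniform j (s : R) : 0 <= s <= 1 ->
  fine (law [set x | tnth (pit law x) j <= s]) = s.
Proof.
move=> /andP[s0 s1].
set u := fine _; have u0 : 0 <= u by rewrite fine_ge0.
have mF x : measurable [set v : d.-tuple R | tnth v j <= x].
  rewrite -[X in measurable X]setTI.
  have -> : [set v : d.-tuple R | tnth v j <= x] = (fun v => tnth v j) @^-1`
    `]-oo, x].
    by apply/seteqP; split => v; rewrite /= in_itv.
  by apply: (measurable_tnth j) => //; exact: measurable_itv.
have upper r : s < r -> u <= r.
  move=> sr; have [r1|r1] := leP 1 r.
    apply: le_trans r1; rewrite -lee_fin fineK ?probability_le1
      ?fin_num_measure//;
      exact: measurable_pit_le.
  have [|x Fx] := @marginal_cdf_surj j r;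
    first by rewrite r1 (le_lt_trans s0 sr).
  rewrite -Fx marginal_cdfE; apply: fine_law_le => //;
    first exact: measurable_pit_le.
  move=> v /=; rewrite tnth_mktuple => Fv; rewrite leNgt; apply/negP => /ltW.
  by move=> /(marginal_cdf_nondecreasing j);
    rewrite Fx leNgt (le_lt_trans Fv sr).
have su : s <= u.
  have [->//|s0'] := eqVneq s 0.
  have [s1'|s1'] := leP 1 s.
    rewrite /u (_ : [set x | _] = setT) ?probability_setT//.
    by apply/seteqP; split => // x _ /=; apply: le_trans s1'; exact: pit_le1.
  have [|x Fx] := @marginal_cdf_surj j s;
    first by rewrite s1' lt_neqAle eq_sym s0' s0.
  rewrite -{1}Fx marginal_cdfE; apply: fine_law_le => //;
    first exact: measurable_pit_le.
  move=> v /= vx; rewrite tnth_mktuple -Fx.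
  exact: marginal_cdf_nondecreasing.
apply/eqP; rewrite eq_le su andbT; apply/ler_addgt0Pl => e e0.
by rewrite addrC; apply: upper; rewrite ltrDl.
Qed.

End ProbabilityIntegralTransform.

Section GridIndex.
Context {R : realType} {N : nat}.
Hypothesis N_gt0 : (0 < N)%N.

(** Rounding up makes the cells closed on the right, like the events of a cdf, so that comparing
    with a node is exactly comparing indices. *)
Definition grid_index (u : R) : 'I_N.+1 := inord `|Num.ceil (N%:R * u)|%N.

Lemma grid_index_le (u : R) (a : 'I_N.+1) : 0 <= u <= 1 ->
  (grid_index u <= a)%N = (u <= node a).
Proof.
move=> /andP[u0 u1]; have N0 : (0 : R) < N%:R by rewrite ltr0n.
have c0 : 0 <= Num.ceil (N%:R * u).
  by rewrite ceil_ge0 (lt_le_trans _ (mulr_ge0 (ltW N0) u0)).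
have cle (k : nat) : (`|Num.ceil (N%:R * u)| <= k)%N = (N%:R * u <= k%:R).
  by rewrite -[k%:R]/(k%:~R) -ceil_le_int -lez_nat gez0_abs.
rewrite /grid_index inordK; last first.
  by rewrite ltnS cle -[leRHS]mulr1 ler_pM2l.
by rewrite cle /node ler_pdivlMr// mulrC.
Qed.

Lemma grid_index_node (u : R) : 0 <= u <= 1 ->
  u <= node (grid_index u) <= u + N%:R^-1.
Proof.
move=> u01; rewrite -grid_index_le// leqnn/=.
have N0 : (0 : R) < N%:R by rewrite ltr0n.
case: (posnP (grid_index u)) => [g0|g0].
  rewrite /node g0 mul0r addr_ge0 ?invr_ge0 ?(ltW N0)//.
  by case/andP: u01.
have aN : ((grid_index u).-1 < N.+1)%N by rewrite (leq_ltn_trans (leq_pred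
  _))// ltn_ord.
have := @grid_index_le u (Ordinal aN) u01; rewrite /= leqNgt prednK// leqnn/=.
rewrite /node/= => /esym/negbT; rewrite -ltNge => h.
rewrite -lerBlDr; apply: le_trans (ltW h).
rewrite -{1}(prednK g0) -natr1 mulrDl mul1r addrK//.
Qed.

End GridIndex.

Lemma measurable_index {d : measure_display} {T : measurableType d} {N : nat}
    (c : T -> 'I_N.+1) :
  (forall a : 'I_N.+1, measurable [set x | (c x <= a)%N]) ->
  forall a, measurable [set x | c x = a].
Proof.
move=> mc a.
have -> : [set x | c x = a] = [set x | (c x <= a)%N] `&`
    \bigcap_(b in [set` [pred b : 'I_N.+1 | (b < a)%N]]) ~` [set x | (c x <=
      b)%N].
  apply/seteqP; split => [x /= ca|x /= [ca cb]].
    split => [|b]; rewrite /= ca ?leqnn// inE => ba.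
    by apply/negP; rewrite -ltnNge.
  apply/val_inj/eqP; rewrite eqn_leq ca/= leqNgt; apply/negP => lt.
  by have := cb (c x); rewrite /= inE => /(_ lt); rewrite leqnn.
apply: measurableI => //; apply: fin_bigcap_measurable => // b _.
exact: measurableC.
Qed.

Section CellLaw.
Context {R : realType} {d : nat} (law : probability (d.-tuple R) R).
Variables (l m : 'I_d) (N : nat).
Local Notation I := 'I_N.+1.
Hypotheses (lm : l != m) (N_gt0 : (0 < N)%N).
Hypothesis F_cont : forall j, continuous (marginal_cdf law j).
Local Notation C := (bimargin law l m).

Definition pit_index (j : 'I_d) (x : d.-tuple R) : I := grid_index (tnth (pit
  law x) j).

Definition pit_cell (x : d.-tuple R) : I * I := (pit_index l x, pit_index m x).

Definition cell_law (z : I * I) : R := fine (law [set x | pit_cell x = z]).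

Lemma pit01 x j : 0 <= tnth (pit law x) j <= 1.
Proof. by rewrite pit_ge0 pit_le1. Qed.

Lemma pit_index_le j x (a : I) : (pit_index j x <= a)%N = (tnth (pit law x) j
  <= node a).
Proof. by rewrite grid_index_le// pit01. Qed.

Lemma measurable_pit_index j (a : I) : measurable [set x | pit_index j x = a].
Proof.
move: a; apply: measurable_index => a.
rewrite (_ : [set x | _] = [set x | tnth (pit law x) j <= node a]).
  exact: measurable_pit_le.
by apply: eq_set => x; rewrite pit_index_le.
Qed.

Lemma measurable_pit_cell z : measurable [set x | pit_cell x = z].
Proof.
case: z => a b; rewrite (_ : [set x | _] =
    [set x | pit_index l x = a] `&` [set x | pit_index m x = b]).
  by apply: measurableI; exact: measurable_pit_index.
by apply/seteqP; split => x /= [e1 e2]; rewrite ?/pit_cell ?e1 ?e2.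
Qed.

Lemma rect_sum_cell_law (A B : pred I) : rect_sum cell_law A B =
  fine (law [set x | A (pit_index l x) && B (pit_index m x)]).
Proof.
exact/esym/(prob_finite_map measurable_pit_cell law (fun z => A z.1 && B z.2)).
Qed.

Lemma bimarginE (s t : R) : C s t =
  fine (law [set x | (tnth (pit law x) l <= s) && (tnth (pit law x) m <= t)]).
Proof.
rewrite /bimargin /copula /copula_law /distribution /pushforward.
congr (fine (law _)); apply/seteqP; split => x /=.
  move=> h; have := h l; have := h m; rewrite !mxE !eqxx.
  by rewrite eq_sym (negbTE lm) => -> ->.
move=> /andP[hl hm] j; rewrite mxE; case: eqP => [->//|_].
by case: eqP => [->//|_]; exact: pit_le1.
Qed.

Lemma cell_law_weights : weights cell_law.
Proof.
split => [z|]; first by rewrite fine_ge0.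
rewrite -[LHS]/(rect_sum cell_law xpredT xpredT) rect_sum_cell_law.
by rewrite (_ : [set x | _] = setT) ?probability_setT//; apply/seteqP; split.
Qed.

Lemma cell_law_cdf (a b : I) : cell_cdf cell_law a b = C (node a) (node b).
Proof.
rewrite /cell_cdf rect_sum_cell_law bimarginE; congr (fine (law _)).
by apply: eq_set => x; rewrite !pit_index_le.
Qed.

Lemma node01 (a : I) : 0 <= (node a : R) <= 1.
Proof. by rewrite node_ge0 node_le1. Qed.

(** Successive differences of cumulative masses. This serves the margins of the copula as well as
    Lebesgue measure. *)
Lemma node_cell_mass (f : I -> R) :
  (forall a : I, \sum_(a' : I | (a' <= a)%N) f a' = node a) -> forall a, f a =
    cell_mass a.
Proof.
move=> h a; have := h a; rewrite (bigD1 a)//=.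
rewrite (eq_bigl (fun a' : I => (a' < a)%N)); last first.
  by move=> a'; rewrite -val_eqE/= ltn_neqAle andbC.
case: (posnP a) => [a0|a0].
  rewrite big_pred0; last by move=> a'; rewrite a0.
  by rewrite addr0 /node /cell_mass a0 mul0r.
have aN : (a.-1 < N.+1)%N by rewrite (leq_ltn_trans (leq_pred _))// ltn_ord.
rewrite (eq_bigl (fun a' : I => (a' <= Ordinal aN)%N)); last first.
  by move=> a' /=; rewrite -[RHS]ltnS prednK.
rewrite h /node/= => /(canRL (addrK _)) ->.
by rewrite /cell_mass a0 -mulrBl -natrB ?leq_pred// -{1}(prednK a0) subSnn.
Qed.

Lemma cell_law_margins : uniform_margins cell_law.
Proof.
split; apply: node_cell_mass => a.
  transitivity (rect_sum cell_law (fun a' => (a' <= a)%N) xpredT).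
    by rewrite pair_big; apply: eq_big => [[]|[] ? ? _].
  rewrite rect_sum_cell_law -[RHS](pit_uniform F_cont l (node01 a)).
  by congr (fine (law _)); apply: eq_set => x; rewrite pit_index_le andbT.
transitivity (rect_sum cell_law xpredT (fun b' => (b' <= a)%N)).
  by rewrite exchange_big pair_big; apply: eq_big => [[]|[] ? ? _].
rewrite rect_sum_cell_law -[RHS](pit_uniform F_cont m (node01 a)).
by congr (fine (law _)); apply: eq_set => x; rewrite pit_index_le.
Qed.

Lemma measurable_pit_rect (s t : R) :
  measurable [set x | (tnth (pit law x) l <= s) && (tnth (pit law x) m <= t)].
Proof.
rewrite (_ : [set x | _] = [set x | tnth (pit law x) l <= s] `&`
    [set x | tnth (pit law x) m <= t]).
  by apply: measurableI; exact: measurable_pit_le.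
by apply/seteqP; split => x /= => [/andP[]|[-> ->]].
Qed.

(** The larger quadrant is covered by the smaller one and two strips, whose probabilities are s' - s
    and t' - t because the margins are uniform. Every grid approximation of C rests on this. *)
Lemma bimargin_mono_lipschitz (s s' t t' : R) :
  0 <= s <= 1 -> 0 <= s' <= 1 -> 0 <= t <= 1 -> 0 <= t' <= 1 ->
  s <= s' -> t <= t' -> 0 <= C s' t' - C s t <= (s' - s) + (t' - t).
Proof.
move=> s01 s01' t01 t01' ss tt; rewrite !bimarginE subr_ge0; apply/andP; split.
  apply: fine_law_le; [exact: measurable_pit_rect|exact: measurable_pit_rect|].
  by move=> x /= /andP[h1 h2]; rewrite (le_trans h1)// (le_trans h2).
have D j (u v : R) : u <= v -> 0 <= u <= 1 -> 0 <= v <= 1 ->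
    fine (law ([set x | tnth (pit law x) j <= v] `\` [set x | tnth (pit law x)
      j <= u]))
    = v - u.
  move=> uv u01 v01.
  have mu := measurable_pit_le law j u; have mv := measurable_pit_le law j v.
  have sub : [set x | tnth (pit law x) j <= u] `<=` [set x | tnth (pit law x) j
    <= v].
    by move=> x /= /le_trans; apply.
  rewrite measureD// ?(le_lt_trans (probability_le1 _ _)) ?ltry//.
  rewrite setIidr// fineB ?fin_num_measure//.
  by rewrite !pit_uniform.
rewrite lerBlDr -(D l) // -(D m)//.
set A := [set x | _ <= s'] `\` _; set B := [set x | _ <= t'] `\` _.
set G := [set x | (_ <= s) && _].
have mA : measurable A by apply: measurableD; exact: measurable_pit_le.
have mB : measurable B by apply: measurableD; exact: measurable_pit_le.
have mG : measurable G by exact: measurable_pit_rect.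
rewrite -!fineD ?fin_num_measure//; last by rewrite fin_numD !fin_num_measure.
rewrite fine_le ?fin_num_measure//; [exact: measurable_pit_rect| |].
  by rewrite !fin_numD !fin_num_measure.
apply: (@le_trans _ _ (law ((A `|` B) `|` G))).
  apply: le_measure; rewrite ?inE.
  - exact: measurable_pit_rect.
  - by do 2 apply: measurableU => //.
  move=> x /= /andP[h1 h2].
  case: (lerP (tnth (pit law x) l) s) => hs; last by left; left; split => //=;
    apply/negP; rewrite -ltNge.
  case: (lerP (tnth (pit law x) m) t) => ht; last by left; right; split => //=;
    apply/negP; rewrite -ltNge.
  by right; apply/andP.
apply: le_trans (measureU2 _ _ _) _ => //; first exact: measurableU.
by rewrite leeD2r// measureU2.
Qed.

End CellLaw.

(** * Integrals compared with sums over cells *)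

Section GridIntegral.
Context {d : measure_display} {T : measurableType d} {R : realType}.
Variables (D : set T) (mD : measurable D).

Lemma measurable_fun_finite_map (Z : finType) (h : T -> Z) (g : Z -> R) :
  (forall z, measurable [set x | h x = z]) -> measurable_fun D (g \o h).
Proof.
move=> mh _ Y mY; apply: measurableI => //.
rewrite (_ : _ @^-1` _ = [set x | (fun z => `[< Y (g z) >]) (h x)]).
  exact: (measurable_finite_map mh (fun z => `[< Y (g z) >])).
by apply/seteqP; split => x /=; rewrite asboolE.
Qed.

(** A limit of finite-valued measurable functions. The joint measurability of C thus follows from
    its Lipschitz bound, and likewise for sums of its sections. *)
Lemma measurable_grid_limit (f : T -> R) (K : R) :
  (forall N, (0 < N)%N -> exists (Z : finType) (h : T -> Z) (g : Z -> R),
    (forall z, measurable [set x | h x = z]) /\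
    (forall x, D x -> `|f x - g (h x)| <= K / N%:R)) -> measurable_fun D f.
Proof.
move=> H.
have H' N : exists F : T -> R, measurable_fun D F /\
    (forall x, D x -> `|f x - F x| <= K / N.+1%:R).
  have [Z [h [g [mh fg]]]] := H N.+1 isT.
  by exists (g \o h); split => //; exact: measurable_fun_finite_map.
have [F FP] := choice H'.
apply: (@measurable_fun_cvg _ _ _ _ F) => [N|x Dx]; first by have [] := FP N.
apply/cvgrPdist_le => /= e e0.
near=> N; have [_ /(_ x Dx)] := FP N; move/le_trans; apply.
rewrite ler_pdivrMr// mulrC -ler_pdivrMr//.
rewrite (le_trans (ler_norm _))// -[leRHS]natr1 ler_wpDr//.
by near: N; exact: nbhs_infty_ger.
Unshelve. all: by end_near. Qed.

Variable mu : {measure set T -> \bar R}.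
Hypothesis muD : mu D = 1%E.

(** Since [mu D] is 1, a uniform error passes to the integral unchanged. One estimate covers
    Lebesgue measure on the interval and on the square, and the measure dC: only the masses of the
    cells change. *)
Lemma Rintegral_grid (Z : finType) (h : T -> Z) (g : Z -> R) (f : T -> R) (e :
  R) :
  (forall z, measurable [set x | h x = z]) -> measurable_fun D f ->
  (forall x, D x -> `|f x - g (h x)| <= e) ->
  `|\int[mu]_(x in D) f x - \sum_z fine (mu (D `&` [set x | h x = z])) * g z|
    <= e.
Proof.
move=> mh mf fg.
have muDoo : (mu D < +oo)%E by rewrite muD ltry.
pose A z := D `&` [set x | h x = z].
have mA z : measurable (A z) by exact: measurableI.
have muA z : mu (A z) \is a fin_num.
  rewrite ge0_fin_numE// (le_lt_trans _ muDoo)// le_measure ?inE//.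
  exact: subIsetl.
pose M := \sum_z `|g z|.
have gM z : `|g z| <= M by rewrite /M (bigD1 z)//= lerDl sumr_ge0.
have bnd (F : T -> R) (c : R) : measurable_fun D F -> (forall x, D x -> `|F x|
  <= c) ->
    mu.-integrable D (EFin \o F).
  move=> mF Fc; apply: measurable_bounded_integrable => //.
  exists c; split; first exact: num_real.
  by move=> c' cc' x Dx /=; rewrite (le_trans (Fc x Dx))// ltW.
have mgh := measurable_fun_finite_map g mh.
have igh : mu.-integrable D (EFin \o (g \o h)) by apply: (bnd _ M) => // x _
  /=; exact: gM.
have intf : mu.-integrable D (EFin \o f).
  apply: (bnd _ (e + M)) => // x Dx; rewrite -[f x](subrK (g (h x))).
  by rewrite (le_trans (ler_normD _ _))// lerD// fg.
have intg : \int[mu]_(x in D) (g \o h) x = \sum_z fine (mu (A z)) * g z.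
  have iA z : mu.-integrable D (fun x => (g z)%:E * (\1_(A z) x)%:E)%E.
    rewrite (_ : (fun x => _) = EFin \o (fun x => g z * \1_(A z) x));
      last first.
      by apply/funext => x /=; rewrite EFinM.
    apply: (bnd _ `|g z|); last first.
      move=> x _; rewrite normrM ler_piMr// indicE.
      by case: (_ \in _); rewrite ?normr1 ?normr0.
    by apply: measurable_funM => //; exact: measurable_indic.
  rewrite /Rintegral (_ : (\int[mu]_(x in D) ((g \o h) x)%:E)%E =
     (\sum_z mu (A z) * (g z)%:E)%E).
    rewrite -sum_fine => [|z _]; last by rewrite fin_numM.
    by apply: eq_bigr => z _; rewrite fineM.
  transitivity (\int[mu]_(x in D) (\sum_z (g z)%:E * (\1_(A z) x)%:E))%E.
    apply: eq_integral => x; rewrite inE => Dx.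
    rewrite (bigD1 (h x))//= indicE mem_set//= mule1 big1 ?adde0// => z zx.
    rewrite indicE memNset ?mule0// => -[_ /= hx].
    by rewrite hx eqxx in zx.
  rewrite (integral_sum mD iA); apply: eq_bigr => z _.
  rewrite integralZl//; last first.
    rewrite (_ : (fun x => _) = EFin \o (\1_(A z) : T -> R))//.
    apply: (bnd _ 1); first exact: measurable_indic.
    by move=> x _; rewrite indicE; case: (_ \in _); rewrite ?normr1 ?normr0.
  rewrite integral_indic// muleC; congr (mu _ * _)%E.
  by rewrite /A setIAC setIid.
rewrite -intg -RintegralB//.
have mfg : measurable_fun D (fun x => f x - (g \o h) x) by exact:
  measurable_funB.
have ifg : mu.-integrable D (EFin \o (fun x => f x - (g \o h) x)).
  by apply: (bnd _ e) => // x Dx; exact: fg.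
apply: (le_trans (le_normr_Rintegral mD ifg)).
have -> : e = \int[mu]_(x in D) e by rewrite Rintegral_cst// muD mulr1.
apply: le_Rintegral => //.
- apply: (bnd _ e); first exact: measurableT_comp.
  by move=> x Dx; rewrite normr_id; exact: fg.
- apply: (bnd _ `|e|) => //.
Qed.

End GridIntegral.

Section UnitIndex.
Context {R : realType} (N : nat).
Local Notation I := 'I_N.+1.
Local Notation I01 := (`[0, 1]%classic : set R).

(** Clamping to [0, 1] makes the preimages of cells measurable in the whole line; only their traces
    on [0, 1] enter the integrals. *)
Definition unit_index (u : R) : I := grid_index (Num.max 0 (Num.min u 1)).

Lemma unit_indexE (u : R) : 0 <= u <= 1 -> unit_index u = grid_index u.
Proof. by move=> /andP[u0 u1]; rewrite /unit_index min_l// max_r. Qed.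

Hypothesis N_gt0 : (0 < N)%N.

Lemma measurable_unit_index {d : measure_display} {T : measurableType d} (f : T
  -> R) :
  measurable_fun setT f -> forall a, measurable [set x | unit_index (f x) = a].
Proof.
move=> mf; apply: measurable_index => a.
pose g x := Num.max 0 (Num.min (f x) 1).
have mg : measurable_fun setT g.
  by apply: measurable_maxr => //; apply: measurable_minr.
rewrite (_ : [set x | _] = g @^-1` `]-oo, node a]).
  by rewrite -[X in measurable X]setTI; apply: mg => //; exact: measurable_itv.
apply/seteqP; split => x; rewrite /= in_itv/= /unit_index grid_index_le//;
  by rewrite le_max lexx/= ge_max ler01 ge_min lexx orbT.
Qed.

Lemma measurable_unit_cell {d : measure_display} {T : measurableType d} (f g :
  T -> R) :
  measurable_fun setT f -> measurable_fun setT g ->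
  forall z, measurable [set x | (unit_index (f x), unit_index (g x)) = z].
Proof.
move=> mf mg [a b]; rewrite (_ : [set x | _] =
    [set x | unit_index (f x) = a] `&` [set x | unit_index (g x) = b]).
  by apply: measurableI; exact: measurable_unit_index.
by apply/seteqP; split => x /= [e1 e2]; rewrite ?e1 ?e2.
Qed.

Lemma lebesgue_unit : lebesgue_measure I01 = 1%E.
Proof. by rewrite lebesgue_measure_itv/= lte_fin ltr01 oppr0 adde0. Qed.

Lemma lebesgue_unit_cell (a : I) :
  lebesgue_measure (I01 `&` [set u | unit_index u = a]) = (cell_mass a)%:E.
Proof.
have mh := measurable_unit_index (@measurable_id _ (measurableTypeR R) setT).
have fin b : lebesgue_measure (I01 `&` [set u : R | unit_index u = b]) \is a
  fin_num.
  rewrite ge0_fin_numE// (@le_lt_trans _ _ (lebesgue_measure I01))//;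
    last first.
    by rewrite lebesgue_unit ltry.
  apply: le_measure; rewrite ?inE; [|exact: measurable_itv|by move=> u []].
  by apply: measurableI => //; exact: mh.
rewrite -[LHS]fineK//; congr (_%:E).
apply: (@node_cell_mass _ _ (fun b => fine (lebesgue_measure (I01 `&` [set u |
  unit_index u = b])))) => b.
rewrite sum_fine// -(measure_finite_map mh lebesgue_measure (fun a' : I => a'
  <= b)%N) ?measurable_itv//.
have /andP[b0 b1] := @node01 R N b.
rewrite (_ : I01 `&` _ = `[0, node b]%classic); last first.
  apply/seteqP; split => u /=; rewrite !in_itv/=.
    move=> [/andP[u0 u1]]; rewrite unit_indexE ?u0// grid_index_le ?u0// => ->.
  move=> /andP[u0 ub]; have u1 := le_trans ub b1.
  by rewrite u0 u1 unit_indexE ?u0// grid_index_le ?u0.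
rewrite -[X in fine X]/(lebesgue_measure _) lebesgue_measure_itv/= lte_fin
  oppr0 adde0.
by case: ltP => //= nb; apply/eqP; rewrite eq_le nb b0.
Qed.

Lemma lebesgue_square : (lebesgue_measure \x lebesgue_measure)%E (I01 `*` I01)
  = 1%E.
Proof.
rewrite product_measure1E ?measurable_itv// -[RHS]mule1.
by congr (_ * _)%E; exact: lebesgue_unit.
Qed.

Lemma lebesgue_square_cell (a b : I) :
  (lebesgue_measure \x lebesgue_measure)%E ((I01 `*` I01) `&`
    [set z | (unit_index z.1, unit_index z.2) = (a, b)]) =
  (cell_mass a * cell_mass b)%:E.
Proof.
rewrite (_ : _ `&` _ = (I01 `&` [set u | unit_index u = a]) `*`
    (I01 `&` [set u | unit_index u = b])); last first.
  apply/seteqP; split => -[u v] /=.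
    by move=> [[h1 h2] [h3 h4]].
  by move=> [[h1 h2] [h3 h4]]; split => //; rewrite h2 h4.
have mh := measurable_unit_index (@measurable_id _ (measurableTypeR R) setT).
rewrite product_measure1E; [|by apply: measurableI => //; exact: mh..].
by rewrite EFinM; congr (_ * _)%E; exact: lebesgue_unit_cell.
Qed.

End UnitIndex.

Section CopulaIntegrals.
Context {R : realType} {d : nat} (law : probability (d.-tuple R) R).
Variables (l m : 'I_d).
Hypotheses (lm : l != m) (F_cont : forall j, continuous (marginal_cdf law j)).
Local Notation C := (bimargin law l m).
Local Notation dC := (bimargin_law law l m).
Local Notation dPi := (@lebesgue_measure R \x @lebesgue_measure R)%E.
Local Notation I01 := (`[0, 1]%classic : set R).

Local Notation cells N := (@cell_law R d law l m N).

Lemma bimargin_grid (N : nat) (s t : R) : (0 < N)%N -> 0 <= s <= 1 -> 0 <= t <=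
  1 ->
  `|C s t - C (node (@grid_index R N s)) (node (@grid_index R N t))| <= 2 /
    N%:R.
Proof.
move=> N0 s01 t01.
have /andP[s1 s2] := grid_index_node N0 s01;
  have /andP[t1 t2] := grid_index_node N0 t01.
have := bimargin_mono_lipschitz lm F_cont s01 (node01 _) t01 (node01 _) s1 t1.
move=> /andP[h1 h2]; rewrite distrC ger0_norm// (le_trans h2)//.
rewrite mulrDl mul1r lerD// lerBlDr addrC//.
Qed.

Lemma square01 (z : R * R) : (I01 `*` I01) z -> 0 <= z.1 <= 1 /\ 0 <= z.2 <= 1.
Proof. by case=> /=; rewrite !in_itv. Qed.

Lemma measurable_square : measurable (I01 `*` I01).
Proof. by apply: measurableX; exact: measurable_itv. Qed.

Lemma grid_square (N : nat) (z : R * R) : (0 < N)%N -> (I01 `*` I01) z ->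
  `|C z.1 z.2 - C (node (unit_index N z.1)) (node (unit_index N z.2))| <= 2 /
    N%:R.
Proof.
move=> N0 /square01[z1 z2]; rewrite !unit_indexE//.
exact: bimargin_grid.
Qed.

Lemma measurable_bimargin_square :
  measurable_fun (I01 `*` I01) (fun z : R * R => C z.1 z.2).
Proof.
apply: (measurable_grid_limit measurable_square (K := 2)) => N N0.
exists (('I_N.+1 * 'I_N.+1)%type : finType).
exists (fun z => (unit_index N z.1, unit_index N z.2)), (fun z => C (node z.1)
  (node z.2)).
split; last by move=> z Dz; exact: grid_square.
by move=> z; apply: measurable_unit_cell.
Qed.

Lemma bimargin_lawE (A : set (R * R)) :
  dC A = law [set x | A (tnth (pit law x) l, tnth (pit law x) m)].
Proof. by []. Qed.

Lemma dC_unit_square : dC (I01 `*` I01) = 1%E.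
Proof.
rewrite bimargin_lawE (_ : [set x | _] = setT) ?probability_setT//.
by apply/seteqP; split => // x _ /=; split; rewrite /= in_itv/=; exact: pit01.
Qed.

Lemma dC_cell (N : nat) (z : 'I_N.+1 * 'I_N.+1) : (0 < N)%N ->
  fine (dC ((I01 `*` I01) `&` [set w | (unit_index N w.1, unit_index N w.2) =
    z])) =
  cell_law law l m z.
Proof.
move=> N0; rewrite bimargin_lawE.
congr (fine (law _)); apply/seteqP; split => x /=.
  by move=> [_]; rewrite !unit_indexE; [|exact: pit01..].
move=> <-; split; last by rewrite !unit_indexE; [|exact: pit01..].
by split; rewrite /= in_itv/=; exact: pit01.
Qed.

Lemma spearman_grid (N : nat) : (0 < N)%N ->
  `|spearman law l m - (12 * (\sum_(a : 'I_N.+1) cell_mass a *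
      mean_section (cells N) a) - 3)| <= 24 / N%:R.
Proof.
move=> N0.
pose T := (measurableTypeR R * measurableTypeR R)%type.
have mS : measurable (I01 `*` I01 : set T) by exact: measurable_square.
have mB : @measurable_fun _ _ T R (I01 `*` I01) (fun z => C z.1 z.2).
  exact: measurable_bimargin_square.
have := @Rintegral_grid _ T _ _ mS dPi lebesgue_square
  ('I_N.+1 * 'I_N.+1)%type (fun z => (unit_index N z.1, unit_index N z.2))
  (fun z => C (node z.1) (node z.2)) (fun z => C z.1 z.2) (2 / N%:R)
  (measurable_unit_cell N0 measurable_fst measurable_snd) mB (fun z =>
    @grid_square N z N0).
rewrite (_ : \sum_z _ = \sum_(a : 'I_N.+1) cell_mass a *
    mean_section (cells N) a); last first.
  transitivity (\sum_(z : 'I_N.+1 * 'I_N.+1)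
      cell_mass z.1 * cell_mass z.2 * C (node z.1) (node z.2)).
    apply: eq_bigr => -[a b] _ /=; congr (_ * _).
    by have /(congr1 fine) := lebesgue_square_cell (R := R) N0 a b.
  rewrite -(pair_bigA _ (fun a b : 'I_N.+1 => cell_mass a * cell_mass b * C
    (node a) (node b)))/=.
  apply: eq_bigr => a _; rewrite /mean_section mulr_sumr; apply: eq_bigr => b _.
  by rewrite cell_law_cdf// mulrA.
rewrite /spearman => h.
have -> : forall x y : R, 12 * x - 3 - (12 * y - 3) = 12 * (x - y) by move=> x
  y; ring.
have -> : 24 / N%:R = 12 * (2 / N%:R) :> R by rewrite mulrA -natrM.
by rewrite normrM ger0_norm// ler_pM2l.
Qed.

Lemma kendall_grid (N : nat) : (0 < N)%N ->
  `|kendall law l m - (4 * mean (cells N)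
      (fun z : 'I_N.+1 * 'I_N.+1 => cell_cdf (cells N) z.1 z.2) - 1)| <= 8 /
        N%:R.
Proof.
move=> N0.
have := @Rintegral_grid _ _ _ _ measurable_square dC dC_unit_square
  ('I_N.+1 * 'I_N.+1)%type (fun z => (unit_index N z.1, unit_index N z.2))
  (fun z => C (node z.1) (node z.2)) (fun z => C z.1 z.2) (2 / N%:R)
  (measurable_unit_cell N0 measurable_fst measurable_snd)
  measurable_bimargin_square (fun z => @grid_square N z N0).
rewrite (_ : \sum_z _ = mean (cells N)
      (fun z : 'I_N.+1 * 'I_N.+1 => cell_cdf (cells N) z.1 z.2)); last first.
  by apply: eq_bigr => z _; rewrite dC_cell// cell_law_cdf.
rewrite /kendall => h.
have -> : forall x y : R, 4 * x - 1 - (4 * y - 1) = 4 * (x - y) by move=> x y;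
  ring.
have -> : 8 / N%:R = 4 * (2 / N%:R) :> R by rewrite mulrA -natrM.
by rewrite normrM ger0_norm// ler_pM2l.
Qed.

Lemma product_moment_grid (N : nat) : (0 < N)%N ->
  `|\int[dC]_(z in I01 `*` I01) (z.1 * z.2) - mean (cells N)
      (fun z : 'I_N.+1 * 'I_N.+1 => node z.1 * node z.2)| <= 2 / N%:R.
Proof.
move=> N0.
have := @Rintegral_grid _ _ _ _ measurable_square dC dC_unit_square
  ('I_N.+1 * 'I_N.+1)%type (fun z => (unit_index N z.1, unit_index N z.2))
  (fun z => node z.1 * node z.2) (fun z => z.1 * z.2) (2 / N%:R)
  (measurable_unit_cell N0 measurable_fst measurable_snd).
rewrite (_ : \sum_z _ = mean (cells N)
      (fun z : 'I_N.+1 * 'I_N.+1 => node z.1 * node z.2)); last first.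
  by apply: eq_bigr => z _; rewrite dC_cell.
apply.
  apply: measurable_funM; apply: (@measurable_funS _ _ _ _ setT) => //.
move=> z /square01[z1 z2]; rewrite !unit_indexE//.
have /andP[s1 s2] := grid_index_node N0 z1;
  have /andP[t1 t2] := grid_index_node N0 z2.
have /andP[n0 n1] := @node01 R N (grid_index z.1).
have /andP[z20 z21] := z2.
set s := node (grid_index z.1) in s1 s2 n0 n1 *; set t := node _ in t1 t2 *.
rewrite distrC (_ : s * t - z.1 * z.2 = s * (t - z.2) + (s - z.1) * z.2);
  last by ring.
have t3 : 0 <= t - z.2 by rewrite subr_ge0.
have s3 : 0 <= s - z.1 by rewrite subr_ge0.
have -> : 2 / N%:R = N%:R^-1 + N%:R^-1 :> R by rewrite mulrDl mul1r.
rewrite ger0_norm ?addr_ge0 ?mulr_ge0// lerD//.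
  by rewrite -[leRHS]mul1r ler_pM// lerBlDr addrC.
by rewrite -[leRHS]mulr1 ler_pM// lerBlDr addrC.
Qed.

Lemma section_grid (N : nat) (u v : R) : (0 < N)%N -> 0 <= u <= 1 -> 0 <= v <=
  1 ->
  `|\int[@lebesgue_measure R]_(z in I01) (C u z + C z v) -
    (mean_section (cells N) (@grid_index R N u) +
     mean_section (swap_weights (cells N)) (@grid_index R N v))| <= 4 / N%:R.
Proof.
move=> N0 u01 v01.
have gr (M : nat) (z : R) : (0 < M)%N -> I01 z ->
    `|(C u z + C z v) - (C (node (@grid_index R M u)) (node (unit_index M z)) +
      C (node (unit_index M z)) (node (@grid_index R M v)))| <= 4 / M%:R.
  move=> M0; rewrite /= in_itv/= => z01; rewrite !unit_indexE//.
  have := bimargin_grid M0 u01 z01; have := bimargin_grid M0 z01 v01.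
  move=> h1 h2; rewrite opprD addrACA (le_trans (ler_normD _ _))//.
  by apply: le_trans (lerD h2 h1) _; rewrite -mulrDl -natrD.
have mI : measurable (I01 : set (measurableTypeR R)) by exact: measurable_itv.
have mf : @measurable_fun _ _ (measurableTypeR R) R I01 (fun z => C u z + C z
  v).
  apply: (measurable_grid_limit mI (K := 4)) => M M0.
  exists 'I_M.+1, (unit_index M), (fun b => C (node (@grid_index R M u)) (node
    b) +
      C (node b) (node (@grid_index R M v))).
  by split; [exact: measurable_unit_index|move=> z Dz; exact: gr].
have := @Rintegral_grid _ (measurableTypeR R) _ _ mI lebesgue_measure
  lebesgue_unit _ (unit_index N)
  (fun b => C (node (@grid_index R N u)) (node b) + C (node b) (node
    (@grid_index R N v)))
  _ _ (measurable_unit_index N0 (@measurable_id _ (measurableTypeR R) setT)) mf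
    (fun z => @gr N z N0).
rewrite (_ : \sum_z _ = mean_section (cells N) (@grid_index R N u) +
     mean_section (swap_weights (cells N)) (@grid_index R N v))//.
rewrite /mean_section -big_split/=; apply: eq_bigr => a _.
rewrite lebesgue_unit_cell//= -mulrDr; congr (_ * (_ + _)).
  by rewrite cell_law_cdf.
by rewrite /cell_cdf rect_sum_swap -/(cell_cdf _ _ _) cell_law_cdf.
Qed.

End CopulaIntegrals.

(** * Second-order expansion of the copula at (1/2, 1/2) *)

Lemma quadratic_sum_le {R : realType} (B a b x1 x2 x3 : R) :
  0 <= B -> 0 <= a -> 0 <= b -> x1 <= B * a -> x2 <= B * b -> x3 <= B * b ->
  x1 * a + x2 * a + x3 * b <= 2 * B * (a ^+ 2 + b ^+ 2).
Proof.
move=> B0 a0 b0 h1 h2 h3.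
apply: (@le_trans _ _ (B * a * a + B * b * a + B * b * b)).
  by rewrite !lerD// ler_wpM2r.
have -> : 2 * B * (a ^+ 2 + b ^+ 2) = B * a * a + B * b * a + B * b * b +
    (B * (a ^+ 2 + b ^+ 2) / 2 + B * (a - b) ^+ 2 / 2) by field.
by rewrite lerDl addr_ge0// mulr_ge0 ?invr_ge0// mulr_ge0 ?addr_ge0 ?sqr_ge0.
Qed.

Lemma mvt_between {R : realType} (f : R -> R) (x y : R) :
  (forall z, Num.min x y <= z <= Num.max x y -> derivable f z 1) ->
  exists2 c, Num.min x y <= c <= Num.max x y & f x - f y = 'D_1 f c * (x - y).
Proof.
wlog yx : x y / y <= x => [H df|].
  case/orP: (le_total y x) => [yx|xy]; first exact: H.
  have [z zz|c cc e] := H y x xy; first by apply: df; rewrite minC maxC.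
  exists c; first by rewrite minC maxC.
  by rewrite -[LHS]opprB e -mulrN opprB.
rewrite (min_r yx) (max_l yx) => df.
have [z||c cyx ->] := @MVT_segment R f ('D_1 f) y x yx.
- rewrite in_itv/= => /andP[z1 z2]; apply: derivableP; apply: df.
  by rewrite !ltW.
- apply: derivable_within_continuous => z; rewrite in_itv/= => zz.
  exact: df.
by exists c => //; rewrite in_itv/= in cyx.
Qed.

Lemma derive_lipschitz_le {R : realType} (f : R -> R) (x r : R) : 0 < r ->
  (forall h, `|h| < r -> `|f (h + x) - f x| <= `|h|) ->
  derivable f x 1 -> `|'D_1 f x| <= 1.
Proof.
move=> r0 lip df.
have q : \forall h \near 0^', `|h^-1 *: ((f \o shift x) (h *: (1 : R)) - f x)|
  <= 1.
  near=> h; rewrite /= /GRing.scale/= mulr1 normrM normfV.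
  have hr : `|h| < r by near: h; exact: dnbhs0_lt.
  rewrite mulrC; have [->|h0] := eqVneq h 0;
    first by rewrite normr0 invr0 mulr0.
  by rewrite ler_pdivrMr ?normr_gt0// mul1r lip.
rewrite ler_norml; apply/andP; split.
  apply: limr_ge => //; near=> h.
  have : `|h^-1 *: ((f \o shift x) (h *: (1 : R)) - f x)| <= 1 by near: h.
  by rewrite ler_norml => /andP[].
apply: limr_le => //; near=> h.
have : `|h^-1 *: ((f \o shift x) (h *: (1 : R)) - f x)| <= 1 by near: h.
by rewrite ler_norml => /andP[].
Unshelve. all: by end_near. Qed.

Section CopulaTaylor.
Context {R : realType} {d : nat} (law : probability (d.-tuple R) R).
Variables (l m : 'I_d) (K : R).
Hypotheses (lm : l != m) (F_cont : forall j, continuous (marginal_cdf law j)).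
Hypothesis C_reg : second_order_regular K (copula law).
Local Notation C := (bimargin law l m).
Local Notation half := (2^-1 : R).

(** By definition [bimargin] is the copula on this face, so that partial derivatives in the
    directions [l] and [m] become ordinary derivatives in [s] and [t]. *)
Definition face (s t : R) : 'rV[R]_d :=
  \row_j (if j == l then s else if j == m then t else 1).

Lemma face_shiftl (s t h : R) : h *: delta_mx 0 l + face s t = face (h + s) t.
Proof.
apply/rowP => j; rewrite !mxE eqxx/=.
by case: eqP => [_|_]; rewrite ?mulr1// mulr0 add0r.
Qed.

Lemma face_shiftr (s t h : R) : h *: delta_mx 0 m + face s t = face s (h + t).
Proof.
apply/rowP => j; rewrite !mxE eqxx/=.
case: (eqVneq j l) => [->|_]; first by rewrite (negbTE lm) mulr0 add0r.
by case: eqP => [_|_]; rewrite ?mulr1// mulr0 add0r.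
Qed.

Section Partial.
Variable f : 'rV[R]_d -> R.

Lemma partiall (s t : R) : partial l f (face s t) = 'D_1 (fun s => f (face s
  t)) s.
Proof.
rewrite /partial /derive; congr (lim (_ @ 0^')); apply/funext => h /=.
by rewrite face_shiftl /GRing.scale/= mulr1.
Qed.

Lemma partialr (s t : R) : partial m f (face s t) = 'D_1 (fun t => f (face s
  t)) t.
Proof.
rewrite /partial /derive; congr (lim (_ @ 0^')); apply/funext => h /=.
by rewrite face_shiftr /GRing.scale/= mulr1.
Qed.

Lemma partially_derivablel (s t : R) : partially_derivable l f (face s t) ->
  derivable (fun s => f (face s t)) s 1.
Proof.
rewrite /partially_derivable /derivable.
have -> : (fun h : R => h^-1 *: (((fun s => f (face s t)) \o shift s) (h *: (1
  : R))
    - f (face s t))) =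
  (fun h => h^-1 *: ((f \o shift (face s t)) (h *: delta_mx 0 l) - f (face s
    t))).
  by apply/funext => h /=; rewrite face_shiftl /GRing.scale/= mulr1.
by [].
Qed.

Lemma partially_derivabler (s t : R) : partially_derivable m f (face s t) ->
  derivable (fun t => f (face s t)) t 1.
Proof.
rewrite /partially_derivable /derivable.
have -> : (fun h : R => h^-1 *: (((fun t => f (face s t)) \o shift t) (h *: (1
  : R))
    - f (face s t))) =
  (fun h => h^-1 *: ((f \o shift (face s t)) (h *: delta_mx 0 m) - f (face s
    t))).
  by apply/funext => h /=; rewrite face_shiftr /GRing.scale/= mulr1.
by [].
Qed.

End Partial.

(** At most the coordinates [l] and [m] are below 1, so a condition on [Wset2] controls the
    bivariate margin. *)
Lemma face_inner (s t : R) : 0 < s < 1 -> 0 < t < 1 ->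
  (Vset l `&` Vset m `&` Wset2) (face s t).
Proof.
move=> s01 t01.
have le1 (z : R) : 0 < z < 1 -> 0 <= z <= 1 by move=> /andP[z0 z1];
  rewrite !ltW.
have all01 k : 0 <= face s t 0 k <= 1.
  rewrite mxE; case: eqP => _; first exact: le1.
  by case: eqP => _; [exact: le1|rewrite ler01 lexx].
have El : face s t 0 l = s by rewrite mxE eqxx.
have Em : face s t 0 m = t by rewrite mxE eq_sym (negbTE lm) eqxx.
split; last split => //.
  by split; split => //; rewrite ?El ?Em.
apply: (@leq_trans #|pred2 l m|); last by rewrite card2; case: (_ != _).
apply/subset_leq_card/fintype.subsetP => j; rewrite !inE mxE.
by case: eqP => //= _; case: eqP => //; rewrite ltxx.
Qed.

(** 16/3 is the maximum of 1 / (z (1 - z)) on [1/4, 3/4], attained at the ends; the absolute value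
    covers any sign of [K]. *)
Let B := `|K| * (16 / 3).

Let quarter (s : R) : 4^-1 <= s <= 3 / 4 -> 0 < s < 1.
Proof. by move=> /andP[? ?]; apply/andP; split; lra. Qed.

Lemma second_partial_le (i j : 'I_d) (s t : R) :
  i = l \/ i = m -> j = l \/ j = m ->
  4^-1 <= s <= 3 / 4 -> 4^-1 <= t <= 3 / 4 ->
  `|partial i (partial j (copula law)) (face s t)| <= B.
Proof.
move=> il jl s4 t4; have [[Vl Vm] W] := face_inner (quarter s4) (quarter t4).
have V k : k = l \/ k = m -> Vset k (face s t) by case=> ->.
have [_ _ /(_ i j (face s t))] := C_reg.
move=> /(_ (conj (conj (V i il) (V j jl)) W)) /le_trans; apply.
have big k : k = l \/ k = m -> (face s t 0 k * (1 - face s t 0 k))^-1 <= 16 / 3.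
  have El : face s t 0 l = s by rewrite mxE eqxx.
  have Em : face s t 0 m = t by rewrite mxE eq_sym (negbTE lm) eqxx.
  have h (z : R) : 4^-1 <= z <= 3 / 4 -> (z * (1 - z))^-1 <= 16 / 3.
    move=> /andP[z1 z2]; rewrite -[16 / 3]invrK lef_pV2 ?posrE; first last.
    - by rewrite invr_gt0.
    - by rewrite mulr_gt0//; lra.
    by rewrite invf_div; nra.
  by case=> ->; rewrite ?El ?Em; exact: h.
have h0 : 0 <= Num.min (face s t 0 j * (1 - face s t 0 j))^-1
    (face s t 0 i * (1 - face s t 0 i))^-1.
  have pos k : k = l \/ k = m -> 0 <= (face s t 0 k * (1 - face s t 0 k))^-1.
    move=> /V[a01 /andP[a b]]; rewrite invr_ge0 mulr_ge0 ?(ltW a)// subr_ge0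
      ltW//.
  by rewrite le_min !pos.
apply: (@le_trans _ _ (`|K| * Num.min (face s t 0 j * (1 - face s t 0 j))^-1
    (face s t 0 i * (1 - face s t 0 i))^-1)).
  by rewrite ler_wpM2r// ler_norm.
by rewrite /B ler_wpM2l// ge_min big.
Qed.

Lemma face_derivable (j : 'I_d) (s t : R) : j = l \/ j = m ->
  4^-1 <= s <= 3 / 4 -> 4^-1 <= t <= 3 / 4 ->
  partially_derivable j (copula law) (face s t).
Proof.
move=> jl s4 t4; have [[Vl Vm] W] := face_inner (quarter s4) (quarter t4).
have [/(_ j)[+ _] _ _] := C_reg; apply; split => //.
by case: jl => ->.
Qed.

Lemma face_derivable2 (i j : 'I_d) (s t : R) : i = l \/ i = m -> j = l \/ j = m
  ->
  4^-1 <= s <= 3 / 4 -> 4^-1 <= t <= 3 / 4 ->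
  partially_derivable i (partial j (copula law)) (face s t).
Proof.
move=> il jl s4 t4; have [[Vl Vm] W] := face_inner (quarter s4) (quarter t4).
have V k : k = l \/ k = m -> Vset k (face s t) by case=> ->.
have [_ /(_ i j)[+ _] _] := C_reg; apply; split => //; split; exact: V.
Qed.

Let between (z c : R) : 4^-1 <= z <= 3 / 4 ->
  Num.min z half <= c <= Num.max z half -> 4^-1 <= c <= 3 / 4 /\ `|c - half| <=
    `|z - half|.
Proof.
move=> /andP[z1 z2]; have [zh|hz] := leP z half => /andP[c1 c2].
  split; first by apply/andP; split; lra.
  by rewrite !ler0_norm; lra.
split; first by apply/andP; split; lra.
by rewrite !ger0_norm; lra.
Qed.

Let half4 : 4^-1 <= half <= 3 / 4.
Proof. by apply/andP; split; lra. Qed.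

(** Mean value theorem along the broken line from (s, t) to (1/2, t) to (1/2, 1/2), then once more
    on the first-order partials at the intermediate points, whose own derivatives are at most [B].
    The three resulting products are collected by [quadratic_sum_le]. *)
Lemma copula_taylor (s t : R) : 4^-1 <= s <= 3 / 4 -> 4^-1 <= t <= 3 / 4 ->
  `|C s t - C half half - derive1 (fun s => C s half) half * (s - half)
    - derive1 (fun t => C half t) half * (t - half)|
  <= 2 * B * ((s - half) ^+ 2 + (t - half) ^+ 2).
Proof.
move=> s4 t4; rewrite !derive1E.
pose L s t := partial l (copula law) (face s t).
pose M s t := partial m (copula law) (face s t).
have B0 : 0 <= B by rewrite mulr_ge0.
have [x xs e1] : exists2 x, Num.min s half <= x <= Num.max s half &
    C s t - C half t = L x t * (s - half).
  have [z /(between s4)[z4 _]|x xx e] := @mvt_between R (fun s => C s t) s half.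
    by apply: partially_derivablel; apply: face_derivable => //; left.
  by exists x => //; rewrite /L partiall.
have [y yt e2] : exists2 y, Num.min t half <= y <= Num.max t half &
    C half t - C half half = M half y * (t - half).
  have [z /(between t4)[z4 _]|y yy e] := @mvt_between R (fun t => C half t) t
    half.
    by apply: partially_derivabler; apply: face_derivable => //; right.
  by exists y => //; rewrite /M partialr.
have [x4 xh] := between s4 xs; have [y4 yh] := between t4 yt.
have b1 : `|L x t - L half t| <= B * `|s - half|.
  have [z /(between x4)[z4 _]|c /(between x4)[c4 _] ->] :=
      @mvt_between R (fun s => L s t) x half.
    by apply: partially_derivablel; apply: face_derivable2 => //; left.
  rewrite normrM ler_pM// -(partiall (partial l (copula law))).
  by apply: second_partial_le => //; left.
have b2 : `|L half t - L half half| <= B * `|t - half|.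
  have [z /(between t4)[z4 _]|c /(between t4)[c4 _] ->] :=
      @mvt_between R (fun t => L half t) t half.
    by apply: partially_derivabler; apply: face_derivable2 => //; [right|left].
  rewrite normrM ler_pM// -(partialr (partial l (copula law))).
  by apply: second_partial_le => //; [right|left].
have b3 : `|M half y - M half half| <= B * `|t - half|.
  have [z /(between y4)[z4 _]|c /(between y4)[c4 _] ->] :=
      @mvt_between R (fun t => M half t) y half.
    by apply: partially_derivabler; apply: face_derivable2 => //; right.
  rewrite normrM ler_pM// -(partialr (partial m (copula law))).
  by apply: second_partial_le => //; right.
have -> : 'D_1 (fun s => C s half) half = L half half by rewrite /L partiall.
have -> : 'D_1 (fun t => C half t) half = M half half by rewrite /M partialr.
have -> : C s t - C half half - L half half * (s - half) - M half half * (t -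
  half) =
    (L x t - L half t) * (s - half) + (L half t - L half half) * (s - half) +
    (M half y - M half half) * (t - half).
  have -> : C s t - C half half = (C s t - C half t) + (C half t - C half half)
    by ring.
  by rewrite e1 e2; ring.
apply: (le_trans (ler_normD _ _));
  apply: (le_trans (lerD (ler_normD _ _) (lexx _))).
rewrite !normrM -[(s - half) ^+ 2]real_normK ?num_real// -[(t - half) ^+
  2]real_normK ?num_real//.
exact: (quadratic_sum_le B0 (normr_ge0 _) (normr_ge0 _) b1 b2 b3).
Qed.

Lemma bimargin_derive_le1 :
  `|derive1 (fun s => C s half) half| <= 1 /\ `|derive1 (fun t => C half t)
    half| <= 1.
Proof.
have h01 : 0 <= half <= 1 by apply/andP; split; lra.
have shift01 (h : R) : `|h| < half -> 0 <= h + half <= 1.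
  by rewrite ltr_norml => /andP[? ?]; apply/andP; split; lra.
have lip (s s' t t' : R) : 0 <= s <= 1 -> 0 <= s' <= 1 -> 0 <= t <= 1 -> 0 <=
  t' <= 1 ->
    s <= s' -> t <= t' -> `|C s' t' - C s t| <= (s' - s) + (t' - t).
  move=> s1 s2 t1 t2 ss tt.
  have /andP[h1 h2] := bimargin_mono_lipschitz lm F_cont s1 s2 t1 t2 ss tt.
  by rewrite ger0_norm.
split; rewrite derive1E.
  apply: (@derive_lipschitz_le _ _ _ half) => // [h hh|].
    have h2 := shift01 h hh; have [h0|h0] := leP 0 h.
      apply: le_trans (lip half (h + half) half half _ _ _ _ _ _) _ => //.
      + by rewrite lerDr.
      + by rewrite addrK subrr addr0 ger0_norm.
    rewrite distrC; apply: le_trans (lip (h + half) half half half _ _ _ _ _ _)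
      _ => //.
    + by rewrite gerDr ltW.
    + by rewrite ltr0_norm//; lra.
  by apply: partially_derivablel; apply: face_derivable => //; left.
apply: (@derive_lipschitz_le _ _ _ half) => // [h hh|].
  have h2 := shift01 h hh; have [h0|h0] := leP 0 h.
    apply: le_trans (lip half half half (h + half) _ _ _ _ _ _) _ => //.
    + by rewrite lerDr.
    + by rewrite addrK subrr add0r ger0_norm.
  rewrite distrC; apply: le_trans (lip half half (h + half) half _ _ _ _ _ _) _
    => //.
  + by rewrite gerDr ltW.
  + by rewrite ltr0_norm//; lra.
by apply: partially_derivabler; apply: face_derivable => //; right.
Qed.

End CopulaTaylor.

(** * Error bounds for a pair of coordinates *)

Section PairError.
Context {R : realType} {d n : nat} (law : probability (d.-tuple R) R).
Variables (x : 'I_n -> d.-tuple R) (l m : 'I_d) (k t K : R).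
(* The number of cells is even so that 1/2 is a node. *)
Local Notation N := (2 * n)%N.
Local Notation p := (@cell_law R d law l m N).
Local Notation ix j i := (@pit_index R d law N j (x i)).
Local Notation ph := (@cell_freq R n N (fun i => ix l i) (fun i => ix m i)).
Local Notation u i := (tnth (pit law (x i)) l).
Local Notation v i := (tnth (pit law (x i)) m).
Hypotheses (lm : l != m) (F_cont : forall j, continuous (marginal_cdf law j)).
Hypotheses (n_ge2 : (2 <= n)%N) (k_ge0 : 0 <= k) (t01 : 0 < t <= 1).
Hypotheses (nt : 1 <= n%:R * t ^+ 4) (cl : rect_close k t p ph).

Let n_gt0 : (0 < n)%N. Proof. exact: ltnW. Qed.
Let N_gt0 : (0 < N)%N. Proof. by rewrite muln_gt0. Qed.
Let n0 : (0 : R) < n%:R. Proof. by rewrite ltr0n. Qed.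
Let Nt : 1 <= N%:R * t ^+ 4.
Proof.
apply: (le_trans nt); rewrite ler_wpM2r ?exprn_ge0 ?ler_nat ?leq_pmull//.
by case/andP: t01 => /ltW.
Qed.
Let pw : weights p. Proof. exact: cell_law_weights. Qed.
Let pm : uniform_margins p. Proof. exact: cell_law_margins. Qed.
Let phw : weights ph. Proof. exact: cell_freq_weights. Qed.

(** Contrapositive of the monotonicity of the cdf; it lets ranks of the observations be read off the
    cells of their transforms. *)
Lemma pit_index_mono j (y z : d.-tuple R) :
  (@pit_index R d law N j y < pit_index law N j z)%N -> tnth y j < tnth z j.
Proof.
rewrite ltNge ltnNge => /negP h; apply/negP => zy; apply: h.
rewrite pit_index_le//; apply: (@le_trans _ _ (tnth (pit law y) j)).
  by rewrite !tnth_mktuple marginal_cdf_nondecreasing.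
by rewrite -(pit_index_le law N_gt0).
Qed.

Let al i j : (ix l i < ix l j)%N -> tnth (x i) l < tnth (x j) l.
Proof. exact: pit_index_mono. Qed.
Let bm i j : (ix m i < ix m j)%N -> tnth (x i) m < tnth (x j) m.
Proof. exact: pit_index_mono. Qed.

Let e := (1 + 2 * k) * t ^+ 4.

Let ae c : rect_sum ph (pred1 c) xpredT <= e.
Proof. exact: (line_freq_le k_ge0 t01 Nt pm cl). Qed.
Let be c : rect_sum (swap_weights ph) (pred1 c) xpredT <= e.
Proof.
exact: (line_freq_le k_ge0 t01 Nt (uniform_margins_swap pm) (rect_close_swap
  cl)).
Qed.

Let t4 : t ^+ 4 <= t ^+ 3.
Proof. by case/andP: t01 => t0 t1; rewrite ler_wiXn2l// ltW. Qed.

Let mesh : n%:R^-1 <= t ^+ 3.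
Proof. by apply: le_trans t4; rewrite -(ler_pM2l n0) mulfV ?gt_eqF. Qed.

Let meshN (c : R) : c / N%:R = c / 2 * n%:R^-1.
Proof. by rewrite natrM invfM mulrA. Qed.

Let e3 : e <= (1 + 2 * k) * t ^+ 3.
Proof. by rewrite ler_wpM2l// addr_ge0// mulr_ge0. Qed.

Let u_node i : 0 <= node (ix l i) - u i <= 2^-1 * n%:R^-1.
Proof.
have /andP[h1 h2] := grid_index_node N_gt0 (pit01 law (x i) l).
have <- : N%:R^-1 = 2^-1 * n%:R^-1 :> R by rewrite natrM invfM.
by rewrite subr_ge0 h1 lerBlDl.
Qed.

Let v_node i : 0 <= node (ix m i) - v i <= 2^-1 * n%:R^-1.
Proof.
have /andP[h1 h2] := grid_index_node N_gt0 (pit01 law (x i) m).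
have <- : N%:R^-1 = 2^-1 * n%:R^-1 :> R by rewrite natrM invfM.
by rewrite subr_ge0 h1 lerBlDl.
Qed.

(** The multiplier 12 of rho gives 336 = 12 * 28; 216 = 12 * 12 + 36 * 2, the second part from the
    ties [e]. The constant 270 is 144 from the linearization, 36 from ties, 6 from the normalization
    of ranks, and 12 + 72 from the grid. *)
Lemma spearman_error :
  `|spearman_hat x l m - spearman law l m
    - n%:R^-1 * \sum_i lin_spearman law l m (pit law (x i))|
  <= (336 * k ^+ 2 + 216 * k + 270) * t ^+ 3.
Proof.
have h1 := spearman_hat_mean n_ge2 al bm ae be.
have h2 := spearman_grid lm F_cont N_gt0.
have h3 := rank_correlation_linearization k_ge0 t01 Nt pw phw pm cl.
have h4 := product_moment_grid law l m N_gt0.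
have h5 : `|n%:R^-1 * \sum_i lin_spearman law l m (pit law (x i)) -
    mean ph (fun z => 12 * ((1 - node z.1) * (1 - node z.2)) -
      36 * mean p (fun z => node z.1 * node z.2) +
      12 * (mean_section p z.1 + mean_section (swap_weights p) z.2))| <= 72 *
        n%:R^-1.
  rewrite mean_cell_freq; apply: sample_mean_le => // i /=.
  have h6 := section_grid lm F_cont N_gt0 (pit01 law (x i) l) (pit01 law (x i)
    m).
  have /andP[u1 u2] := u_node i; have /andP[v1 v2] := v_node i.
  have /andP[u3 u4] := pit01 law (x i) l;
    have /andP[v3 v4] := pit01 law (x i) m.
  have /andP[a3 a4] := @node01 R N (ix l i).
  have h7 : `|(1 - u i) * (1 - v i) - (1 - node (ix l i)) * (1 - node (ix m
    i))| <= n%:R^-1.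
    have -> : (1 - u i) * (1 - v i) - (1 - node (ix l i)) * (1 - node (ix m i))
      =
      (node (ix l i) - u i) * (1 - v i) + (1 - node (ix l i)) * (node (ix m i)
        - v i).
      by ring.
    have -> : n%:R^-1 = 2^-1 * n%:R^-1 * 1 + 1 * (2^-1 * n%:R^-1) :> R by
      field; rewrite gt_eqF.
    rewrite ger0_norm ?addr_ge0 ?mulr_ge0 ?subr_ge0//.
      by apply: lerD; apply: ler_pM => //; rewrite ?subr_ge0// lerBlDr lerDl.
    - by rewrite -subr_ge0.
    - by rewrite -subr_ge0.
  rewrite !meshN in h4 h6; rewrite /lin_spearman -/(u i) -/(v i).
  move: h4 h6 h7; set A := \int[_]_(_ in _) _; set B := \int[_]_(_ in _) _.
  set E := mean _ _; set s1 := mean_section _ _; set s2 := mean_section _ _.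
  set q1 := _ * (1 - node _); rewrite -[12 * _ * _]mulrA;
    set q2 := _ * (1 - v i).
  rewrite !ler_norml; clearbody A B E s1 s2 q1 q2; move: (n%:R^-1) => ni; lra.
rewrite meanD meanB !meanZ meanD mean_cst// in h5.
rewrite meshN in h2; move: h1 h2 h3 h5 mesh e3.
set r1 := spearman_hat _ _ _; set r2 := spearman _ _ _;
  set r3 := n%:R^-1 * \sum_i _.
set m1 := mean _ _; set m2 := \sum_a _; set m3 := mean _ _; set m4 := mean _ _.
set m5 := mean _ _; set m6 := mean _ _.
rewrite !ler_norml; clearbody e r1 r2 r3 m1 m2 m3 m4 m5 m6.
move: (n%:R^-1) (t ^+ 3) => ni t3; lra.
Qed.

(** Here 480 = 4 * 120 and 60 = 4 * 12 + 6 * 2; the constant 40 is 8 from the linearization, 6 from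
    ties, 2 from the normalization of pairs, and 4 + 20 from the grid. *)
Lemma kendall_error :
  `|kendall_hat x l m - kendall law l m
    - n%:R^-1 * \sum_i lin_kendall law l m (pit law (x i))|
  <= (480 * k ^+ 2 + 60 * k + 40) * t ^+ 3.
Proof.
have h1 := kendall_hat_mean n_ge2 al bm ae be.
have h2 := kendall_grid lm F_cont N_gt0.
have h3 := concordance_linearization k_ge0 t01 Nt pw phw pm cl.
have h5 : `|n%:R^-1 * \sum_i lin_kendall law l m (pit law (x i)) -
    mean ph (fun z => 8 * cell_cdf p z.1 z.2 - 4 * node z.1 - 4 * node z.2 +
      (2 - 2 * (4 * mean p (fun z => cell_cdf p z.1 z.2) - 1)))| <= 20 *
        n%:R^-1.
  rewrite mean_cell_freq; apply: sample_mean_le => // i /=.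
  have /andP[u1 u2] := u_node i; have /andP[v1 v2] := v_node i.
  have h6 : `|bimargin law l m (u i) (v i) - cell_cdf p (ix l i) (ix m i)| <= 2
    / N%:R.
    by rewrite cell_law_cdf//; apply: bimargin_grid => //; exact: pit01.
  rewrite !meshN in h2 h6; rewrite /lin_kendall.
  move: h2 h6 u1 u2 v1 v2; set C1 := bimargin _ _ _ _ _;
    set C2 := cell_cdf _ _ _.
  set E := mean _ _; set T := kendall _ _ _; set a := node _; set b := node _.
  rewrite !ler_norml; clearbody C1 C2 E T a b; move: (n%:R^-1) => ni; lra.
rewrite meanD !meanB !meanZ !mean_cst// in h5.
rewrite meshN in h2; move: h1 h2 h3 h5 mesh e3.
set r1 := kendall_hat _ _ _; set r2 := kendall _ _ _;
  set r3 := n%:R^-1 * \sum_i _.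
set m1 := mean _ _; set m2 := mean _ _; set m3 := mean _ _; set m4 := mean _ _.
set m5 := mean _ _.
rewrite !ler_norml; clearbody e r1 r2 r3 m1 m2 m3 m4 m5.
move: (n%:R^-1) (t ^+ 3) => ni t3; lra.
Qed.

Hypothesis C_reg : second_order_regular K (copula law).
Hypothesis t_small : (1 + 4 * k) * t ^+ 2 <= 4^-1.

(** As 1/2 is a node, the indicators and the copula at (1/2, 1/2) are exact cell quantities: the
    linearizing sum is exactly 4 times the linear form in D of [empirical_copula_half], without mesh
    error. *)
Lemma blomqvist_error :
  `|blomqvist_hat x l m - blomqvist law l m
    - n%:R^-1 * \sum_i lin_blomqvist law l m (pit law (x i))|
  <= 4 * (4 * k * (2 + 4 * k) + 6 * (1 + 2 * k)
     + 2 * (2 * (`|K| * (16 / 3))) * (1 + 4 * k) ^+ 2) * t ^+ 3.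
Proof.
have nN : (n < N.+1)%N by rewrite ltnS leq_pmull.
pose h : 'I_N.+1 := Ordinal nN.
have hh : node h = 2^-1 :> R.
  by rewrite /node/= natrM; field; rewrite gt_eqF.
have [g1 g2] := bimargin_derive_le1 lm F_cont C_reg.
set c1 := derive1 _ _ in g1; set c2 := derive1 _ _ in g2.
have B0 : 0 <= 2 * (`|K| * (16 / 3)) :> R by rewrite mulr_ge0// mulr_ge0.
have tay (a b : 'I_N.+1) : 4^-1 <= (node a : R) <= 3 / 4 -> 4^-1 <= (node b :
  R) <= 3 / 4 ->
  `|cell_cdf p a b - cell_cdf p h h - c1 * (node a - 2^-1) - c2 * (node b -
    2^-1)| <=
  2 * (`|K| * (16 / 3)) * ((node a - 2^-1) ^+ 2 + (node b - 2^-1) ^+ 2).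
  by move=> a4 b4; rewrite !cell_law_cdf// hh; exact: copula_taylor.
have h1 := empirical_copula_half n_gt0 al bm k_ge0 t01 Nt pw pm cl t_small hh
  g1 g2 B0 tay.
have half i j : (tnth (pit law (x i)) j <= 2^-1) = (ix j i <= h)%N.
  by rewrite pit_index_le// hh.
have h2 : n%:R^-1 * \sum_i lin_blomqvist law l m (pit law (x i)) =
    4 * (rect_sum (fun z => ph z - p z) (fun a => (a <= h)%N) (fun b => (b <=
      h)%N)
      - c1 * rect_sum (fun z => ph z - p z) (fun a => (a <= h)%N) xpredT
      - c2 * rect_sum (fun z => ph z - p z) xpredT (fun b => (b <= h)%N)).
  have p1 : rect_sum p (fun a => (a <= h)%N) xpredT = 2^-1.
    by rewrite -[LHS]/(margin_cdf p h) margin_cdfE// hh.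
  have p2 : rect_sum p xpredT (fun b => (b <= h)%N) = 2^-1.
    rewrite -rect_sum_swap -[LHS]/(margin_cdf (swap_weights p) h).
    by rewrite margin_cdfE ?hh//; exact: uniform_margins_swap.
  have r1 : rect_sum ph (fun a => (a <= h)%N) xpredT =
      n%:R^-1 * \sum_i (ix l i <= h)%N%:R.
    by rewrite rect_sum_cell_freq; congr (_ * _); apply: eq_bigr => i _;
      rewrite andbT.
  have r2 : rect_sum ph xpredT (fun b => (b <= h)%N) =
      n%:R^-1 * \sum_i (ix m i <= h)%N%:R by rewrite rect_sum_cell_freq.
  rewrite !rect_sumB p1 p2 r1 r2 -/(cell_cdf p h h) rect_sum_cell_freq.
  rewrite (eq_bigr (fun i => 4 * ((ix l i <= h)%N && (ix m i <= h)%N)%:R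
    - 4 * (c1 * (ix l i <= h)%N%:R) - 4 * (c2 * (ix m i <= h)%N%:R)
    + 4 * (- bimargin law l m 2^-1 2^-1 + c1 / 2 + c2 / 2))); last first.
    by move=> i _; rewrite /lin_blomqvist -/c1 -/c2 !half; ring.
  rewrite big_split sumrB sumrB/= sumr_const card_ord -!mulr_sumr.
  rewrite cell_law_cdf// hh -[4 * _ *+ _]mulr_natr; field.
  by rewrite gt_eqF.
have h3 : blomqvist_hat x l m - blomqvist law l m =
    4 * (empirical_copula x l m 2^-1 2^-1 - cell_cdf p h h).
  by rewrite /blomqvist_hat /blomqvist cell_law_cdf// hh; ring.
by rewrite h2 h3 -mulrBr normrM ger0_norm// -[4 * _ * t ^+ 3]mulrA ler_pM2l.
Qed.

End PairError.

(** * Almost sure bounds *)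

Section UnionBound.
Context {R : realType} {dT : measure_display} {T : measurableType dT}
  {d n : nat} (P : probability T R) (law : probability (d.-tuple R) R).
Variables (X : 'I_n -> {RV P >-> d.-tuple R}).
Hypotheses (n_gt0 : (0 < n)%N) (iid : iid_sample law X).
Local Notation N := (2 * n)%N.
Local Notation J := 'I_N.+2.

Lemma prob_bigsetU_le (Z : eqType) (s : seq Z) (A : Z -> set T) (e : \bar R) :
  (0 <= e)%E -> (forall z, measurable (A z)) -> (forall z, P (A z) <= e)%E ->
  measurable (\big[setU/set0]_(z <- s) A z) /\
  (P (\big[setU/set0]_(z <- s) A z) <= (size s)%:R%:E * e)%E.
Proof.
move=> e0 mA Ae; elim: s => [|z s [mIH IH]].
  by rewrite big_nil measure0 mul0e.
rewrite big_cons; split; first exact: measurableU.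
apply: le_trans (measureU2 _ (mA z) mIH) _.
by rewrite /= -natr1 EFinD ge0_muleDl// mul1e addeC leeD.
Qed.

(** Endpoints take the N + 2 values 0, ..., N + 1, enough for half-open ranges to give every
    interval of indices, the empty one and the full one included. *)
Definition in_rect (l m : 'I_d) (r : (J * J) * (J * J)) (y : d.-tuple R) : bool
  :=
  (r.1.1 <= @pit_index R d law N l y < r.1.2)%N &&
  (r.2.1 <= @pit_index R d law N m y < r.2.2)%N.

Lemma measurable_in_rect l m r : measurable [set y | in_rect l m r y].
Proof.
have N0 : (0 < N)%N by rewrite muln_gt0.
have mc := @measurable_pit_cell R d law l m N N0.
exact: (measurable_finite_map mc (fun z : 'I_N.+1 * 'I_N.+1 =>
  (r.1.1 <= z.1 < r.1.2)%N && (r.2.1 <= z.2 < r.2.2)%N)).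
Qed.

Definition bad_event (k t : R) : set T :=
  \big[setU/set0]_(z : ('I_d * 'I_d) * ((J * J) * (J * J)))
    [set w | deviates law X (in_rect z.1.1 z.1.2 z.2) k t w].

Lemma bad_event_prob (k t : R) : 0 < t -> 0 <= k ->
  measurable (bad_event k t) /\
  (P (bad_event k t) <=
    ((d ^ 2 * (2 * n).+2 ^ 4)%N%:R *
     (2 * expR (- ((k - 1) / 2 * (n%:R * t ^+ 4)))))%:E)%E.
Proof.
move=> t0 k0; pose e : R := 2 * expR (- ((k - 1) / 2 * (n%:R * t ^+ 4))).
have e0 : (0 <= e%:E)%E by rewrite lee_fin mulr_ge0 ?expR_ge0.
have dev (z : ('I_d * 'I_d) * ((J * J) * (J * J))) :=
  deviation_prob iid (measurable_in_rect z.1.1 z.1.2 z.2) n_gt0 t0 k0.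
have [mB PB] := @prob_bigsetU_le _ (index_enum (('I_d * 'I_d) * ((J * J) * (J *
  J)))%type)
  (fun z => [set w | deviates law X (in_rect z.1.1 z.1.2 z.2) k t w]) e%:E e0
  (fun z => (dev z).1) (fun z => (dev z).2).
split => //; apply: (le_trans PB); rewrite -EFinM lee_fin -/e.
rewrite -sum1_size sum1_card !card_prod !card_ord.
by rewrite (_ : (d * d * _ = d ^ 2 * (2 * n).+2 ^ 4)%N)// -!mulnn !expnS expn0;
  lia.
Qed.

Lemma good_event (k t : R) (w : T) (l m : 'I_d) : ~ bad_event k t w ->
  rect_close k t (@cell_law R d law l m N)
    (@cell_freq R n N (fun i => pit_index law N l (X i w))
      (fun i => pit_index law N m (X i w))).
Proof.
move=> good A B [i1 [i2 Ai]] [j1 [j2 Bj]].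
have N0 : (0 < N)%N by rewrite muln_gt0.
(* Clipping a bound at N + 1 does not change the range, since indices are at most N. *)
pose c (i : nat) : J := inord (minn i N.+1).
have cE (i j : nat) (a : 'I_N.+1) : (i <= a < j)%N = (c i <= a < c j)%N.
  rewrite /c !inordK ?ltnS ?geq_minr//.
  have := ltn_ord a; rewrite leq_min geq_min; lia.
rewrite rect_sum_cell_law// rect_sum_cell_freq.
pose r := ((c i1, c i2), (c j1, c j2)).
have fE y : (A (pit_index law N l y) && B (pit_index law N m y)) = in_rect l m
  r y.
  by rewrite Ai Bj cE [X in _ && X]cE.
rewrite (_ : [set y | _] = [set y | in_rect l m r y]); last first.
  by apply: eq_set => y; rewrite fE.
rewrite (eq_bigr (fun i => (in_rect l m r (X i w))%:R)); last by move=> i _;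
  rewrite fE.
rewrite leNgt; apply/negP => dev; apply: good.
by rewrite /bad_event -bigcup_seq; exists ((l, m), r) => //=;
  rewrite mem_index_enum.
Qed.

End UnionBound.

(** The sum of the three constants, so that one bound, free of n and d, serves every [gamma]. *)
Definition lin_error_const {R : realType} (k K : R) : R :=
  (336 * k ^+ 2 + 216 * k + 270) + (480 * k ^+ 2 + 60 * k + 40) +
  4 * (4 * k * (2 + 4 * k) + 6 * (1 + 2 * k)
     + 2 * (2 * (`|K| * (16 / 3))) * (1 + 4 * k) ^+ 2).

Lemma max_lin_error_le {R : realType} {d n : nat} (law : probability (d.-tuple
  R) R)
    (x : 'I_n -> d.-tuple R) (k t K : R) (g : measure_kind) :
  (forall j, continuous (marginal_cdf law j)) ->
  second_order_regular K (copula law) ->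
  (2 <= n)%N -> 0 <= k -> 0 < t <= 1 -> 1 <= n%:R * t ^+ 4 ->
  (1 + 4 * k) * t ^+ 2 <= 4^-1 ->
  (forall l m, rect_close k t (@cell_law R d law l m (2 * n))
    (@cell_freq R n (2 * n) (fun i => pit_index law (2 * n) l (x i))
      (fun i => pit_index law (2 * n) m (x i)))) ->
  max_lin_error x law g <= lin_error_const k K * (Num.sqrt n%:R * t ^+ 3).
Proof.
move=> F_cont C_reg n2 k0 t01 nt ts close.
have n0 : (0 : R) < n%:R by rewrite ltr0n ltnW.
have t3 : 0 <= t ^+ 3 by case/andP: t01 => /ltW t0 _; rewrite exprn_ge0.
have k2 : 0 <= k ^+ 2 by rewrite sqr_ge0.
pose A := 336 * k ^+ 2 + 216 * k + 270; pose B := 480 * k ^+ 2 + 60 * k + 40.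
pose D := 4 * (4 * k * (2 + 4 * k) + 6 * (1 + 2 * k)
     + 2 * (2 * (`|K| * (16 / 3))) * (1 + 4 * k) ^+ 2).
have A0 : 0 <= A by rewrite /A; lra.
have B0 : 0 <= B by rewrite /B; lra.
have D0 : 0 <= D.
  by rewrite /D; do ![apply: mulr_ge0 => //|apply: addr_ge0 => //|exact:
    sqr_ge0].
have [c0 cA cB cD] : [/\ 0 <= lin_error_const k K, A <= lin_error_const k K,
    B <= lin_error_const k K & D <= lin_error_const k K].
  rewrite (_ : lin_error_const k K = A + B + D)//.
  by clearbody A B D; split; lra.
apply: bigmax_le => [|[l m] /= lm].
  by apply: mulr_ge0 => //; rewrite mulr_ge0 ?sqrtr_ge0.
have lm' : l != m by rewrite -val_eqE/= ltn_eqF.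
have -> : Num.sqrt n%:R * (assoc_hat x g l m - assoc law l m g) - lin_sum x law
  g l m =
    Num.sqrt n%:R * (assoc_hat x g l m - assoc law l m g -
      n%:R^-1 * \sum_(i < n) lin law l m g (pit law (x i))).
  rewrite /lin_sum [RHS]mulrBr; congr (_ - _); rewrite mulrA; congr (_ * _).
  rewrite -[in X in _ * X^-1](sqr_sqrtr (ltW n0)).
  by field; rewrite gt_eqF// sqrtr_gt0.
rewrite normrM ger0_norm ?sqrtr_ge0// mulrCA ler_wpM2l ?sqrtr_ge0//.
have cl := close l m.
case: g => /=.
- apply: (le_trans (spearman_error lm' F_cont n2 k0 t01 nt cl)).
  exact: ler_wpM2r cA.
- apply: (le_trans (kendall_error lm' F_cont n2 k0 t01 nt cl)).
  exact: ler_wpM2r cB.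
- apply: (le_trans (blomqvist_error lm' F_cont n2 k0 t01 nt cl C_reg ts)).
  exact: ler_wpM2r cD.
Qed.

(** * Orders of magnitude in n and d *)

Section Rates.
Context {R : realType} (d : nat -> nat).
Hypothesis d_ge2 : forall n : nat, (0 < n)%N -> (2 <= d n)%N.
Hypothesis log_d : (fun n : nat => ln (d n)%:R : R) =o_\oo
             (fun n : nat => n%:R `^ (3^-1) : R).

Definition log_size (n : nat) : R := ln ((n * d n)%N%:R).

Definition scale_param (n : nat) : R := (log_size n / n%:R) `^ 4^-1.

Definition rate (n : nat) : R := n%:R `^ (- 4^-1) * log_size n `^ (3 / 4).

Lemma log_sizeE (n : nat) : (0 < n)%N -> log_size n = ln n%:R + ln (d n)%:R.
Proof.
move=> n0; rewrite /log_size natrM lnM// posrE ltr0n//.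
by rewrite (leq_trans _ (d_ge2 n0)).
Qed.

Lemma log_size_ge (n : nat) : (0 < n)%N -> ln n%:R <= log_size n.
Proof.
move=> n0; rewrite log_sizeE// lerDl ln_ge0// ler1n.
by rewrite (leq_trans _ (d_ge2 n0)).
Qed.

Lemma log_size_gt0 (n : nat) : (1 < n)%N -> 0 < log_size n.
Proof.
move=> n1; apply: lt_le_trans (log_size_ge (ltnW n1)).
by rewrite ln_gt0// ltr1n.
Qed.

Lemma scale_param_gt0 (n : nat) : (1 < n)%N -> 0 < scale_param n.
Proof. by move=> n1; rewrite powR_gt0// divr_gt0 ?log_size_gt0// ltr0n ltnW.
  Qed.

Lemma scale_param4 (n : nat) : (1 < n)%N -> n%:R * scale_param n ^+ 4 =
  log_size n.
Proof.
move=> n1; have n0 : (0 : R) < n%:R by rewrite ltr0n ltnW.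
have q0 : 0 <= log_size n / n%:R by rewrite divr_ge0 ?ltW// log_size_gt0.
rewrite /scale_param -powR_mulrn ?powR_ge0// -powRrM mulVf// powRr1//.
by rewrite mulrC divfK// gt_eqF.
Qed.

Lemma rateE (n : nat) : (1 < n)%N -> Num.sqrt n%:R * scale_param n ^+ 3 = rate
  n.
Proof.
move=> n1; have n0 : (0 : R) < n%:R by rewrite ltr0n ltnW.
have L0 := ltW (log_size_gt0 n1).
rewrite /scale_param /rate -powR_mulrn ?powR_ge0// -powRrM.
rewrite powRM// ?invr_ge0 ?ltW// -powR12_sqrt ?ltW//.
rewrite -[n%:R^-1]powR_inv1 ?ltW// -powRrM mulrCA -powRD; last first.
  by rewrite (gt_eqF n0) implybT.
by rewrite mulrC; congr (_ `^ _ * _ `^ _); lra.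
Qed.

Lemma log_ratio_cvg0 : log_size n / n%:R `^ 3^-1 @[n --> \oo] --> (0 : R).
Proof.
have /eqoP ld := log_d.
apply/cvgrPdist_le => /= e e0.
have e2 : 0 < e / 2 by rewrite divr_gt0.
have := ld _ e2; rewrite /= => ld2.
near=> n.
have n1 : (1 < n)%N by near: n; exact: nbhs_infty_gt.
have n0 : (0 : R) < n%:R by rewrite ltr0n ltnW.
have p3 : 0 < n%:R `^ 3^-1 :> R by rewrite powR_gt0.
have p6 : 0 < n%:R `^ 6^-1 :> R by rewrite powR_gt0.
have L0 := ltW (log_size_gt0 n1).
rewrite sub0r normrN ger0_norm ?divr_ge0 ?powR_ge0//.
rewrite ler_pdivrMr// log_sizeE 1?ltnW//.
have -> : e = e / 2 + e / 2 by lra.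
rewrite mulrDl lerD//; last first.
  have h : `|ln (d n)%:R| <= e / 2 * `|n%:R `^ 3^-1| :> R by near: n.
  by apply: (le_trans (ler_norm _)); rewrite (ger0_norm (powR_ge0 _ _)) in h.
have -> : n%:R `^ 3^-1 = n%:R `^ 6^-1 * n%:R `^ 6^-1 :> R.
  rewrite -powRD; last by rewrite (gt_eqF n0) implybT.
  by congr (_ `^ _); lra.
(* From ln y < y at y = n^(1/6); the exponent 1/6 leaves another factor n^(1/6) of n^(1/3) to absorb
   the constants. *)
have lnn : ln n%:R <= 6 * n%:R `^ 6^-1 :> R.
  have -> : ln n%:R = 6 * ln (n%:R `^ 6^-1) :> R by rewrite ln_powR mulrA divff
    ?mul1r.
  by rewrite ler_pM2l// ltW// ln_sublinear.
apply: (le_trans lnn); rewrite mulrA ler_pM2r// -ler_pdivrMl// invf_div.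
have c0 : 0 <= 2 / e * 6 by rewrite mulr_ge0// divr_ge0// ltW.
have -> : 2 / e * 6 = ((2 / e * 6) ^+ 6) `^ 6^-1.
  by rewrite -powR_mulrn// -powRrM divff// powRr1.
apply: ge0_ler_powR; rewrite ?nnegrE ?invr_ge0 ?exprn_ge0 ?(ltW n0)//.
by near: n; exact: nbhs_infty_ger.
Unshelve. all: by end_near. Qed.

Lemma scale_param_small (e : R) : 0 < e ->
  \forall n \near \oo, scale_param n ^+ 4 <= e.
Proof.
move=> e0; have /cvgrPdist_le/(_ _ e0) c := log_ratio_cvg0.
near=> n.
have n1 : (1 < n)%N by near: n; exact: nbhs_infty_gt.
have n0 : (0 : R) < n%:R by rewrite ltr0n ltnW.
have L0 := ltW (log_size_gt0 n1).
have h : `|0 - log_size n / n%:R `^ 3^-1| <= e by near: n.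
rewrite sub0r normrN ger0_norm ?divr_ge0 ?powR_ge0// in h.
apply: le_trans h; rewrite -(ler_pM2l n0) scale_param4//.
rewrite mulrCA -[leLHS]mulr1 ler_wpM2l// ler_pdivlMr ?powR_gt0// mul1r.
rewrite -[leRHS]powRr1 ?(ltW n0)// ler_powR//; first by rewrite ler1n ltnW.
by rewrite invf_le1// ler1n.
Unshelve. all: by end_near. Qed.

(** The rate is exactly the power 3/4 of ln (n d) / n^(1/3), which is the origin of the exponent 1/3
    in the growth condition. *)
Lemma rate_cvg0 : rate n @[n --> \oo] --> (0 : R).
Proof.
apply/cvgrPdist_le => /= e e0.
have e43 : 0 < e `^ (4 / 3) by rewrite powR_gt0.
have /cvgrPdist_le/(_ _ e43) c := log_ratio_cvg0.
near=> n.
have n1 : (1 < n)%N by near: n; exact: nbhs_infty_gt.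
have n0 : (0 : R) < n%:R by rewrite ltr0n ltnW.
have L0 := ltW (log_size_gt0 n1).
have h : `|0 - log_size n / n%:R `^ 3^-1| <= e `^ (4 / 3) by near: n.
have q0 : 0 <= log_size n / n%:R `^ 3^-1 by rewrite divr_ge0 ?powR_ge0.
rewrite sub0r normrN ger0_norm// in h.
rewrite sub0r normrN ger0_norm ?mulr_ge0 ?powR_ge0//.
have -> : rate n = (log_size n / n%:R `^ 3^-1) `^ (3 / 4).
  rewrite powRM// ?invr_ge0 ?powR_ge0// mulrC /rate; congr (_ * _).
  by rewrite -powRN -powRrM; congr (_ `^ _); lra.
have -> : e = (e `^ (4 / 3)) `^ (3 / 4).
  rewrite -powRrM -[LHS]powRr1 ?ltW//; congr (_ `^ _); lra.
by apply: ge0_ler_powR => //; rewrite ?nnegrE ?powR_ge0.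
Unshelve. all: by end_near. Qed.

(** As 2 n + 2 <= 4 n, the product is at most 2 * 4^4 n^-2 d^-4, and d^-4 <= 1. *)
Lemma bad_prob_rate (n : nat) : (1 < n)%N ->
  (d n ^ 2 * (2 * n).+2 ^ 4)%N%:R *
     (2 * expR (- ((13 - 1) / 2 * (n%:R * scale_param n ^+ 4)))) <= 2 * 4 ^+ 4
       / n%:R ^+ 2 :> R.
Proof.
move=> n1; have n0 : (0 : R) < n%:R by rewrite ltr0n ltnW.
have d1 : (1 : R) <= (d n)%:R by rewrite ler1n (leq_trans _ (d_ge2 (ltnW n1))).
have d0 : (0 : R) < (d n)%:R by exact: lt_le_trans d1.
rewrite scale_param4// (_ : (13 - 1) / 2 = 6%:R :> R); last by lra.
rewrite natrM !natrX expRN expRM_natl /log_size natrM lnK ?posrE ?mulr_gt0//.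
have n4 : (2 * n).+2%:R <= 4 * n%:R :> R by rewrite -natrM ler_nat; lia.
have n44 : (2 * n).+2%:R ^+ 4 <= (4 * n%:R) ^+ 4 :> R.
  by rewrite lerXn2r ?nnegrE ?mulr_ge0 ?(ltW n0)//.
apply: (@le_trans _ _ ((d n)%:R ^+ 2 * (4 * n%:R) ^+ 4 * (2 / (n%:R * (d n)%:R)
  ^+ 6))).
  by rewrite ler_wpM2r ?mulr_ge0 ?invr_ge0 ?exprn_ge0 ?mulr_ge0 ?(ltW n0)//
    ler_wpM2l ?sqr_ge0.
have -> : (d n)%:R ^+ 2 * (4 * n%:R) ^+ 4 * (2 / (n%:R * (d n)%:R) ^+ 6) =
    2 * 4 ^+ 4 / n%:R ^+ 2 / (d n)%:R ^+ 4 :> R by field; rewrite !gt_eqF.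
have c0 : 0 <= 2 * 4 ^+ 4 / n%:R ^+ 2 :> R.
  by rewrite divr_ge0 ?sqr_ge0// mulr_ge0// exprn_ge0.
by rewrite ler_piMr// invf_le1 ?exprn_gt0// exprn_ege1.
Qed.

Lemma sum_inv_square_le (c : R) (m : nat) : 0 <= c ->
  \sum_(0 <= i < m) (if (i < 2)%N then 0 else c / i%:R ^+ 2) <= c.
Proof.
move=> c0; pose u i : R := if (i < 2)%N then 0 else c / i%:R ^+ 2.
have u0 i : 0 <= u i by rewrite /u; case: ifP => // _;
  rewrite mulr_ge0 ?invr_ge0 ?sqr_ge0.
(* Telescoping, from 1 / (a + 1)^2 <= 1/a - 1/(a + 1). *)
have S j : \sum_(0 <= i < j.+2) u i <= c * (1 - j.+1%:R^-1).
  elim: j => [|j IH].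
    by rewrite 2?big_nat_recr//= big_geq// /u/= !addr0 invr1 subrr mulr0.
  rewrite big_nat_recr//=; apply: (le_trans (lerD IH (lexx _))).
  rewrite /u /= -[j.+2%:R]natr1.
  have j0 : (0 : R) < j.+1%:R by rewrite ltr0n.
  move: (j.+1%:R : R) j0 => a a0; rewrite -subr_ge0.
  have -> : c * (1 - (a + 1)^-1) - (c * (1 - a^-1) + c / (a + 1) ^+ 2) =
    c / (a * (a + 1) ^+ 2).
    by field; rewrite !gt_eqF// addr_gt0.
  by rewrite divr_ge0// mulr_ge0 ?sqr_ge0// ltW.
have Sm : \sum_(0 <= i < m) u i <= \sum_(0 <= i < m.+2) u i.
  by rewrite !big_nat_recr//= -addrA lerDl addr_ge0.
apply: (le_trans Sm); apply: (le_trans (S m)).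
by rewrite ler_piMr// gerBl invr_ge0.
Qed.

End Rates.

Theorem proposition3p1 (R : realType) (dT : measure_display)
    (T : measurableType dT) (P : probability T R)
    (d : nat -> nat)
    (law : forall n : nat, probability ((d n).-tuple R) R)
    (X : forall n : nat, 'I_n -> {RV P >-> (d n).-tuple R})
    (K : R) (gamma : measure_kind)
    (d_ge2 : forall n : nat, (0 < n)%N -> (2 <= d n)%N)
    (X_iid : forall n : nat, (0 < n)%N -> iid_sample (law n) (X n))
    (F_cont : forall (n : nat) (j : 'I_(d n)), (0 < n)%N ->
      continuous (marginal_cdf (law n) j))
    (C_reg : forall n : nat, (0 < n)%N ->
      second_order_regular K (copula (law n)))
    (log_d : (fun n : nat => ln (d n)%:R : R) =o_\oo
             (fun n : nat => n%:R `^ (3^-1) : R)) :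
  let Z := fun (n : nat) (w : T) =>
    max_lin_error (fun i : 'I_n => X n i w) (law n) gamma in
  bigO_as P Z
    (fun n : nat => n%:R `^ (- 4^-1) * ln ((n * d n)%N%:R) `^ (3 / 4)) /\
  littleo1_as P Z.
Proof.
move=> Z.
pose t (n : nat) : R := scale_param d n.
(* The rows 0 and 1 get an empty event: the estimates ask for n >= 2, and finitely many rows do not
   affect the limits. *)
pose B (n : nat) : set T :=
  if (n < 2)%N then set0 else bad_event (law n) (X n) 13 (t n).
have k0 : 0 <= 13 :> R by [].
have t0 n : (1 < n)%N -> 0 < t n by move=> n1; exact: scale_param_gt0.
pose c : R := 2 * 4 ^+ 4.
have c0 : 0 <= c by rewrite mulr_ge0// exprn_ge0.
have mB n : measurable (B n).
  rewrite /B; case: ltnP => // n1.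
  by have [] := bad_event_prob (ltnW n1) (X_iid n (ltnW n1)) (t0 n n1) k0.
have PB n : (P (B n) <= (if (n < 2)%N then 0 else c / n%:R ^+ 2)%:E)%E.
  rewrite /B; case: ltnP => n1; first by rewrite measure0.
  have [_ h] := bad_event_prob (ltnW n1) (X_iid n (ltnW n1)) (t0 n n1) k0.
  by apply: (le_trans h); rewrite lee_fin; exact: bad_prob_rate.
have sumB : (\sum_(n <oo) P (B n) < +oo)%E.
  apply: (@le_lt_trans _ _ c%:E); last by rewrite ltry.
  apply: lime_le; first by apply: is_cvg_nneseries => *.
  apply: nearW => m; apply: (@le_trans _ _ (\sum_(0 <= i < m)
      (if (i < 2)%N then 0 else c / i%:R ^+ 2)%:E)%E).
    by apply: lee_sum => i _; exact: PB.
  by rewrite sumEFin lee_fin sum_inv_square_le.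
have PB0 := lim_sup_set_cvg0 mB sumB.
have good w : ~ lim_sup_set B w -> \forall n \near \oo,
    Z n w <= lin_error_const 13 K * rate d n.
  move=> nw.
  have [n0 n0B] : exists n0, forall n, (n0 <= n)%N -> ~ B n w.
    apply: contrapT => h; apply: nw => n _; apply: contrapT => h'; apply: h.
    by exists n => j nj Bj; apply: h'; exists j.
  (* At k = 13, t^2 <= e is the condition (1 + 4 k) t^2 <= 1/4 of the Blomqvist bound; it also
     implies t <= 1. *)
  pose e : R := (4 * (1 + 4 * 13))^-1.
  have e0 : 0 < e by rewrite invr_gt0 mulr_gt0// addr_gt0// mulr_gt0.
  have e2 : 0 < e ^+ 2 by rewrite exprn_gt0.
  near=> n.
  have n1 : (1 < n)%N by near: n; exact: nbhs_infty_gt.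
  have n0R : (0 : R) < n%:R by rewrite ltr0n ltnW.
  have tn0 := t0 n n1.
  have ts4 : t n ^+ 4 <= e ^+ 2.
    by near: n; exact: (scale_param_small d_ge2 log_d e2).
  have ts : t n ^+ 2 <= e.
    by rewrite -ler_sqr ?nnegrE ?sqr_ge0 ?(ltW e0)// -exprM.
  have e1 : e <= 1.
    by rewrite invf_le1 ?mulr_gt0 ?addr_gt0 ?mulr_gt0//; lra.
  have t1 : t n <= 1.
    by rewrite -(@expr_le1 _ 2) ?(ltW tn0)// (le_trans ts).
  (* Here n t^4 is ln (n d), which is at least 1 as soon as n >= exp(1). *)
  have L1 : 1 <= n%:R * t n ^+ 4.
    rewrite /t scale_param4//; apply: le_trans (log_size_ge d_ge2 (ltnW n1)).
    rewrite -[leLHS](expRK 1) ler_ln ?posrE ?expR_gt0//.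
    by near: n; exact: nbhs_infty_ger.
  have Bn : ~ bad_event (law n) (X n) 13 (t n) w.
    have := n0B n; rewrite /B ltnNge n1/=; apply.
    by near: n; exact: nbhs_infty_ge.
  rewrite /Z -rateE//; apply: max_lin_error_le => //.
  - by move=> j; apply: F_cont; exact: ltnW.
  - by apply: C_reg; exact: ltnW.
  - by rewrite tn0.
  - by rewrite -ler_pdivlMl ?addr_gt0 ?mulr_gt0// -invfM mulrC.
  - by move=> l m; apply: good_event => //; exact: ltnW.
have Z0 n w : 0 <= Z n w by apply: bigmax_ge_id.
(* The same null set serves both conclusions. *)
have ae (Q : T -> Prop) : (forall w, ~ lim_sup_set B w -> Q w) -> {ae P, forall
  w, Q w}.
  move=> h; exists (lim_sup_set B); split => //.
    by apply: bigcap_measurable => // k _; apply: bigcup_measurable.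
  by move=> w /= nQ; apply: contrapT => /h.
split; apply: ae => w /good gw.
  apply: (@le_lt_trans _ _ (lin_error_const 13 K)%:E); last by rewrite ltry.
  (* The upper limit is an infimum, over neighbourhoods of infinity, of suprema, so one
     neighbourhood suffices. The condition n > 1 makes the rate positive throughout it. *)
  pose V := [set n : nat | (1 < n)%N /\ Z n w <= lin_error_const 13 K * rate d
    n].
  have Voo : \oo V.
    by near=> n; split; near: n => //; exact: nbhs_infty_gt.
  apply: (@le_trans _ _ (ereal_sup ((fun n => (`|Z n w| /
      (n%:R `^ (- 4^-1) * ln ((n * d n)%N%:R) `^ (3 / 4)))%:E) @` V))).
    by apply: ereal_inf_lbound; exists V.
  apply: ge_ereal_sup => _ [n [n1 Zn] <-]; rewrite lee_fin.
  have r0 : 0 < rate d n :> R.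
    apply: mulr_gt0; rewrite powR_gt0 ?ltr0n 1?ltnW//.
    exact: (log_size_gt0 d_ge2).
  by rewrite -/(log_size d n) -/(rate d n) ler_pdivrMr// ger0_norm.
apply: (@squeeze_cvgr _ _ _ _ (fun=> 0) (fun n => lin_error_const 13 K * rate d
  n)).
- by near=> n; rewrite Z0/=; near: n.
- exact: cvg_cst.
- rewrite -[X in _ --> X](mulr0 (lin_error_const 13 K)).
  apply: cvgM; [exact: cvg_cst|exact: (rate_cvg0 d_ge2 log_d)].
Unshelve. all: by end_near. Qed.
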